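(* Let $F_\bullet:\mathbb{C}\times\mathbb{C}^n\to\mathbb{C}^n$, $(t,x)\mapsto F_t(x)$, be a polynomial map given by an arithmetic circuit. Let $(x,r,A)$ be a $\frac78$-Moore box for $F_0$ with associated zero $\zeta$. Let $I\subseteq\mathbb{R}$ and $Z:I\to\mathbb{C}^n$ be the maximal interval and the continuation of the zero $\zeta$, as defined in the context. Then the path tracking algorithm with the tangent predictor described in the context, on input $F_\bullet,x,r,A$, terminates if and only if $1\in I$. In this case, it outputs a $\frac78$-Moore box for $F_1$ with associated zero $Z_1$.
   Context: **Norm, Moore boxes.** $\|\cdot\|$ is the norm on $\mathbb{C}^n$ given by $\|(z_1,\dots,z_n)\|=\max_i\max(|\mathrm{Re}\,z_i|,|\mathrm{Im}\,z_i|)$ and $B$ is its closed unit ball. For a polynomial map $f:\mathbb{C}^n\to\mathbb{C}^n$ and $\rho\in(0,1)$, a $\rho$-Moore box for $f$ is a triple $(x,r,A)\in\mathbb{C}^n\times\mathbb{R}_{>0}\times\mathbb{C}^{n\times n}$ such that $\|-r^{-1}Af(x)+(I_n-A\,\mathrm{d}f(x+ru))v\|\le\rho$ for all $u,v\in B$. There is then a unique zero of $f$ in $x+rB$, called the associated zero of the box, and $\mathrm{d}f$ is invertible there. **Continuation.** $\mathrm{d}F_t$ is the differential of $F_t:\mathbb{C}^n\to\mathbb{C}^n$ and $\dot F_t$ the partial derivative of $F_t$ with respect to $t$. For a regular zero $\zeta$ of $F_0$ (i.e. $F_0(\zeta)=0$ and $\mathrm{d}F_0(\zeta)$ invertible),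 $I\subseteq\mathbb{R}$ is the unique open interval containing $0$, and $Z:I\to\mathbb{C}^n$, $t\mapsto Z_t$, the unique continuous function, such that: (i) $Z_0=\zeta$; (ii) $F_t(Z_t)=0$ for all $t\in I$; (iii) if $b\in\overline I\setminus I$, then either $\lim_{t\to b}\|Z_t\|=\infty$ or $\lim_{t\to b}\det(\mathrm{d}F_t(Z_t))=0$. Concretely, $(I,Z)$ is the maximal solution of the differential equation $\frac{\mathrm{d}}{\mathrm{d}t}Z_t=-\mathrm{d}F_t(Z_t)^{-1}\cdot\dot F_t(Z_t)$, $Z_0=\zeta$. **Circuits.** An arithmetic circuit with input space $\mathbb{C}^N$ is a directed acyclic multigraph whose nodes are input nodes (labelled in $\{1,\dots,N\}$), constant nodes, and addition and multiplication nodes with exactly two incoming edges; each node computes a polynomial function in the obvious way, and a tuple of $m$ nodes represents a polynomial map to $\mathbb{C}^m$. Circuits for derivatives are obtained by automatic differentiation. Constants of circuits are representable (see below). **Interval arithmetic with adaptive precision.** $\mathbb{F}\subset\mathbb{R}$ is the set of representable numbers (for instance the dyadic numbers $a2^b$, $a,b\in\mathbb{Z}$). $\square\mathbb{R}$ is the set of nonempty compact intervals with endpoints in $\mathbb{F}$; $\square\mathbb{C}$ is the set of pairs of elements of $\square\mathbb{R}$ (real and imaginary parts); $\square\mathbb{C}^n$ is the set of vectors of such boxes, viewed as subsets of $\mathbb{C}^n$. There are operations $\boxplus,\boxtimes$ on $\square\mathbb{R}$, depending on a parameter $u_{\mathrm{prec}}\in(0,1)$ (the unit roundoff, which the algorithm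 may change), with $x+y\in I\boxplus J$ and $xy\in I\boxtimes J$ for $x\in I$, $y\in J$, and such that for any $M\ge1$ and any $[a,b],[c,d]\in\square\mathbb{R}$ included in $[-M,M]$, $[a,b]\boxplus[c,d]\subseteq[a+c-Mu_{\mathrm{prec}},\,b+d+Mu_{\mathrm{prec}}]$ and $[a,b]\boxtimes[c,d]\subseteq[\min(ac,ad,bc,bd)-M^2u_{\mathrm{prec}},\,\max(ac,ad,bc,bd)+M^2u_{\mathrm{prec}}]$. These operations are extended to complex boxes, vectors and matrices in the obvious way. For a map $f$ given by a circuit, $\square f$ and $\square\mathrm{d}f$ are the natural interval extensions, obtained by evaluating the circuits of $f$ and $\mathrm{d}f$ with $\boxplus,\boxtimes$ and replacing constants $c$ by $[c,c]$; $\square\dot F_t$ is obtained likewise from a circuit for $\dot F_t$. For a box $X$: $\mathrm{width}(X)=\sup_{x,y\in X}\|x-y\|$, $\|X\|_\square=\sup_{x\in X}\|x\|$, and $\mathrm{mid}(X)$ is some representable element of $X$ (usually as close as possible to its center). Moore boxes used as data have representable $x,r,A$. **Taylor models.** Let $J_0\in\square\mathbb{R}$ contain $0$. A Taylor model of order $\nu$ on $J_0$ is a polynomial $P(\eta)=a_0+a_1\eta+\dots+a_{\nu+1}\eta^{\nu+1}$ with $a_i\in\square\mathbb{C}$. It encloses a function $g$ if for every $e\in J_0$ there are $\bar a_i\in a_i$ with $g(e)=\sum_i\bar a_ie^i$. For a subinterval $J\subseteq J_0$, $P(J)$ is the box obtained by evaluating $P$ on $J$ in interval arithmetic. A model of order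 $\nu$ is squeezed to one of order $\nu-1$ by replacing $a_\nu\eta^\nu+a_{\nu+1}\eta^{\nu+1}$ with $(a_\nu\boxplus(a_{\nu+1}\boxtimes J_0))\eta^\nu$. Models of order $\nu$ are added coefficientwise with $\boxplus$; they are multiplied by the polynomial multiplication formula using $\boxplus,\boxtimes$, followed by repeated squeezing back to order $\nu$. $\square F_{t+\eta}$ and $\square\mathrm{d}F_{t+\eta}$ are evaluated by running the circuits in Taylor model arithmetic, with the parameter input replaced by the model $t+\eta$; numbers and boxes are viewed as constant models. **Test $\mathtt{M}$.** $\mathtt{M}(\square f,\square\mathrm{d}f,x,r,A,\rho)$ computes in interval arithmetic the box $K=-r^{-1}A\cdot\square f(x)+(I_n-A\cdot\square\mathrm{d}f(x+rB))\cdot B$ and returns True if and only if $\|K\|_\square\le\rho$. **Algorithm $\mathtt{refine}(f,x,r,A,\tau)$** (input: a $\frac78$-Moore box $(x,r,A)$ for $f$, and $\tau\in(0,1)$). 1. $y\gets x$; $s\gets r$; $U\gets A$. 2. While $\mathtt{M}(\square f,\square\mathrm{d}f,y,s,U,\tau)$ is not True, do: (a) $\delta\gets A\cdot\square f(y)$ (interval arithmetic). (b) If $\|\delta\|_\square\le\frac1{64}\tau s$: set $s\gets\frac12s$, and then, if $s<\frac1{16}\tau r$, increase the precision enough so that $u_{\mathrm{prec}}=o(s)$. Else if $\mathrm{width}(y-\delta)>\frac1{40}\|\delta\|_\square$: increase the working precision. Else: $y\gets\mathrm{mid}(y-\delta)$. (c) (in all cases) $U\gets\mathrm{mid}(\square\mathrm{d}f(y))^{-1}$,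 computed in unchecked arithmetic. 3. While $2s\le1$ and $\mathtt{M}(\square f,\square\mathrm{d}f,y,2s,U,\tau)$ is True: $s\gets2s$. 4. Return $(y,s,U)$. **Path tracking algorithm with the tangent predictor**, on input $F_\bullet,x,r,A$: 1. $t\gets0$; $h\gets\frac12$. 2. While $t<1$, do: (a) $(x,r,A)\gets\mathtt{refine}(F_t,x,r,A,\frac18)$. (b) $h\gets\frac54h$. (c) $v\gets\mathrm{mid}(-A\cdot\square\dot F_t(x))$; $\mathcal{X}(\eta)\gets x+v\eta$. (d) Compute, with order-2 Taylor model arithmetic on $[0,h]$, $\mathcal{K}\gets-r^{-1}A\cdot\square F_{t+\eta}(\mathcal{X})+[I_n-A\cdot\square\mathrm{d}F_{t+\eta}(\mathcal{X}+rB)]\cdot B$. (e) If $\|\mathcal{K}([0,h])\|_\square>\frac78$: set $h\gets\frac h2$ and $u_{\mathrm{prec}}\gets\min(u_{\mathrm{prec}},h)$; then, if $\|\mathcal{K}([0,h])\|_\square>\frac78$ for this new $h$, go directly to the next iteration of the loop 2 (with $t$ unchanged). (f) $t\gets t+h$; $x\gets\mathrm{mid}(\mathcal{X}(h))$. 3. Return $(x,r,A)$. Conventions: increasing the working precision means lowering $u_{\mathrm{prec}}$, and doing so infinitely often makes $u_{\mathrm{prec}}\to0$; ''increase the precision enough so that $u_{\mathrm{prec}}=o(s)$'' means that $u_{\mathrm{prec}}$ is lowered in such a way that it goes to $0$ faster than $s$. The computation of $U$ in step 2(c) of $\mathtt{refine}$ need not be performed in interval arithmetic, but the distance from $U$ to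 $\mathrm{d}f(y)^{-1}$ must go to zero as $u_{\mathrm{prec}}\to0$.
   Formalization: Steps may overshoot t=1 (e.g. F_t(z)=z-10t), so the output is claimed for F_t, Z_t at the final t≥1, and for F_1, Z_1 if steps are capped at 1-t; mid(X(h)) is exactly x+vh; dividing by r has its own error bound Mu; representable numbers form a ring containing 1/2. *)

(* Defs.v *)
From mathcomp Require Import all_boot all_order all_algebra.
From mathcomp Require Import complex.
From mathcomp Require Import all_classical all_reals all_analysis.
From mathcomp Require mpoly.

Set Implicit Arguments.
Unset Strict Implicit.
Unset Printing Implicit Defensive.

Import Order.TTheory GRing.Theory Num.Theory.
Import numFieldNormedType.Exports.

Local Open Scope classical_set_scope.
Local Open Scope ring_scope.
Local Open Scope complex_scope.

Section Moore.
Variable R : realType.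

Definition cabs (z : R[i]) : R := Num.max `|complex.Re z| `|complex.Im z|.

(* On column vectors this is the norm max_i max(|Re z_i|, |Im z_i|); on square
   matrices it is the entrywise norm, used only to express convergence. *)
Definition cnorm m p (A : 'M[R[i]]_(m, p)) : R :=
  \big[Num.max/0]_i \big[Num.max/0]_j cabs (A i j).

Definition unit_ball n : set 'cV[R[i]]_n := [set v | cnorm v <= 1].

Record mbox n := MBox {
  box_ctr : 'cV[R[i]]_n;
  box_rad : R;
  box_mat : 'M[R[i]]_n }.

(* [df] is meant to be the differential of [f]. *)
Definition moore_box n (f : 'cV[R[i]]_n -> 'cV[R[i]]_n)
    (df : 'cV[R[i]]_n -> 'M[R[i]]_n) (rho : R) (m : mbox n) : Prop :=
  0 < box_rad m /\
  forall u v, unit_ball u -> unit_ball v ->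
    cnorm (- ((box_rad m)^-1)%:C *: (box_mat m *m f (box_ctr m))
           + (1%:M - box_mat m *m df (box_ctr m + (box_rad m)%:C *: u)) *m v) <= rho.

Definition associated_zero n (f : 'cV[R[i]]_n -> 'cV[R[i]]_n) (m : mbox n)
    (zeta : 'cV[R[i]]_n) : Prop :=
  unique (fun z => f z = 0 /\
            exists2 u, unit_ball u & z = box_ctr m + (box_rad m)%:C *: u) zeta.

(* The point (t, x) of T * T^n: coordinate 0 is the parameter. *)
Definition point T n (t : T) (x : 'cV[T]_n) : 'I_n.+1 -> T :=
  fun k => oapp (fun j => x j ord0) t (unlift ord0 k).

Definition polymx N m p := 'M[mpoly.mpoly N R[i]]_(m, p).

Definition at_point n m p (P : polymx n.+1 m p) (t : R) (x : 'cV[R[i]]_n) :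
    'M[R[i]]_(m, p) :=
  map_mx (mpoly.meval (point t%:C x)) P.

Definition jacobian_x n (F : polymx n.+1 n 1) : polymx n.+1 n n :=
  \matrix_(i, j) mpoly.mderiv (lift ord0 j) (F i ord0).

Definition derivative_t n (F : polymx n.+1 n 1) : polymx n.+1 n 1 :=
  map_mx (mpoly.mderiv ord0) F.

Definition moore_box_at n (F : polymx n.+1 n 1) (t : R) :=
  moore_box (at_point F t) (at_point (jacobian_x F) t).

(* [cont_regular] is part of the characterisation of Z as the maximal solution
   of Z' = - dF_t(Z)^-1 . dF/dt: without it a path could cross a singular zero
   and (I, Z) would not be unique. *)
Record continuation n (F : polymx n.+1 n 1) (zeta : 'cV[R[i]]_n)
    (I : set R) (Z : R -> 'cV[R[i]]_n) : Prop := Continuation {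
  cont_open : open I;
  cont_interval : is_interval I;
  cont_mem0 : I 0;
  cont_continuous : forall i,
    {within I, continuous (fun t => complex.Re (Z t i ord0))} /\
    {within I, continuous (fun t => complex.Im (Z t i ord0))};
  cont_init : Z 0 = zeta;
  cont_zero : forall t, I t -> at_point F t (Z t) = 0;
  cont_regular : forall t, I t -> \det (at_point (jacobian_x F) t (Z t)) != 0;
  cont_maximal : forall b, closure I b -> ~ I b ->
    (cnorm (Z t) @[t --> within I (nbhs b)] --> +oo) \/
    (cabs (\det (at_point (jacobian_x F) t (Z t)))
       @[t --> within I (nbhs b)] --> (0 : R)) }.

End Moore.

Section Circuits.
Variable R : realType.

(* The nodes of the graph are listed in a topological order, and the two
   incoming edges of an addition or multiplication node are given by the
   positions of their origins. *)
Inductive gate (N : nat) :=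
| GInput of 'I_N
| GConst of R[i]
| GAdd of nat & nat
| GMul of nat & nat.

Record circuit (N m p : nat) := Circuit {
  gates : seq (gate N);
  outs : 'M[nat]_(m, p) }.

Definition gate_value N T (cst : R[i] -> T) (add mul : T -> T -> T)
    (inp : 'I_N -> T) (vals : seq T) (g : gate N) : T :=
  match g with
  | GInput i => inp i
  | GConst c => cst c
  | GAdd j k => add (nth (cst 0) vals j) (nth (cst 0) vals k)
  | GMul j k => mul (nth (cst 0) vals j) (nth (cst 0) vals k)
  end.

Definition circuit_eval N m p T (cst : R[i] -> T) (add mul : T -> T -> T)
    (c : circuit N m p) (inp : 'I_N -> T) : 'M[T]_(m, p) :=
  let vals := foldl
    (fun vs g => rcons vs (gate_value cst add mul inp vs g)) [::] (gates c) in
  map_mx (nth (cst 0) vals) (outs c).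

Definition represents N m p (c : circuit N m p) (P : polymx R N m p) : Prop :=
  forall z : 'I_N -> R[i],
    circuit_eval id +%R *%R c z = map_mx (mpoly.meval z) P.

End Circuits.

Record ival (R : realType) := Ival { lo : R; hi : R }.

Definition in_ival (R : realType) (I : ival R) : set R :=
  [set x | lo I <= x <= hi I].

Definition bounded_by (R : realType) (M : R) (I : ival R) : Prop :=
  - M <= lo I /\ hi I <= M.

Definition is_ival (R : realType) (rep : {pred R}) (I : ival R) : Prop :=
  [/\ lo I \in rep, hi I \in rep & lo I <= hi I].

(* [rep] is a ring containing 1/2 (as the dyadic numbers are) so that t + h,
   5h/4, s/2, 2s, x + hv, formed exactly by the algorithm, are representable.
   As [rep] need not be closed under inversion, the scaling by r^-1 is an
   operation of its own, [idiv], whose error is relative to its result. *)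
Record interval_arith (R : realType) := IntervalArith {
  rep : {pred R};
  rep_subring : subring_closed rep;
  rep_half : 2^-1 \in rep;
  iadd : R -> ival R -> ival R -> ival R;
  imul : R -> ival R -> ival R -> ival R;
  idiv : R -> ival R -> R -> ival R;
  iadd_ival : forall u I J, 0 < u < 1 -> is_ival rep I -> is_ival rep J ->
    is_ival rep (iadd u I J);
  iadd_incl : forall u I J x y, 0 < u < 1 -> is_ival rep I -> is_ival rep J ->
    in_ival I x -> in_ival J y -> in_ival (iadd u I J) (x + y);
  iadd_tight : forall u M I J, 0 < u < 1 -> 1 <= M ->
    is_ival rep I -> is_ival rep J -> bounded_by M I -> bounded_by M J ->
    lo I + lo J - M * u <= lo (iadd u I J) /\
    hi (iadd u I J) <= hi I + hi J + M * u;
  imul_ival : forall u I J, 0 < u < 1 -> is_ival rep I -> is_ival rep J ->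
    is_ival rep (imul u I J);
  imul_incl : forall u I J x y, 0 < u < 1 -> is_ival rep I -> is_ival rep J ->
    in_ival I x -> in_ival J y -> in_ival (imul u I J) (x * y);
  imul_tight : forall u M I J, 0 < u < 1 -> 1 <= M ->
    is_ival rep I -> is_ival rep J -> bounded_by M I -> bounded_by M J ->
    let: (a, b, c, d) := (lo I, hi I, lo J, hi J) in
    Num.min (Num.min (a * c) (a * d)) (Num.min (b * c) (b * d)) - M ^+ 2 * u
      <= lo (imul u I J) /\
    hi (imul u I J) <=
      Num.max (Num.max (a * c) (a * d)) (Num.max (b * c) (b * d)) + M ^+ 2 * u;
  idiv_ival : forall u I r, 0 < u < 1 -> is_ival rep I -> r \in rep -> 0 < r ->
    is_ival rep (idiv u I r);
  idiv_incl : forall u I r x, 0 < u < 1 -> is_ival rep I -> r \in rep -> 0 < r ->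
    in_ival I x -> in_ival (idiv u I r) (x / r);
  idiv_tight : forall u M I r, 0 < u < 1 -> 1 <= M ->
    is_ival rep I -> r \in rep -> 0 < r ->
    bounded_by M (Ival (lo I / r) (hi I / r)) ->
    lo I / r - M * u <= lo (idiv u I r) /\
    hi (idiv u I r) <= hi I / r + M * u }.

Record cbox (R : realType) := CBox { bRe : ival R; bIm : ival R }.

Section Boxes.
Variables (R : realType) (Ar : interval_arith R).

Definition crep (z : R[i]) : bool :=
  (complex.Re z \in rep Ar) && (complex.Im z \in rep Ar).

Definition mxrep m p (A : 'M[R[i]]_(m, p)) : Prop := forall i j, crep (A i j).

Definition mbox_rep n (m : mbox R n) : Prop :=
  [/\ mxrep (box_ctr m), box_rad m \in rep Ar & mxrep (box_mat m)].

Definition circuit_ok N m p (c : circuit R N m p) : Prop :=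
  (forall k, (k < size (gates c))%N ->
     match nth (GConst N 0) (gates c) k with
     | GInput _ => true
     | GConst a => crep a
     | GAdd i j | GMul i j => (i < k)%N && (j < k)%N
     end) /\
  forall i j, (outs c i j < size (gates c))%N.

Definition in_cbox (X : cbox R) : set R[i] :=
  [set z | in_ival (bRe X) (complex.Re z) /\ in_ival (bIm X) (complex.Im z)].

Definition box_set m p (X : 'M[cbox R]_(m, p)) : set 'M[R[i]]_(m, p) :=
  [set z | forall i j, in_cbox (X i j) (z i j)].

Definition box_norm m p (X : 'M[cbox R]_(m, p)) : R :=
  sup [set cnorm z | z in box_set X].

Definition box_width m p (X : 'M[cbox R]_(m, p)) : R :=
  sup [set cnorm (z - w) | z in box_set X & w in box_set X].

(* mid is not assumed to be a function, only a choice at each use. *)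
Definition is_mid m p (X : 'M[cbox R]_(m, p)) (z : 'M[R[i]]_(m, p)) : Prop :=
  mxrep z /\ box_set X z.

Definition ipoint (a : R) : ival R := Ival a a.
Definition ineg (I : ival R) : ival R := Ival (- hi I) (- lo I).
Definition cb_point (z : R[i]) : cbox R :=
  CBox (ipoint (complex.Re z)) (ipoint (complex.Im z)).
Definition cb_real (J : ival R) : cbox R := CBox J (ipoint 0).
Definition cb_ball (r : R) : cbox R := CBox (Ival (- r) r) (Ival (- r) r).
Definition cb_neg (X : cbox R) : cbox R := CBox (ineg (bRe X)) (ineg (bIm X)).

Variable u : R.

Definition cb_add (X Y : cbox R) : cbox R :=
  CBox (iadd Ar u (bRe X) (bRe Y)) (iadd Ar u (bIm X) (bIm Y)).

Definition cb_mul (X Y : cbox R) : cbox R :=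
  CBox (iadd Ar u (imul Ar u (bRe X) (bRe Y)) (ineg (imul Ar u (bIm X) (bIm Y))))
       (iadd Ar u (imul Ar u (bRe X) (bIm Y)) (imul Ar u (bIm X) (bRe Y))).

Definition cb_div (X : cbox R) (r : R) : cbox R :=
  CBox (idiv Ar u (bRe X) r) (idiv Ar u (bIm X) r).

End Boxes.

(* A model a_0 + ... + a_(nu+1) eta^(nu+1) of order nu is the sequence of its
   nu+2 coefficients; J is the interval J_0 on which the model is taken. *)
Section TaylorModels.
Variables (R : realType) (Ar : interval_arith R) (u : R) (nu : nat) (J : ival R).

Definition tmodel := seq (cbox R).

Notation zero := (cb_point (0 : R[i])).

Definition tm_const (X : cbox R) : tmodel := X :: nseq nu.+1 zero.

Definition tm_affine (a b : R[i]) : tmodel := cb_point a :: cb_point b :: nseq nu zero.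

Definition tm_add (p q : tmodel) : tmodel :=
  [seq cb_add Ar u ab.1 ab.2 | ab <- zip p q].

Definition tm_squeeze (p : tmodel) : tmodel :=
  rcons (take (size p - 2) p)
    (cb_add Ar u (nth zero p (size p - 2))
       (cb_mul Ar u (nth zero p (size p - 1)) (cb_real J))).

Definition tm_polymul (p q : tmodel) : tmodel :=
  mkseq (fun k => \big[cb_add Ar u/zero]_(i < k.+1 |
                     (i < size p)%N && (k - i < size q)%N)
                    cb_mul Ar u (nth zero p i) (nth zero q (k - i)))
        (size p + size q).-1.

Definition tm_mul (p q : tmodel) : tmodel :=
  iter nu.+1 tm_squeeze (tm_polymul p q).

Definition tm_eval (p : tmodel) (I : ival R) : cbox R :=
  foldr (fun a acc => cb_add Ar u a (cb_mul Ar u (cb_real I) acc)) zero p.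

End TaylorModels.

Record arith (R : realType) (T : Type) := Arith {
  a_box : cbox R -> T;
  a_add : T -> T -> T;
  a_neg : T -> T;
  a_mul : T -> T -> T;
  a_div : T -> R -> T }.

Definition box_arith (R : realType) (Ar : interval_arith R) (u : R) :
    arith R (cbox R) :=
  Arith id (cb_add Ar u) (@cb_neg R) (cb_mul Ar u) (cb_div Ar u).

Definition tm_arith (R : realType) (Ar : interval_arith R) (u : R) (nu : nat)
    (J : ival R) : arith R (tmodel R) :=
  Arith (@tm_const R nu) (tm_add Ar u) (map (@cb_neg R)) (tm_mul Ar u nu J)
        (fun p r => [seq cb_div Ar u a r | a <- p]).

Section Arith.
Variables (R : realType) (T : Type) (o : arith R T).

Definition a_circuit N m p (c : circuit R N m p) (inp : 'I_N -> T) :=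
  circuit_eval (fun z => a_box o (cb_point z)) (a_add o) (a_mul o) c inp.

Definition a_mx m p (A : 'M[R[i]]_(m, p)) : 'M[T]_(m, p) :=
  map_mx (fun z => a_box o (cb_point z)) A.

Definition a_addmx m p (X Y : 'M[T]_(m, p)) : 'M[T]_(m, p) :=
  map2_mx (a_add o) X Y.

Definition a_oppmx m p (X : 'M[T]_(m, p)) : 'M[T]_(m, p) := map_mx (a_neg o) X.

Definition a_mulmx m p q (X : 'M[T]_(m, p)) (Y : 'M[T]_(p, q)) : 'M[T]_(m, q) :=
  \matrix_(i, k) \big[a_add o/a_box o (cb_point 0)]_j a_mul o (X i j) (Y j k).

Definition a_ball n (r : R) : 'cV[T]_n := const_mx (a_box o (cb_ball r)).

(* The division by r comes last: its rounding error is then of order u / r. *)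
Definition krawczyk n (r : R) (A : 'M[R[i]]_n) (fx : 'cV[T]_n) (dfX : 'M[T]_n) :
    'cV[T]_n :=
  a_addmx
    (a_oppmx (map_mx (fun X => a_div o X r) (a_mulmx (a_mx A) fx)))
    (a_mulmx (a_addmx (a_mx 1%:M) (a_oppmx (a_mulmx (a_mx A) dfX))) (a_ball n 1)).

End Arith.

(* The algorithm is a transition system.  [Track m] is the head of the main
   loop; [Refine m m1] the head of the first loop of refine, with input m and
   current (y, s, U) = m1; [Raise], [Tune], [Invert] the instructions increasing
   the precision, making it o(s), and recomputing U; [Enlarge m1] the head of
   the second loop of refine; [Predict m] the rest of the main loop. *)
Inductive control (R : realType) (n : nat) :=
| Track of mbox R n
| Refine of mbox R n & mbox R n
| Raise of mbox R n & mbox R n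
| Tune of mbox R n & mbox R n
| Invert of mbox R n & mbox R n
| Enlarge of mbox R n
| Predict of mbox R n
| Return of mbox R n.

Record state (R : realType) (n : nat) := State {
  time : R;
  stepsize : R;
  uprec : R;
  ctl : control R n }.

Definition halted (R : realType) n (st : state R n) : Prop :=
  exists m, ctl st = Return m.

Section Algorithm.
Variables (R : realType) (n : nat) (Ar : interval_arith R).
Variables (cF : circuit R n.+1 n 1) (cdF : circuit R n.+1 n n).
Variable (cFdot : circuit R n.+1 n 1).

(* With [cap = false] the time is advanced by the full step, so that the main
   loop may stop at a time beyond 1, with a box for a system other than F_1.
   With [cap = true] the step is shortened to end at time 1 exactly. *)
Variable cap : bool.

Section Computations.
Variables (u t : R).
Notation B := (box_arith Ar u).

Definition box_at m p (c : circuit R n.+1 m p) (X : 'cV[cbox R]_n) :=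
  a_circuit B c (point (cb_point t%:C) X).

Definition moore_test (m : mbox R n) (rho : R) : bool :=
  box_norm (krawczyk B (box_rad m) (box_mat m)
    (box_at cF (a_mx B (box_ctr m)))
    (box_at cdF (a_addmx B (a_mx B (box_ctr m)) (a_ball B n (box_rad m))))) <= rho.

Definition newton_delta (A : 'M[R[i]]_n) (y : 'cV[R[i]]_n) : 'cV[cbox R]_n :=
  a_mulmx B (a_mx B A) (box_at cF (a_mx B y)).

Definition newton_box (A : 'M[R[i]]_n) (y : 'cV[R[i]]_n) : 'cV[cbox R]_n :=
  a_addmx B (a_mx B y) (a_oppmx B (newton_delta A y)).

Definition tangent_box (m : mbox R n) : 'cV[cbox R]_n :=
  a_oppmx B (a_mulmx B (a_mx B (box_mat m)) (box_at cFdot (a_mx B (box_ctr m)))).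

Definition predictor_model (h : R) (m : mbox R n) (v : 'cV[R[i]]_n) :
    'cV[tmodel R]_n :=
  let T := tm_arith Ar u 2 (Ival 0 h) in
  let tau := tm_affine 2 t%:C 1 in
  let X := \col_i tm_affine 2 (box_ctr m i ord0) (v i ord0) in
  krawczyk T (box_rad m) (box_mat m)
    (a_circuit T cF (point tau X))
    (a_circuit T cdF (point tau (a_addmx T X (a_ball T n (box_rad m))))).

End Computations.

Definition model_test (u : R) (K : 'cV[tmodel R]_n) (h : R) : bool :=
  box_norm (map_mx (fun p => tm_eval Ar u p (Ival 0 h)) K) <= 7 / 8.

Definition refine_tol : R := 1 / 8.

Definition next_stepsize (t h : R) : R :=
  if cap then Num.min (5 / 4 * h) (1 - t) else 5 / 4 * h.

(* The point x + hv of the predictor is representable: it is not rounded, since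
   a perturbation of it may not be the centre of a 7/8-Moore box. *)
Definition advance (m : mbox R n) (v : 'cV[R[i]]_n) (h : R) : mbox R n :=
  MBox (box_ctr m + h%:C *: v) (box_rad m) (box_mat m).

(* In [step_accept_half] and [step_reject], the model computed on [0, h1] is
   evaluated on the subinterval [0, h1/2]. *)
Inductive step : state R n -> state R n -> Prop :=
| step_return t h u m :
    1 <= t ->
    step (State t h u (Track m)) (State t h u (Return m))
| step_call_refine t h u m :
    t < 1 ->
    step (State t h u (Track m)) (State t h u (Refine m m))
| step_certified t h u m m1 :
    moore_test u t m1 refine_tol ->
    step (State t h u (Refine m m1)) (State t h u (Enlarge m1))
| step_halve t h u m y s U :
    ~~ moore_test u t (MBox y s U) refine_tol ->
    box_norm (newton_delta u t (box_mat m) y) <= 1 / 64 * refine_tol * s ->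
    1 / 16 * refine_tol * box_rad m <= s / 2 ->
    step (State t h u (Refine m (MBox y s U)))
         (State t h u (Invert m (MBox y (s / 2) U)))
| step_halve_tune t h u m y s U :
    ~~ moore_test u t (MBox y s U) refine_tol ->
    box_norm (newton_delta u t (box_mat m) y) <= 1 / 64 * refine_tol * s ->
    s / 2 < 1 / 16 * refine_tol * box_rad m ->
    step (State t h u (Refine m (MBox y s U)))
         (State t h u (Tune m (MBox y (s / 2) U)))
| step_imprecise t h u m y s U :
    ~~ moore_test u t (MBox y s U) refine_tol ->
    1 / 64 * refine_tol * s < box_norm (newton_delta u t (box_mat m) y) ->
    1 / 40 * box_norm (newton_delta u t (box_mat m) y)
      < box_width (newton_box u t (box_mat m) y) ->
    step (State t h u (Refine m (MBox y s U)))
         (State t h u (Raise m (MBox y s U)))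
| step_newton t h u m y s U y' :
    ~~ moore_test u t (MBox y s U) refine_tol ->
    1 / 64 * refine_tol * s < box_norm (newton_delta u t (box_mat m) y) ->
    box_width (newton_box u t (box_mat m) y)
      <= 1 / 40 * box_norm (newton_delta u t (box_mat m) y) ->
    is_mid Ar (newton_box u t (box_mat m) y) y' ->
    step (State t h u (Refine m (MBox y s U)))
         (State t h u (Invert m (MBox y' s U)))
| step_raise t h u u' m m1 :
    0 < u' < u ->
    step (State t h u (Raise m m1)) (State t h u' (Invert m m1))
| step_tune t h u u' m m1 :
    0 < u' <= u ->
    step (State t h u (Tune m m1)) (State t h u' (Invert m m1))
| step_invert t h u m y s U U' :
    mxrep Ar U' ->
    step (State t h u (Invert m (MBox y s U)))
         (State t h u (Refine m (MBox y s U')))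
| step_enlarge t h u y s U :
    2 * s <= 1 -> moore_test u t (MBox y (2 * s) U) refine_tol ->
    step (State t h u (Enlarge (MBox y s U)))
         (State t h u (Enlarge (MBox y (2 * s) U)))
| step_refined t h u y s U :
    ~ (2 * s <= 1 /\ moore_test u t (MBox y (2 * s) U) refine_tol) ->
    step (State t h u (Enlarge (MBox y s U)))
         (State t h u (Predict (MBox y s U)))
| step_accept t h u m v :
    let h1 := next_stepsize t h in
    is_mid Ar (tangent_box u t m) v ->
    model_test u (predictor_model u t h1 m v) h1 ->
    step (State t h u (Predict m))
         (State (t + h1) h1 u (Track (advance m v h1)))
| step_accept_half t h u m v :
    let h1 := next_stepsize t h in
    let h2 := h1 / 2 in
    let u2 := Num.min u h2 in
    is_mid Ar (tangent_box u t m) v ->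
    ~~ model_test u (predictor_model u t h1 m v) h1 ->
    model_test u2 (predictor_model u t h1 m v) h2 ->
    step (State t h u (Predict m))
         (State (t + h2) h2 u2 (Track (advance m v h2)))
| step_reject t h u m v :
    let h1 := next_stepsize t h in
    let h2 := h1 / 2 in
    let u2 := Num.min u h2 in
    is_mid Ar (tangent_box u t m) v ->
    ~~ model_test u (predictor_model u t h1 m v) h1 ->
    ~~ model_test u2 (predictor_model u t h1 m v) h2 ->
    step (State t h u (Predict m))
         (State t h2 u2 (Track m)).

(* A complete run, finite (then prolonged by its last state) or infinite. *)
Definition execution (m0 : mbox R n) (u0 : R) (run : nat -> state R n) : Prop :=
  run 0%N = State 0 (1 / 2) u0 (Track m0) /\
  forall k, step (run k) (run k.+1) \/ (halted (run k) /\ run k.+1 = run k).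

End Algorithm.

Definition terminates (R : realType) n (run : nat -> state R n) : Prop :=
  exists k, halted (run k).

(* What the instructions Raise, Tune and Invert must achieve along a run.  All
   three conditions hold automatically when the run is finite. *)
Record precision_conventions (R : realType) n (F : polymx R n.+1 n 1)
    (run : nat -> state R n) : Prop := PrecisionConventions {
  raise_convention :
    (forall N, exists2 k, (N <= k)%N & exists m m1, ctl (run k) = Raise m m1) ->
    uprec (run k) @[k --> \oo] --> (0 : R);
  tune_convention : forall e, 0 < e -> exists2 d, 0 < d &
    forall k m m1, ctl (run k) = Tune m m1 ->
      box_rad m1 < d -> uprec (run k.+1) <= e * box_rad m1;
  invert_convention : forall e, 0 < e -> exists2 d, 0 < d &
    forall k m m1 m2,
      ctl (run k) = Invert m m1 -> ctl (run k.+1) = Refine m m2 ->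
      uprec (run k) < d ->
      cnorm (box_mat m2 - invmx (at_point (jacobian_x F) (time (run k)) (box_ctr m2)))
        < e }.

(* Main.v *)
(* Interval evaluation encloses the exact Krawczyk map, so a box passing a
   test is a Moore box: the map is a contraction of the box into its
   interior, with a unique zero as fixed point. A model passing its test on
   [0,h] makes every translated box x + v e a Moore box for F_(t+e); as its
   zero is interior, the continuation can neither leave the moving box nor
   stop inside it, which proves the output correct, and 1 in I when the
   algorithm terminates.

   Conversely let 1 be in I. On the compact path up to time 1 the inverse of
   dF and the data of all boxes are bounded. Quasi-Newton steps with the box
   matrix A contract by a fixed factor, so an infinite refine raises the
   precision or halves s infinitely often; either way u_prec tends to 0, y
   approaches the zero and U the inverse of dF(y), so that the test holds
   once s and u_prec are small. Hence refine ends, and its enlarging phase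
   bounds the radius from below. In the main loop, an infinite run forces
   infinitely many halvings with h, and therefore u_prec, tending to 0, since
   the total time is bounded; but on a short interval at high precision the
   model is close to the box of the successful test with 1/8, so the test
   with 7/8 passes. *)
Require Import Defs.
From mathcomp Require Import all_boot all_order all_algebra perm.
From mathcomp Require Import complex.
From mathcomp Require Import all_classical all_reals all_analysis.
From mathcomp Require mpoly.
Import (canonicals, coercions) mpoly.
From mathcomp Require Import ring lra.

Set Implicit Arguments.
Unset Strict Implicit.
Unset Printing Implicit Defensive.

Import Order.TTheory GRing.Theory Num.Theory.
Import numFieldNormedType.Exports.

Local Open Scope classical_set_scope.
Local Open Scope ring_scope.
Local Open Scope complex_scope.

(** * The maximum norm and differentiation *)

(** The main obstacle is uniformity: precision, time and box vary along a run, so every constant has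
    to be fixed before them. Interval evaluation is compared with other evaluations of the same
    circuit through relations indexed by a bound [M], whose growth depends only on the circuit and
    on bounds for the data. One induction on circuits yields enclosure, distance to the exact value,
    enclosure by Taylor models, distance of a model from a box, and Lipschitz bounds for polynomial
    maps.

    A second obstacle is the radius. The enlarging loop bounds it from below only if the matrix was
    recomputed at the current centre with small [u], whereas a box certified at once keeps its old
    matrix. The invariant separates the two cases and can start only once the precision is known to
    vanish, so this must follow from step sizes and bounded time alone, before any lower bound on
    radii. Bounds on the path are then needed only near the supremum of the times reached.

    Inside refine the difficulty is the residual divided by [s]: rounding errors of order [u] become
    [u / s], so the test is shown to pass just after an instruction [Tune]. *)

Section Norm.
Variable R : realType.
Implicit Types (z w : R[i]) (r : R).

Lemma cReD z w : complex.Re (z + w) = complex.Re z + complex.Re w.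
Proof. by case: z; case: w. Qed.

Lemma cImD z w : complex.Im (z + w) = complex.Im z + complex.Im w.
Proof. by case: z; case: w. Qed.

Lemma cReN z : complex.Re (- z) = - complex.Re z.
Proof. by case: z. Qed.

Lemma cImN z : complex.Im (- z) = - complex.Im z.
Proof. by case: z. Qed.

Lemma cReM z w :
  complex.Re (z * w) = complex.Re z * complex.Re w - complex.Im z * complex.Im w.
Proof. by case: z; case: w. Qed.

Lemma cImM z w :
  complex.Im (z * w) = complex.Re z * complex.Im w + complex.Im z * complex.Re w.
Proof. by case: z; case: w. Qed.

Lemma cReZ r z : complex.Re (r%:C * z) = r * complex.Re z.
Proof. by rewrite cReM /= mul0r subr0. Qed.

Lemma cImZ r z : complex.Im (r%:C * z) = r * complex.Im z.
Proof. by rewrite cImM /= mul0r addr0. Qed.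

Lemma cabs_ge0 z : 0 <= cabs z.
Proof. by rewrite /cabs le_max normr_ge0. Qed.

Lemma cabs_le z r :
  reflect (`|complex.Re z| <= r /\ `|complex.Im z| <= r) (cabs z <= r).
Proof. by rewrite /cabs ge_max; apply: andP. Qed.

Lemma Re_le_cabs z : `|complex.Re z| <= cabs z.
Proof. by rewrite /cabs le_max lexx. Qed.

Lemma Im_le_cabs z : `|complex.Im z| <= cabs z.
Proof. by rewrite /cabs le_max lexx orbT. Qed.

Lemma cabs0 : cabs (0 : R[i]) = 0.
Proof. by rewrite /cabs /= normr0 maxxx. Qed.

Lemma cabsN z : cabs (- z) = cabs z.
Proof. by rewrite /cabs cReN cImN !normrN. Qed.

Lemma cabsD z w : cabs (z + w) <= cabs z + cabs w.
Proof.
apply/cabs_le; rewrite cReD cImD; split; apply: le_trans (ler_normD _ _) _.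
  by rewrite lerD ?Re_le_cabs.
by rewrite lerD ?Im_le_cabs.
Qed.

(** Each part of a complex product combines two real products, so this norm is submultiplicative
    only up to a factor 2, which reappears as the [2 * p%:R] of [cnorm_mulmx]. *)
Lemma cabsM z w : cabs (z * w) <= 2 * (cabs z * cabs w).
Proof.
apply/cabs_le; rewrite cReM cImM.
have [[[a b] c] d] := (Re_le_cabs z, Im_le_cabs z, Re_le_cabs w, Im_le_cabs w).
split; apply: le_trans (ler_normD _ _) _;
  by rewrite ?normrN !normrM mulr_natl mulr2n lerD // ler_pM.
Qed.

Lemma cabsZ r z : cabs (r%:C * z) = `|r| * cabs z.
Proof. by rewrite /cabs cReZ cImZ !normrM maxr_pMr. Qed.

Lemma cabs_eq0 z : (cabs z == 0) = (z == 0).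
Proof.
apply/eqP/eqP => [z0|->]; last exact: cabs0.
have /cabs_le[] : cabs z <= 0 by rewrite z0.
by rewrite !normr_le0 => /eqP zr /eqP zi; apply/eqP; rewrite eq_complex zr zi !eqxx.
Qed.

Lemma cabs_real r : cabs r%:C = `|r|.
Proof. by rewrite /cabs /= normr0 max_l. Qed.

Lemma cabs1 : cabs (1 : R[i]) = 1.
Proof. by rewrite (cabs_real 1) normr1. Qed.

Section Matrices.
Variables m p : nat.
Implicit Types A B : 'M[R[i]]_(m, p).

Lemma cnorm_ge0 A : 0 <= cnorm A.
Proof. by apply: bigmax_ge_id. Qed.

Lemma cabs_cnorm A i j : cabs (A i j) <= cnorm A.
Proof.
by rewrite /cnorm; apply: le_trans (le_bigmax _ _ i); apply: (le_bigmax _ (fun j => cabs (A i j))).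
Qed.

Lemma cnorm_le A r : 0 <= r -> (cnorm A <= r <-> forall i j, cabs (A i j) <= r).
Proof.
move=> r0; split=> [h i j|h]; first exact: le_trans (cabs_cnorm _ _ _) h.
by apply: bigmax_le => // i _; apply: bigmax_le.
Qed.

Lemma cnormD A B : cnorm (A + B) <= cnorm A + cnorm B.
Proof.
apply/cnorm_le => [|i j]; first by rewrite addr_ge0 ?cnorm_ge0.
by rewrite mxE; apply: le_trans (cabsD _ _) _; rewrite lerD ?cabs_cnorm.
Qed.

Lemma cnormN A : cnorm (- A) = cnorm A.
Proof. by rewrite /cnorm; under eq_bigr do under eq_bigr do rewrite mxE cabsN. Qed.

Lemma cnormB A B : cnorm (A - B) = cnorm (B - A).
Proof. by rewrite -cnormN opprB. Qed.

Lemma cnorm0 : cnorm (0 : 'M[R[i]]_(m, p)) = 0.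
Proof.
apply/le_anti; rewrite cnorm_ge0 andbT; apply/cnorm_le => // i j.
by rewrite mxE cabs0.
Qed.

Lemma cnorm_eq0 A : cnorm A <= 0 -> A = 0.
Proof.
move=> /cnorm_le h; apply/matrixP => i j; rewrite mxE; apply/eqP.
by rewrite -cabs_eq0 eq_le cabs_ge0 h.
Qed.

Lemma cnormZ r A : cnorm (r%:C *: A) = `|r| * cnorm A.
Proof.
have h s B : cnorm (s%:C *: B) <= `|s| * cnorm B.
  apply/cnorm_le => [|i j]; first by rewrite mulr_ge0 ?cnorm_ge0.
  by rewrite mxE cabsZ ler_wpM2l ?cabs_cnorm.
apply/le_anti; rewrite h /=.
have [->|r0] := eqVneq r 0; first by rewrite normr0 mul0r cnorm_ge0.
have := h r^-1 (r%:C *: A); rewrite scalerA -rmorphM /= mulVf // scale1r => k.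
by rewrite mulrC -ler_pdivlMr ?normr_gt0 // mulrC -normfV.
Qed.

End Matrices.

Lemma cnorm_mulmx m p q (A : 'M[R[i]]_(m, p)) (B : 'M[R[i]]_(p, q)) :
  cnorm (A *m B) <= (2 * p%:R) * (cnorm A * cnorm B).
Proof.
apply/cnorm_le => [|i k]; first by rewrite !mulr_ge0 ?cnorm_ge0.
rewrite mxE; apply: (@le_trans _ _ (\sum_(j < p) 2 * (cnorm A * cnorm B))).
  elim/big_ind2: _ => [|b0 b c0 c hB hC|j _]; first by rewrite cabs0.
    by apply: le_trans (cabsD _ _) _; rewrite lerD.
  by apply: le_trans (cabsM _ _) _; rewrite ler_wpM2l // ler_pM ?cabs_ge0 ?cabs_cnorm.
by rewrite sumr_const card_ord -[_ *+ _]mulr_natr mulrAC.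
Qed.

End Norm.

(** Evaluation and derivation are governed by constants, variables, sums and products; this
    induction spares its users the monomials. *)
Lemma mpoly_closed_ind (K : comNzRingType) k (P : mpoly.mpoly k K -> Prop) :
  (forall c, P (mpoly.mpolyC k c)) ->
  (forall i, P (mpoly.mpolyX K (mpoly.mnm1 i))) ->
  (forall p q, P p -> P q -> P (p + q)) ->
  (forall p q, P p -> P q -> P (p * q)) ->
  forall p, P p.
Proof.
move=> hC hX hD hM; elim/mpoly.mpolyind => [|c m p _ _ hp].
  by rewrite -(raddf0 (@mpoly.mpolyC k K)); apply: hC.
apply: (hD) => //; rewrite -mpoly.mul_mpolyC; apply: (hM) => //.
have h1 : P 1 by rewrite -(rmorph1 (@mpoly.mpolyC k K)); apply: hC.
rewrite mpoly.mpolyXE_id; apply: (big_ind P) => // i _.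
elim: (mpoly.fun_of_multinom m i) => [|e he]; first by rewrite expr0.
by rewrite exprS; apply: hM.
Qed.

(** * Derivatives of polynomials along real paths *)

Section Derivative.
Variable R : realType.

(** Only paths with a real parameter are differentiated; splitting the derivative into two real ones
    lets the real mean value theorem act on each part. *)
Definition cderive (f : R -> R[i]) (x : R) (d : R[i]) : Prop :=
  is_derive x (1 : R) (fun s => complex.Re (f s)) (complex.Re d) /\
  is_derive x (1 : R) (fun s => complex.Im (f s)) (complex.Im d).

Lemma cderive_eq f x d d' : cderive f x d -> d = d' -> cderive f x d'.
Proof. by move=> ? <-. Qed.

Lemma cderive_cst c x : cderive (fun=> c) x 0.
Proof. by split; apply: is_derive_cst. Qed.

Lemma cderiveD f g x d e : cderive f x d -> cderive g x e ->
  cderive (fun s => f s + g s) x (d + e).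
Proof.
move=> [f1 f2] [g1 g2]; split.
  by rewrite cReD; under eq_fun do rewrite cReD; apply: is_deriveD.
by rewrite cImD; under eq_fun do rewrite cImD; apply: is_deriveD.
Qed.

Lemma cderiveM f g x d e : cderive f x d -> cderive g x e ->
  cderive (fun s => f s * g s) x (d * g x + f x * e).
Proof.
move=> [f1 f2] [g1 g2]; split.
  under eq_fun do rewrite cReM.
  apply: (is_derive_eq (is_deriveB (is_deriveM f1 g1) (is_deriveM f2 g2))).
  by rewrite cReD !cReM /GRing.scale /=; ring.
under eq_fun do rewrite cImM.
apply: (is_derive_eq (is_deriveD (is_deriveM f1 g2) (is_deriveM f2 g1))).
by rewrite cImD !cImM /GRing.scale /=; ring.
Qed.

Lemma cderive_real x : cderive (fun s => s%:C) x 1.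
Proof. by split; [apply: is_derive_id | apply: is_derive_cst]. Qed.

Lemma cderive_sum (I : Type) (s : seq I) (f : I -> R -> R[i]) x (d : I -> R[i]) :
  (forall i, cderive (f i) x (d i)) ->
  cderive (fun y => \sum_(i <- s) f i y) x (\sum_(i <- s) d i).
Proof.
move=> h; elim: s => [|i s IH].
  by rewrite big_nil; under eq_fun do rewrite big_nil; apply: cderive_cst.
by rewrite big_cons; under eq_fun do rewrite big_cons; apply: cderiveD.
Qed.

Lemma cderive_meval k (g : R -> 'I_k -> R[i]) x (dg : 'I_k -> R[i]) :
  (forall i, cderive (g ^~ i) x (dg i)) ->
  forall p : mpoly.mpoly k R[i], cderive (fun s => mpoly.meval (g s) p) x
    (\sum_i mpoly.meval (g x) (mpoly.mderiv i p) * dg i).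
Proof.
move=> hg; elim/mpoly_closed_ind => [c|i|p q hp hq|p q hp hq].
- under eq_fun do rewrite mpoly.mevalC.
  rewrite big1 => [|i _]; first exact: cderive_cst.
  by rewrite mpoly.mderivC mpoly.meval0 mul0r.
- under eq_fun do rewrite mpoly.mevalXU.
  apply: cderive_eq (hg i) _; rewrite (bigD1 i) //= big1 => [|j ji].
    rewrite mpoly.mderivX mpoly.mnm1E eqxx scale1r addr0.
    have -> : mpoly.mnm_sub (mpoly.mnm1 i) (mpoly.mnm1 i) = mpoly.mnm0 :> mpoly.multinom k.
      by apply/mpoly.mnmP => l; rewrite mpoly.mnmBE subnn mpoly.mnm0E.
    by rewrite mpoly.mpolyX0 mpoly.meval1 mul1r.
  by rewrite mpoly.mderivX mpoly.mnm1E eq_sym (negPf ji) scale0r mpoly.meval0 mul0r.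
- under eq_fun do rewrite mpoly.mevalD.
  apply: cderive_eq (cderiveD hp hq) _; rewrite -big_split /=.
  by apply: eq_bigr => i _; rewrite mpoly.mderivD mpoly.mevalD mulrDl.
- under eq_fun do rewrite mpoly.mevalM.
  apply: cderive_eq (cderiveM hp hq) _.
  rewrite mulr_suml mulr_sumr -big_split /=; apply: eq_bigr => i _.
  by rewrite mpoly.mderivM mpoly.mevalD !mpoly.mevalM mulrDl !mulrA (mulrAC _ (dg i)).
Qed.

Lemma real_mean_value (f df : R -> R) : (forall s, is_derive s (1 : R) f (df s)) ->
  exists2 s, 0 <= s <= 1 & f 1 - f 0 = df s.
Proof.
move=> h; have cf : {within `[(0 : R), 1], continuous f}.
  by apply: derivable_within_continuous => s _; apply: (@ex_derive _ _ _ _ _ _ _ (h s)).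
have [s s01 ->] := MVT ltr01 (fun s _ => h s) cf.
by exists s; [move: s01; rewrite in_itv /= => /andP[/ltW -> /ltW ->] | rewrite subr0 mulr1].
Qed.

End Derivative.

Section MeanValue.
Variables (R : realType) (n : nat) (F : polymx R n.+1 n 1).
Notation f t := (at_point F t).
Notation df t := (at_point (jacobian_x F) t).

Lemma cderive_at_point (t : R) (x w : 'cV[R[i]]_n) i s :
  cderive (fun s => f t (x + s%:C *: w) i ord0) s
    ((df t (x + s%:C *: w) *m w) i ord0).
Proof.
rewrite /at_point; under eq_fun do rewrite mxE.
pose g (s : R) := Defs.point t%:C (x + s%:C *: w).
pose dg : 'I_n.+1 -> R[i] := fun k => oapp (fun j => w j ord0) 0 (unlift ord0 k).
have hg k : cderive (g ^~ k) s (dg k).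
  rewrite /g /dg /Defs.point; case: unliftP => [j|] _ /=; last exact: cderive_cst.
  under eq_fun do rewrite !mxE.
  apply: cderive_eq; first apply: cderiveD (cderive_cst _ _) _.
    by apply: cderiveM (cderive_real _) (cderive_cst _ _).
  by rewrite add0r mul1r mulr0 addr0.
apply: cderive_eq (cderive_meval hg _) _.
rewrite big_ord_recl /dg unlift_none mulr0 add0r mxE.
by apply: eq_bigr => j _; rewrite liftK !mxE.
Qed.

(* The displacement w is affine in the mean value theorem applied to
   s |-> s w - A F(x + s w), and q is a constant added to its derivative. *)
Lemma krawczyk_mean_value (t : R) (A : 'M[R[i]]_n) (x w q : 'cV[R[i]]_n) (c : R) :
  0 <= c ->
  (forall s : R, 0 <= s <= 1 ->
     cnorm (q + (1%:M - A *m df t (x + s%:C *: w)) *m w) <= c) ->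
  cnorm (q + (w - A *m (f t (x + w) - f t x))) <= c.
Proof.
move=> c0 h; apply/(cnorm_le _ c0) => i j; rewrite (ord1 j).
pose g (s : R) := s%:C * w i ord0 + \sum_k (- A i k) * f t (x + s%:C *: w) k ord0.
have dg s : cderive g s (((1%:M - A *m df t (x + s%:C *: w)) *m w) i ord0).
  apply: cderive_eq.
    apply: cderiveD; first exact: cderiveM (cderive_real _) (cderive_cst _ _).
    apply: cderive_sum => k.
    by apply: cderiveM; [apply: cderive_cst | apply: cderive_at_point].
  rewrite mulmxBl mul1mx mxE [in RHS]mxE mul1r mulr0 addr0; congr (_ + _).
  rewrite -mulmxA [in RHS]mxE -sumrN; apply: eq_bigr => k _.
  by rewrite mul0r add0r mulNr.
have gE : g 1 - g 0 = (w - A *m (f t (x + w) - f t x)) i ord0.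
  rewrite /g mul1r mul0r add0r scale1r scale0r addr0 !mxE -addrA; congr (_ + _).
  rewrite -sumrB -sumrN; apply: eq_bigr => k _.
  by rewrite !mxE !mulNr -opprB mulrBr opprK addrC opprB.
rewrite mxE -gE.
have key s : 0 <= s <= 1 -> cabs (q i ord0 +
    ((1%:M - A *m df t (x + s%:C *: w)) *m w) i ord0) <= c.
  by move=> s01; have /(cnorm_le _ c0) /(_ i ord0) := h s s01; rewrite mxE.
have keyD s (a b : R[i]) : cabs (a + b) <= s -> `|complex.Re a + complex.Re b| <= s /\
    `|complex.Im a + complex.Im b| <= s by move/cabs_le; rewrite cReD cImD.
(* The intermediate points differ between the real and the imaginary part and between rows; this is
   harmless because the maximum norm asks for each bound separately. *)
have [s s01 hs] := real_mean_value (fun s => (dg s).1).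
have [s' s01' hs'] := real_mean_value (fun s => (dg s).2).
apply/cabs_le; rewrite cReD (cReD (g 1)) cReN hs cImD (cImD (g 1)) cImN hs'.
by split; [case: (keyD _ _ _ (key s s01)) | case: (keyD _ _ _ (key s' s01'))].
Qed.

End MeanValue.

(** * Limits of geometrically converging sequences *)

Section GeometricLimit.
Variable R : realType.

(** Correcting [a k] by the tail of the geometric series, downwards and upwards, gives an increasing
    and a decreasing sequence. The limit is then a supremum, and the error bound comes with it. *)
Lemma geometric_limit (a : nat -> R) (c rho : R) : 0 <= c -> 0 <= rho < 1 ->
  (forall k, `|a k.+1 - a k| <= c * rho ^+ k) ->
  exists l, forall k, `|a k - l| <= c / (1 - rho) * rho ^+ k.
Proof.
move=> c0 /andP[rho0 rho1] h; set e := c / (1 - rho).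
have r1 : 0 < 1 - rho by rewrite subr_gt0.
have e0 : 0 <= e by rewrite divr_ge0 // ltW.
have eE : c = e * (1 - rho) by rewrite divfK ?gt_eqF.
pose b k := a k - e * rho ^+ k; pose d k := a k + e * rho ^+ k.
have bS k : b k <= b k.+1.
  have := h k; rewrite /b exprS eE ler_norml => /andP[+ _].
  set q := rho ^+ k; nra.
have dS k : d k.+1 <= d k.
  have := h k; rewrite /d exprS eE ler_norml => /andP[_ +].
  set q := rho ^+ k; nra.
have bd k : b k <= d k.
  have : 0 <= e * rho ^+ k by rewrite mulr_ge0 ?exprn_ge0.
  by rewrite /b /d; lra.
have bm : {homo b : i j / (i <= j)%N >-> i <= j} by apply: homo_leq => //; exact: le_trans.
have dm i j : (i <= j)%N -> d j <= d i.
  by move=> /subnKC <-; elim: (j - i)%N => [|k IH]; rewrite ?addn0 // addnS (le_trans (dS _)).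
have bdij i j : b i <= d j.
  have [ij|/ltnW ij] := leqP i j; first exact: le_trans (bm _ _ ij) (bd j).
  exact: le_trans (bd i) (dm _ _ ij).
pose S := [set b k | k in [set: nat]].
have S0 : has_sup S.
  by split; [exists (b 0%N), 0%N | exists (d 0%N) => _ [k _ <-]].
exists (sup S) => k.
have l1 : b k <= sup S by apply: sup_upper_bound => //; exists k.
have l2 : sup S <= d k by apply: ge_sup; [exact: S0.1 | move=> _ [j _ <-]].
by rewrite ler_norml; move: l1 l2; rewrite /b /d; lra.
Qed.

Lemma geometric_limit_mx m p (y : nat -> 'M[R[i]]_(m, p)) (c rho : R) :
  0 <= c -> 0 <= rho < 1 ->
  (forall k, cnorm (y k.+1 - y k) <= c * rho ^+ k) ->
  exists z, forall k, cnorm (y k - z) <= c / (1 - rho) * rho ^+ k.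
Proof.
move=> c0 rho01 h.
have q0 k : 0 <= c * rho ^+ k by rewrite mulr_ge0 ?exprn_ge0 //; case/andP: rho01.
have hij k i j : cabs (y k.+1 i j - y k i j) <= c * rho ^+ k.
  by have /(cnorm_le _ (q0 k)) /(_ i j) := h k; rewrite !mxE.
(* The explicit term extracts, from the bound on an entry of [y k.+1 - y k], the bound on its real
   part in the form that [geometric_limit] expects. *)
have limR i j := @geometric_limit (fun k => complex.Re (y k i j)) c rho c0 rho01
  (fun k => let: conj H _ := elimT (cabs_le _ _) (hij k i j) in
     eq_ind _ (fun q => `|q| <= _) H _ (etrans (cReD _ _) (congr1 _ (cReN _)))).
have limI i j := @geometric_limit (fun k => complex.Im (y k i j)) c rho c0 rho01
  (fun k => let: conj _ H := elimT (cabs_le _ _) (hij k i j) in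
     eq_ind _ (fun q => `|q| <= _) H _ (etrans (cImD _ _) (congr1 _ (cImN _)))).
(* [xget] picks a limit for each real and imaginary part; [limR] and [limI] rule out its default
   value 0. *)
exists (\matrix_(i, j) (xget 0 [set l | forall k, `|complex.Re (y k i j) - l| <= c / (1 - rho) * rho ^+ k]
   +i* xget 0 [set l | forall k, `|complex.Im (y k i j) - l| <= c / (1 - rho) * rho ^+ k])) => k.
apply/cnorm_le => [|i j].
  by rewrite !mulr_ge0 ?exprn_ge0 ?invr_ge0 ?subr_ge0 //; case/andP: rho01 => // _ /ltW.
rewrite !mxE; apply/cabs_le; rewrite cReD cReN cImD cImN /=; split.
  by have [l hl] := limR i j; case: xgetP => [x _ xP //|/(_ l)].
by have [l hl] := limI i j; case: xgetP => [x _ xP //|/(_ l)].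
Qed.

End GeometricLimit.

(** * Matrices close to the identity *)

Section Neumann.
Variables (R : realType) (n : nat).

Lemma injective_unitmx (K : fieldType) k (M : 'M[K]_k) :
  (forall v : 'cV_k, M *m v = 0 -> v = 0) -> M \in unitmx.
Proof.
move=> h; rewrite -unitmx_tr -row_free_unit -kermx_eq0; apply/rowV0P => v /sub_kermxP vM.
by apply: (can_inj (@trmxK _ _ _)); rewrite trmx0; apply: h; rewrite -[M]trmxK -trmx_mul vM trmx0.
Qed.

Lemma expanding_near_id (M : 'M[R[i]]_n) (rho : R) (v : 'cV[R[i]]_n) :
  cnorm ((1%:M - M) *m v) <= rho * cnorm v -> (1 - rho) * cnorm v <= cnorm (M *m v).
Proof.
rewrite mulmxBl mul1mx => h.
have := cnormD (v - M *m v) (M *m v); rewrite subrK.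
by move: (cnorm (M *m v)) h => q; lra.
Qed.

(** A kernel vector [v] would satisfy [cnorm v <= rho * cnorm v]. The hypothesis bounds the operator
    on vectors, not the entries of [1%:M - M]: this is what a Moore box gives, without a dimensional
    factor. *)
Lemma unitmx_near_id (M : 'M[R[i]]_n) (rho : R) : rho < 1 ->
  (forall v : 'cV_n, cnorm ((1%:M - M) *m v) <= rho * cnorm v) -> M \in unitmx.
Proof.
move=> rho1 h; apply: injective_unitmx => v Mv; apply: cnorm_eq0.
have := expanding_near_id (h v); rewrite Mv cnorm0.
by rewrite pmulr_rle0 // subr_gt0.
Qed.

(** Testing on the basis vectors bounds every column; in this direction no dimensional factor is
    lost. *)
Lemma cnorm_mulmx_le (M : 'M[R[i]]_n) (c : R) : 0 <= c ->
  (forall v : 'cV_n, cnorm (M *m v) <= c * cnorm v) -> cnorm M <= c.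
Proof.
move=> c0 h; apply/cnorm_le => // i j.
have := h (delta_mx j ord0); rewrite -colE => hj.
have : cabs (col j M i ord0) <= c.
  apply: le_trans (cabs_cnorm _ _ _) _; apply: le_trans hj _.
  rewrite ler_piMr //; apply/cnorm_le => // k l; rewrite mxE.
  by case: andP; rewrite ?cabs1 ?cabs0 ?ler01.
by rewrite mxE.
Qed.

End Neumann.

(** * Moore boxes *)

Section MooreBox.
Variables (R : realType) (n : nat) (F : polymx R n.+1 n 1) (t : R).
Notation f := (at_point F t).
Notation df := (at_point (jacobian_x F) t).
Implicit Types (m : mbox R n) (rho : R) (z w v : 'cV[R[i]]_n).

Definition in_mbox m z := cnorm (z - box_ctr m) <= box_rad m.

Lemma in_mboxP m z : 0 < box_rad m ->
  (exists2 u, unit_ball u & z = box_ctr m + (box_rad m)%:C *: u) <-> in_mbox m z.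
Proof.
move=> r0; split => [[u u1 ->]|zm].
  rewrite /in_mbox addrC addKr cnormZ gtr0_norm // ger_pMr //.
exists (((box_rad m)^-1)%:C *: (z - box_ctr m)).
  by rewrite /unit_ball /= cnormZ normfV gtr0_norm // mulrC ler_pdivrMr // mul1r.
by rewrite scalerA -rmorphM /= divff ?gt_eqF // scale1r addrC subrK.
Qed.

Section OneBox.
Variables (m : mbox R n) (rho : R).
Hypothesis mm : moore_box_at F t rho m.
Notation x := (box_ctr m).
Notation r := (box_rad m).
Notation A := (box_mat m).

Let r0 : 0 < r. Proof. by case: mm. Qed.

Lemma moore_rho_ge0 : 0 <= rho.
Proof.
case: mm => _ /(_ 0 0); rewrite /unit_ball /= cnorm0 => h.
by apply: le_trans (cnorm_ge0 _) (h _ _).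
Qed.

Let moore_scaled z v : in_mbox m z -> cnorm v <= r ->
  cnorm (- (A *m f x) + (1%:M - A *m df z) *m v) <= rho * r.
Proof.
move=> /(in_mboxP _ r0)[u u1 ->] vr; case: mm => _ /(_ u ((r^-1)%:C *: v) u1) h.
have -> : - (A *m f x) + (1%:M - A *m df (x + r%:C *: u)) *m v = r%:C *:
    (- (r^-1)%:C *: (A *m f x) + (1%:M - A *m df (x + r%:C *: u)) *m ((r^-1)%:C *: v)).
  rewrite scalerDr -scalemxAr !scalerA mulrN -rmorphM /= divff ?gt_eqF //.
  by rewrite scaleN1r scale1r.
rewrite cnormZ gtr0_norm // mulrC ler_pM2r //; apply: h.
by rewrite /unit_ball /= cnormZ normfV gtr0_norm // mulrC ler_pdivrMr // mul1r.
Qed.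

(** The conditions for [v] and [- v] share the residual term, which cancels in their difference and
    leaves twice the linear part. Scaling then reaches vectors of any length. *)
Lemma moore_deriv z v : in_mbox m z -> cnorm ((1%:M - A *m df z) *m v) <= rho * cnorm v.
Proof.
move=> zm; set E := 1%:M - _.
have small w : cnorm w <= r -> cnorm (E *m w) <= rho * r.
  move=> wr; have h1 := moore_scaled zm wr.
  have h2 : cnorm (- (A *m f x) + E *m (- w)) <= rho * r by apply: moore_scaled; rewrite ?cnormN.
  have := cnormD (- (A *m f x) + E *m w) (- (- (A *m f x) + E *m (- w))).
  rewrite cnormN mulmxN opprD !opprK addrACA addNr add0r -mulr2n -scaler_nat.
  rewrite -(rmorph_nat (real_complex R)) cnormZ normr_nat.
  move: h1 h2; rewrite -/E mulmxN; lra.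
have [v0|v0] := eqVneq (cnorm v) 0.
  by rewrite (cnorm_eq0 (_ : cnorm v <= 0)) ?v0 // mulmx0 !cnorm0 mulr0.
have vp : 0 < cnorm v by rewrite lt_neqAle eq_sym v0 cnorm_ge0.
have := small ((r / cnorm v)%:C *: v).
rewrite -scalemxAr !cnormZ gtr0_norm ?divr_gt0 // divfK // lexx => /(_ isT).
by rewrite mulrAC ler_pdivrMr // [rho * r]mulrC -mulrA ler_pM2l.
Qed.

Lemma in_mbox_line z w (s : R) : in_mbox m z -> in_mbox m (z + w) -> 0 <= s <= 1 ->
  in_mbox m (z + s%:C *: w).
Proof.
rewrite /in_mbox => zm wm /andP[s0 s1].
have -> : z + s%:C *: w - x = (1 - s)%:C *: (z - x) + s%:C *: (z + w - x).
  by apply/matrixP => i j; rewrite !mxE rmorphB rmorph1 /=; ring.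
apply: le_trans (cnormD _ _) _; rewrite !cnormZ !ger0_norm ?subr_ge0 //; nra.
Qed.

(** The mean value estimate with [q = 0]: the quasi-Newton map sending [z] to [z - A *m f z]
    contracts the box by the factor [rho]. *)
Lemma moore_contraction z w : in_mbox m z -> in_mbox m w ->
  cnorm ((w - z) - A *m (f w - f z)) <= rho * cnorm (w - z).
Proof.
move=> zm wm; have := @krawczyk_mean_value R n F t A z (w - z) 0 (rho * cnorm (w - z)).
rewrite add0r (addrC z) subrK; apply; first by rewrite mulr_ge0 ?cnorm_ge0 ?moore_rho_ge0.
move=> s s01; rewrite add0r; apply: moore_deriv; apply: in_mbox_line => //.
by rewrite addrC subrK.
Qed.

(** The mean value estimate started at the centre, with the residual kept as [q]: the quasi-Newton
    map sends the box into the concentric ball of radius [rho * r]. *)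
Lemma moore_self_map z : in_mbox m z -> cnorm (z - x - A *m f z) <= rho * r.
Proof.
move=> zm; have := @krawczyk_mean_value R n F t A x (z - x) (- (A *m f x)) (rho * r).
rewrite (addrC x) subrK mulmxBr opprB addrCA addKr; apply.
  by rewrite mulr_ge0 ?moore_rho_ge0 // ltW.
move=> s s01; apply: moore_scaled => //.
have xm : in_mbox m x by rewrite /in_mbox subrr cnorm0 ltW.
by apply: in_mbox_line => //; rewrite addrC subrK.
Qed.

(** A zero is a fixed point of the quasi-Newton map. The margin [(1 - rho) * r] is what later allows
    zero and box to move. *)
Lemma moore_zero_inner z : in_mbox m z -> f z = 0 -> cnorm (z - x) <= rho * r.
Proof. by move=> zm fz; have := moore_self_map zm; rewrite fz mulmx0 subr0. Qed.

Lemma moore_residual_le z w : in_mbox m z -> in_mbox m w -> f z = 0 ->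
  cnorm (A *m f w) <= (1 + rho) * cnorm (w - z).
Proof.
move=> zm wm fz; have := moore_contraction zm wm; rewrite fz subr0 => h.
have := cnormD (- (w - z - A *m f w)) (w - z).
by rewrite cnormN opprB subrK; move: (cnorm (A *m _)) h => q; lra.
Qed.

Hypothesis rho1 : rho < 1.

Lemma moore_unit z : in_mbox m z -> A *m df z \in unitmx.
Proof. by move=> zm; apply: unitmx_near_id rho1 _ => v; apply: moore_deriv. Qed.

Lemma moore_df_unit z : in_mbox m z -> df z \in unitmx.
Proof. by move/moore_unit; rewrite unitmx_mul => /andP[]. Qed.

Lemma moore_mat_unit : A \in unitmx.
Proof.
have xm : in_mbox m x by rewrite /in_mbox subrr cnorm0 ltW.
by have := moore_unit xm; rewrite unitmx_mul => /andP[].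
Qed.

Lemma moore_unique z w : in_mbox m z -> in_mbox m w -> f z = 0 -> f w = 0 -> z = w.
Proof.
move=> zm wm fz fw; have := moore_contraction zm wm; rewrite fz fw subrr mulmx0 subr0 => h.
apply/esym/eqP; rewrite -subr_eq0; apply/eqP/cnorm_eq0.
rewrite leNgt; apply/negP => q0.
by move: h; rewrite leNgt gtr_pMl // rho1.
Qed.

Lemma moore_exists : exists2 z, in_mbox m z & f z = 0.
Proof.
pose g z := z - A *m f z.
have gm z : in_mbox m z -> in_mbox m (g z).
  move=> zm; rewrite /in_mbox /g addrAC; apply: le_trans (moore_self_map zm) _.
  by rewrite ger_pMl // ltW.
have gc z w : in_mbox m z -> in_mbox m w -> cnorm (g w - g z) <= rho * cnorm (w - z).
  move=> zm wm; have := moore_contraction zm wm; congr (cnorm _ <= _).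
  by rewrite /g mulmxBr !opprB [A *m f z - _]addrC addrACA [- z + _]addrC.
(* Quasi-Newton iteration from the centre; its first step has length at most [r], the constant of
   the geometric bound below. *)
pose y k := iter k g x.
have ym k : in_mbox m (y k).
  by elim: k => [|k IH]; [rewrite /in_mbox subrr cnorm0 ltW | apply: gm].
have rho01 : 0 <= rho < 1 by rewrite moore_rho_ge0.
have y0 : y 0%N = x by [].
have yS k : y k.+1 = g (y k) by [].
clearbody y; 
have hy k : cnorm (y k.+1 - y k) <= r * rho ^+ k.
  elim: k => [|k IH]; first by rewrite expr0 mulr1 y0; apply: ym.
  have := gc _ _ (ym k) (ym k.+1); rewrite -!yS => hk; apply: le_trans hk _.
  by rewrite exprS mulrCA ler_wpM2l // moore_rho_ge0.
have [z hz] := geometric_limit_mx (ltW r0) rho01 hy.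
set C := r / (1 - rho) in hz.
have C0 : 0 <= C by rewrite divr_ge0 // ?subr_ge0 ltW.
have small (q c : R) : 0 <= c -> (forall k, q <= c * rho ^+ k) -> q <= 0.
  move=> c0 hq; rewrite leNgt; apply/negP => q0.
  have cc : (fun k => c * rho ^+ k) @ \oo --> c * 0.
    apply: cvgMl_tmp; apply: cvg_expr; rewrite ger0_norm ?moore_rho_ge0 //.
  rewrite mulr0 in cc.
  have /cvgr0Pnorm_lt /(_ q q0)[N _ /(_ N (leqnn N))] := cc.
  by rewrite ger0_norm ?mulr_ge0 ?exprn_ge0 ?moore_rho_ge0 // ltNge hq.
have zm : in_mbox m z.
  rewrite /in_mbox -subr_le0; apply: (small _ C) => // k.
  have := cnormD (- (y k - z)) (y k - x); rewrite cnormN opprB addrA subrK.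
  by move: (hz k) (ym k); rewrite /in_mbox; lra.
exists z => //.
have gz : cnorm (g z - z) <= 0.
  apply: (small _ (C + C)) => [|k]; first exact: addr_ge0.
  have h1 := gc _ _ (ym k) zm; have h2 := hz k.+1.
  have := cnormD (g z - y k.+1) (y k.+1 - z); rewrite addrA subrK => h3.
  have h4 := hz k; rewrite cnormB in h4; rewrite exprS in h2; rewrite -yS in h1.
  have p0 : 0 <= C * rho ^+ k by rewrite mulr_ge0 ?exprn_ge0 ?moore_rho_ge0.
  have h5 : rho * cnorm (z - y k) <= C * rho ^+ k.
    by apply: le_trans h4; rewrite ler_piMl ?cnorm_ge0 // ltW.
  have h6 : C * (rho * rho ^+ k) <= C * rho ^+ k.
    by rewrite mulrCA ler_piMl // ltW.
  rewrite mulrDl; lra.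
(* A fixed point of [g] only annihilates [A *m f z]; the zero follows from the invertibility of
   [A]. *)
have : A *m f z = 0.
  by have := cnorm_eq0 gz; rewrite /g addrAC subrr add0r => /eqP; rewrite oppr_eq0 => /eqP.
by move/(congr1 (mulmx (invmx A))); rewrite mulKmx ?moore_mat_unit // mulmx0.
Qed.

Lemma moore_associated z : in_mbox m z -> f z = 0 -> associated_zero f m z.
Proof.
move=> zm fz; split; first by split => //; apply/in_mboxP.
by move=> w [fw /(in_mboxP _ r0) wm]; apply: moore_unique.
Qed.

End OneBox.
End MooreBox.

(** * Interval arithmetic *)

Section IntervalArith.
Variables (R : realType) (Ar : interval_arith R).
Implicit Types (I J E : ival R) (X Y Z : cbox R).

Lemma rep1 : 1 \in rep Ar.
Proof. by case: (rep_subring Ar). Qed.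

Lemma repB x y : x \in rep Ar -> y \in rep Ar -> x - y \in rep Ar.
Proof. by case: (rep_subring Ar) => _ + _; apply. Qed.

Lemma repM x y : x \in rep Ar -> y \in rep Ar -> x * y \in rep Ar.
Proof. by case: (rep_subring Ar) => _ _; apply. Qed.

Lemma rep0 : 0 \in rep Ar.
Proof. by rewrite -(subrr 1) repB // rep1. Qed.

Lemma repN x : x \in rep Ar -> - x \in rep Ar.
Proof. by move=> xr; rewrite -sub0r repB // rep0. Qed.

Lemma repD x y : x \in rep Ar -> y \in rep Ar -> x + y \in rep Ar.
Proof. by move=> xr yr; rewrite -[y]opprK repB // repN. Qed.

Lemma rep_nat k : k%:R \in rep Ar.
Proof. by elim: k => [|k IH]; rewrite ?rep0 // -natr1 repD // rep1. Qed.

Lemma rep_div2 x : x \in rep Ar -> x / 2 \in rep Ar.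
Proof. by move=> xr; rewrite repM // rep_half. Qed.

Definition cvalid X := is_ival (rep Ar) (bRe X) /\ is_ival (rep Ar) (bIm X).
Definition mxvalid m p (X : 'M[cbox R]_(m, p)) := forall i j, cvalid (X i j).
Definition cbounded (M : R) X := bounded_by M (bRe X) /\ bounded_by M (bIm X).

Lemma cvalid_point z : crep Ar z -> cvalid (cb_point z).
Proof. by case/andP => zr zi; split; split. Qed.

Lemma ival_neg I : is_ival (rep Ar) I -> is_ival (rep Ar) (ineg I).
Proof. by case=> l h lh; split; rewrite /= ?repN // lerN2. Qed.

Lemma ineg_incl I x : in_ival I x -> in_ival (ineg I) (- x).
Proof. by rewrite /in_ival /= => /andP[? ?]; rewrite !lerN2; apply/andP. Qed.

Lemma ineg_bounded (M : R) I : bounded_by M I -> bounded_by M (ineg I).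
Proof. by case=> ? ?; split; rewrite /= ?lerN2 // -[M]opprK lerN2. Qed.

Lemma in_ival_bounded (M : R) I x : bounded_by M I -> in_ival I x -> `|x| <= M.
Proof.
case=> l h /andP[lx xh]; rewrite ler_norml; apply/andP.
by split; [apply: le_trans lx | apply: le_trans h].
Qed.

Lemma cbounded_mono (M M' : R) X : M <= M' -> cbounded M X -> cbounded M' X.
Proof.
move=> MM [[? ?] [? ?]]; split; split;
  by [apply: le_trans MM | apply: le_trans; [|eassumption]; rewrite lerN2].
Qed.

Lemma in_cbox_bounded (M : R) X z : cbounded M X -> in_cbox X z -> cabs z <= M.
Proof.
move=> [a b] [c d]; apply/cabs_le; split; first exact: in_ival_bounded a c.
exact: in_ival_bounded b d.
Qed.

Lemma cbounded_point (M : R) z : cabs z <= M -> cbounded M (cb_point z).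
Proof.
by move=> /cabs_le[]; rewrite !ler_norml => /andP[? ?] /andP[? ?]; split; split.
Qed.

Lemma in_cb_point (z : R[i]) : in_cbox (cb_point z) z.
Proof. by split; rewrite /in_ival /= !lexx. Qed.

Lemma in_cb_pointE (z w : R[i]) : in_cbox (cb_point z) w -> w = z.
Proof.
case=> /andP[/= a b] /andP[/= c d]; apply/eqP.
by rewrite eq_complex !eq_le a b c d.
Qed.

Lemma cb_ball_valid r : r \in rep Ar -> 0 <= r -> cvalid (cb_ball r).
Proof. by move=> rr r0; split; split; rewrite /= ?repN //; lra. Qed.

Lemma cb_ball_bounded (M r : R) : r <= M -> cbounded M (cb_ball r).
Proof. by move=> rM; split; split; rewrite /= ?lerN2. Qed.

Section BoxNorm.
Variables (m p : nat) (X : 'M[cbox R]_(m, p)).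
Implicit Types z w : 'M[R[i]]_(m, p).
Hypothesis Xv : mxvalid X.

Definition lo_mx : 'M[R[i]]_(m, p) := \matrix_(i, j) (lo (bRe (X i j)) +i* lo (bIm (X i j))).
Definition hi_mx : 'M[R[i]]_(m, p) := \matrix_(i, j) (hi (bRe (X i j)) +i* hi (bIm (X i j))).

Lemma lo_mx_in : box_set X lo_mx.
Proof. by move=> i j; rewrite mxE; have [[_ _ h] [_ _ h']] := Xv i j; split; rewrite /in_ival /= lexx. Qed.

Lemma hi_mx_in : box_set X hi_mx.
Proof. by move=> i j; rewrite mxE; have [[_ _ h] [_ _ h']] := Xv i j; split; rewrite /in_ival /= lexx andbT. Qed.

Lemma box_set_bounded : exists2 b, 0 <= b & forall z, box_set X z -> cnorm z <= b.
Proof.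
exists (cnorm lo_mx + cnorm hi_mx) => [|z zX]; first by rewrite addr_ge0 ?cnorm_ge0.
apply/cnorm_le => [|i j]; first by rewrite addr_ge0 ?cnorm_ge0.
have := cabs_cnorm lo_mx i j; have := cabs_cnorm hi_mx i j; rewrite !mxE.
move=> /cabs_le[] /=; rewrite !ler_norml => /andP[a1 a2] /andP[a3 a4].
move=> /cabs_le[] /=; rewrite !ler_norml => /andP[b1 b2] /andP[b3 b4].
have [/andP[c1 c2] /andP[c3 c4]] := zX i j.
by apply/cabs_le; rewrite !ler_norml; split; apply/andP; split; move: (cnorm_ge0 lo_mx) (cnorm_ge0 hi_mx); lra.
Qed.

Lemma box_norm_ge z : box_set X z -> cnorm z <= box_norm X.
Proof.
move=> zX; apply: sup_upper_bound; last by exists z.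
by split; [exists (cnorm z), z | have [b _ hb] := box_set_bounded; exists b => _ [w wX <-]; apply: hb].
Qed.

Lemma box_norm_le c : (forall z, box_set X z -> cnorm z <= c) -> box_norm X <= c.
Proof.
move=> h; apply: ge_sup; first by exists (cnorm lo_mx), lo_mx => //; apply: lo_mx_in.
by move=> _ [w wX <-]; apply: h.
Qed.

Lemma box_norm_bounded c : 0 <= c -> (box_norm X <= c <-> forall i j, cbounded c (X i j)).
Proof.
move=> c0; split=> [h i j|h]; last first.
  by apply: box_norm_le => z zX; apply/cnorm_le => // i j; apply: in_cbox_bounded (h i j) (zX i j).
have /(cnorm_le _ c0) /(_ i j) := le_trans (box_norm_ge lo_mx_in) h.
have /(cnorm_le _ c0) /(_ i j) := le_trans (box_norm_ge hi_mx_in) h.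
rewrite !mxE => /cabs_le[] /=; rewrite !ler_norml => /andP[a1 a2] /andP[a3 a4].
by move=> /cabs_le[] /=; rewrite !ler_norml => /andP[b1 b2] /andP[b3 b4].
Qed.

Lemma box_width_ge z w : box_set X z -> box_set X w -> cnorm (z - w) <= box_width X.
Proof.
move=> zX wX; apply: sup_upper_bound; last by exists z => //; exists w.
split; first by exists (cnorm (z - w)), z => //; exists w.
have [b _ hb] := box_set_bounded; exists (b + b) => _ [z' z'X [w' w'X <-]].
by apply: le_trans (cnormD _ _) _; rewrite cnormN lerD ?hb.
Qed.

Lemma box_width_le c : (forall z w, box_set X z -> box_set X w -> cnorm (z - w) <= c) ->
  box_width X <= c.
Proof.
move=> h; apply: ge_sup; last by move=> _ [z zX [w wX <-]]; apply: h.
by exists (cnorm (lo_mx - lo_mx)), lo_mx; [apply: lo_mx_in | exists lo_mx => //; apply: lo_mx_in].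
Qed.

End BoxNorm.

Section Precision.
Variable u : R.
Hypothesis u01 : 0 < u < 1.

Lemma cb_add_valid X Y : cvalid X -> cvalid Y -> cvalid (cb_add Ar u X Y).
Proof. by move=> [? ?] [? ?]; split; apply: iadd_ival. Qed.

Lemma cb_neg_valid X : cvalid X -> cvalid (cb_neg X).
Proof. by move=> [? ?]; split; apply: ival_neg. Qed.

Lemma cb_mul_valid X Y : cvalid X -> cvalid Y -> cvalid (cb_mul Ar u X Y).
Proof.
move=> [? ?] [? ?]; split; apply: iadd_ival => //; do ?[exact: imul_ival].
by apply: ival_neg; apply: imul_ival.
Qed.

Lemma cb_div_valid X r : r \in rep Ar -> 0 < r -> cvalid X -> cvalid (cb_div Ar u X r).
Proof. by move=> ? ? [? ?]; split; apply: idiv_ival. Qed.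

Lemma cb_add_incl X Y z w : cvalid X -> cvalid Y -> in_cbox X z -> in_cbox Y w ->
  in_cbox (cb_add Ar u X Y) (z + w).
Proof. by move=> [? ?] [? ?] [? ?] [? ?]; split; rewrite ?cReD ?cImD; apply: iadd_incl. Qed.

Lemma cb_neg_incl X z : in_cbox X z -> in_cbox (cb_neg X) (- z).
Proof. by move=> [? ?]; split; rewrite ?cReN ?cImN; apply: ineg_incl. Qed.

Lemma cb_mul_incl X Y z w : cvalid X -> cvalid Y -> in_cbox X z -> in_cbox Y w ->
  in_cbox (cb_mul Ar u X Y) (z * w).
Proof.
move=> [? ?] [? ?] [? ?] [? ?]; split; rewrite ?cReM ?cImM; apply: iadd_incl => //;
  do ?[exact: imul_ival | exact: imul_incl].
  by apply: ival_neg; apply: imul_ival.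
by apply: ineg_incl; apply: imul_incl.
Qed.

Lemma cb_div_incl X r z : r \in rep Ar -> 0 < r -> cvalid X -> in_cbox X z ->
  in_cbox (cb_div Ar u X r) ((r^-1)%:C * z).
Proof.
by move=> ? ? [? ?] [? ?]; split; rewrite ?cReZ ?cImZ mulrC; apply: idiv_incl.
Qed.

(* E stands for the exact result: I exceeds it by at most M * kappa. *)
Definition near_ival (kappa M : R) I E : Prop :=
  [/\ is_ival (rep Ar) I, bounded_by M I, bounded_by M E, lo E <= hi E &
      lo E - M * kappa <= lo I /\ hi I <= hi E + M * kappa].

Lemma near_mono kappa M M' I E : 0 <= kappa -> M <= M' -> near_ival kappa M I E -> near_ival kappa M' I E.
Proof.
move=> k0 MM [Iv [? ?] [? ?] ? [? ?]].
have MMk : M * kappa <= M' * kappa by rewrite ler_wpM2r.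
by split => //; split; lra.
Qed.

Lemma near_neg kappa M I E : near_ival kappa M I E -> near_ival kappa M (ineg I) (ineg E).
Proof.
move=> [Iv ? ? ? [? ?]]; split; do ?[exact: ival_neg | exact: ineg_bounded].
  by rewrite /= lerN2.
by rewrite /=; split; lra.
Qed.

(** [E''] may be any interval containing all sums from [E] and [E']. This serves both for exact
    values, where [E''] is a point, and for a second rounded computation. Rounding is charged to the
    same [kappa] as the errors of the operands, whence [u <= kappa]. *)
Lemma near_add kappa M I J E E' E'' : u <= kappa -> 1 <= M ->
  near_ival kappa M I E -> near_ival kappa M J E' -> bounded_by (3 * M) E'' -> lo E'' <= hi E'' ->
  (forall x y, in_ival E x -> in_ival E' y -> in_ival E'' (x + y)) ->
  near_ival kappa (3 * M) (iadd Ar u I J) E''.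
Proof.
move=> uk M1 [Iv Ib Eb El [I1 I2]] [Jv Jb Eb' El' [J1 J2]] Eb'' El'' h.
have [u0 u1] := andP u01.
have Mu : M * u <= M * kappa by rewrite ler_wpM2l //; lra.
have Mu1 : M * u <= M by rewrite ler_piMr //; lra.
have [t1 t2] := iadd_tight u01 M1 Iv Jv Ib Jb.
have /andP[h1 _] : in_ival E'' (lo E + lo E') by apply: h; rewrite /in_ival /= lexx.
have /andP[_ h2] : in_ival E'' (hi E + hi E') by apply: h; rewrite /in_ival /= lexx andbT.
split => //; first exact: iadd_ival.
  by move: Ib Jb => [? ?] [? ?]; split; lra.
by split; lra.
Qed.

(** Turns nearness of endpoints into nearness of points, as products require: the endpoints of a
    product are not products of matching endpoints. *)
Lemma near_clamp kappa M I E x : 0 <= M * kappa -> near_ival kappa M I E -> lo I <= x <= hi I ->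
  exists2 y, in_ival E y & `|x - y| <= M * kappa.
Proof.
move=> k0 [_ _ _ El [I1 I2]] /andP[x1 x2].
have [xl|xl] := leP x (lo E).
  by exists (lo E); rewrite /in_ival /= ?lexx // ler_norml; apply/andP; split; lra.
have [xh|xh] := leP (hi E) x.
  by exists (hi E); rewrite /in_ival /= ?lexx ?andbT // ler_norml; apply/andP; split; lra.
by exists x; [rewrite /in_ival /= !ltW | rewrite subrr normr0].
Qed.

Lemma near_mul kappa M I J E E' E'' : u <= kappa -> 1 <= M ->
  near_ival kappa M I E -> near_ival kappa M J E' -> bounded_by (3 * M ^+ 2) E'' -> lo E'' <= hi E'' ->
  (forall x y, in_ival E x -> in_ival E' y -> in_ival E'' (x * y)) ->
  near_ival kappa (3 * M ^+ 2) (imul Ar u I J) E''.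
Proof.
move=> uk M1 nI nJ Eb'' El'' h.
have [Iv Ib Eb El _] := nI; have [Jv Jb Eb' El' _] := nJ.
have [u0 u1] := andP u01.
have k0 : 0 <= kappa by lra.
have M0 : 0 <= M by lra.
have Mk0 : 0 <= M * kappa by rewrite mulr_ge0.
have M20 : 0 <= M ^+ 2 by rewrite exprn_ge0.
have Mu : M ^+ 2 * u <= M ^+ 2 * kappa by rewrite ler_wpM2l.
have Mu1 : M ^+ 2 * u <= M ^+ 2 by rewrite ler_piMr //; lra.
have := imul_tight u01 M1 Iv Jv Ib Jb => -[t1 t2].
(* Replacing the two factors one after the other costs [M * (M * kappa)] twice; with the rounding
   error [M ^+ 2 * u] this makes the factor 3. *)
have corner x y : lo I <= x <= hi I -> lo J <= y <= hi J ->
    [/\ - M ^+ 2 <= x * y <= M ^+ 2, lo E'' - 2 * M ^+ 2 * kappa <= x * y &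
        x * y <= hi E'' + 2 * M ^+ 2 * kappa].
  move=> xI yJ; have [x' x'E xx] := near_clamp Mk0 nI xI.
  have [y' y'E yy] := near_clamp Mk0 nJ yJ.
  have xM := in_ival_bounded Ib xI; have yM := in_ival_bounded Eb' y'E.
  have yM' := in_ival_bounded Jb yJ.
  have : `|x * y - x' * y'| <= 2 * M ^+ 2 * kappa.
    rewrite (_ : x * y - x' * y' = x * (y - y') + (x - x') * y'); last by ring.
    apply: le_trans (ler_normD _ _) _; rewrite !normrM.
    have a1 : `|x| * `|y - y'| <= M * (M * kappa) by rewrite ler_pM.
    have a2 : `|x - x'| * `|y'| <= (M * kappa) * M by rewrite ler_pM.
    by move: a1 a2; rewrite expr2 (mulrC _ M) mulrA; lra.
  have /andP[e1 e2] := h _ _ x'E y'E.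
  have : `|x * y| <= M ^+ 2 by rewrite normrM expr2 ler_pM.
  by rewrite !ler_norml => -> /andP[b1 b2]; split => //; clear -e1 e2 b1 b2; lra.
have lI : lo I <= lo I <= hi I by rewrite lexx; case: Iv.
have hI : lo I <= hi I <= hi I by rewrite lexx andbT; case: Iv.
have lJ : lo J <= lo J <= hi J by rewrite lexx; case: Jv.
have hJ : lo J <= hi J <= hi J by rewrite lexx andbT; case: Jv.
have [/andP[a1 a2] a3 a4] := corner _ _ lI lJ.
have [/andP[b1 b2] b3 b4] := corner _ _ lI hJ.
have [/andP[c1 c2] c3 c4] := corner _ _ hI lJ.
have [/andP[d1 d2] d3 d4] := corner _ _ hI hJ.
have m1 e : e <= lo I * lo J -> e <= lo I * hi J -> e <= hi I * lo J -> e <= hi I * hi J ->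
  e - M ^+ 2 * u <= lo (imul Ar u I J).
  by move=> *; apply: le_trans t1; rewrite lerD2r !le_min; apply/andP; split; apply/andP.
have m2 e : lo I * lo J <= e -> lo I * hi J <= e -> hi I * lo J <= e -> hi I * hi J <= e ->
  hi (imul Ar u I J) <= e + M ^+ 2 * u.
  by move=> *; apply: le_trans t2 _; rewrite lerD2r !ge_max; apply/andP; split; apply/andP.
split => //; first exact: imul_ival.
  by split; [have := m1 _ a1 b1 c1 d1 | have := m2 _ a2 b2 c2 d2]; clear -Mu1 M20; lra.
by split; [have := m1 _ a3 b3 c3 d3 | have := m2 _ a4 b4 c4 d4]; clear -Mu; lra.
Qed.

(** Once [kappa] absorbs [s], an interval of radius [s] counts as an inaccurate point 0: the radius
    of a box is treated like a rounding error. *)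
Lemma near_ival_ball kappa M s : s \in rep Ar -> 0 <= s <= M -> s <= M * kappa ->
  near_ival kappa M (Ival (- s) s) (ipoint 0).
Proof.
move=> sr /andP[s0 sM] sk.
by split; [split | split | split | | split] => /=; do ?[exact: repN | lra | done].
Qed.

End Precision.
End IntervalArith.

(** * Comparing two evaluations of the same circuit *)

Section Relations.
Variables (R : realType) (Ar : interval_arith R).

Definition growth (Phi : R -> R) := forall M, 1 <= M -> M <= Phi M.

(* [Rel M] relates two interpretations of a computation, with the constants in
   the estimates bounded by [M]; an operation enlarges [M] to [Phi M]. *)
Record arith_rel (Phi : R -> R) T1 T2 (o1 : arith R T1) (o2 : arith R T2)
    (Rel : R -> T1 -> T2 -> Prop) : Prop := ArithRel {
  rel_mono : forall M M' x y, 1 <= M -> M <= M' -> Rel M x y -> Rel M' x y;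
  rel_point : forall M z, 1 <= M -> crep Ar z -> cabs z <= M ->
    Rel M (a_box o1 (cb_point z)) (a_box o2 (cb_point z));
  rel_add : forall M x1 x2 y1 y2, 1 <= M -> Rel M x1 x2 -> Rel M y1 y2 ->
    Rel (Phi M) (a_add o1 x1 y1) (a_add o2 x2 y2);
  rel_neg : forall M x1 x2, 1 <= M -> Rel M x1 x2 -> Rel (Phi M) (a_neg o1 x1) (a_neg o2 x2);
  rel_mul : forall M x1 x2 y1 y2, 1 <= M -> Rel M x1 x2 -> Rel M y1 y2 ->
    Rel (Phi M) (a_mul o1 x1 y1) (a_mul o2 x2 y2) }.

Definition gate_const_ok N (g : gate R N) : bool :=
  if g is GConst a then crep Ar a else true.

Lemma circuit_ok_const N m p (c : circuit R N m p) : circuit_ok Ar c ->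
  all (@gate_const_ok N) (gates c).
Proof.
case=> h _; apply/(all_nthP (GConst N 0)) => k /h.
by case: (nth _ _ _).
Qed.

Section Uniform.
Variable Phi : R -> R.
Hypothesis PhiP : growth Phi.

(** [M'] is chosen before the arithmetics, the relation and the inputs, hence before the precision.
    All uniform estimates rest on this order of quantifiers. *)
Lemma gates_rel N (gs : seq (gate R N)) (M : R) : 1 <= M -> all (@gate_const_ok N) gs ->
  exists2 M', M <= M' & forall T1 T2 (o1 : arith R T1) (o2 : arith R T2) Rel,
    arith_rel Phi o1 o2 Rel -> forall inp1 inp2, (forall i, Rel M (inp1 i) (inp2 i)) ->
    forall vs1 vs2, size vs1 = size vs2 ->
    let cst1 z := a_box o1 (cb_point z) in let cst2 z := a_box o2 (cb_point z) in
    (forall j, Rel M (nth (cst1 0) vs1 j) (nth (cst2 0) vs2 j)) ->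
    forall j,
    Rel M' (nth (cst1 0) (foldl (fun vs g => rcons vs
                (gate_value cst1 (a_add o1) (a_mul o1) inp1 vs g)) vs1 gs) j)
           (nth (cst2 0) (foldl (fun vs g => rcons vs
                (gate_value cst2 (a_add o2) (a_mul o2) inp2 vs g)) vs2 gs) j).
Proof.
elim: gs M => [|g gs IH] M M1; first by exists M.
(* [b] makes room for the constant that the gate may carry, so that [M + b] bounds it together with
   the earlier values. *)
case/andP=> gok gsok; pose b := if g is GConst a then cabs a else 0.
have b0 : 0 <= b by rewrite /b; case: (g) => // a; apply: cabs_ge0.
have bg : if g is GConst a then cabs a <= b else true by rewrite /b; case: (g).
clearbody b.
have M1' : 1 <= Phi (M + b) by apply: le_trans (PhiP _); lra.
have MM : M <= Phi (M + b) by apply: le_trans (PhiP _); lra.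
have [M' M'ge hM'] := IH _ M1' gsok; exists M'; first exact: le_trans M'ge.
move=> T1 T2 o1 o2 Rel rel inp1 inp2 hinp vs1 vs2 svs cst1 cst2 hvs j /=.
have up x y : Rel M x y -> Rel (Phi (M + b)) x y by apply: (rel_mono rel).
have up' x y : Rel M x y -> Rel (M + b) x y by apply: (rel_mono rel) => //; lra.
apply: (hM' _ _ o1 o2) => [//|i||{}j]; [exact: up | by rewrite !size_rcons svs |].
rewrite !nth_rcons svs; case: ltnP => _; first exact: up.
(* Positions beyond the list return the constant 0, which is related to itself. *)
case: eqP => _; last by apply: (rel_point rel) => //; rewrite ?cabs0 ?/crep ?/= ?rep0 //; lra.
have M1b : 1 <= M + b by lra.
case: (g) gok bg => [i|a|i k|i k] /= gok bg.
- exact: up.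
- by apply: (rel_point rel) => //; apply: le_trans (PhiP _) => //; lra.
- by apply: (rel_add rel) => //; apply: up'.
- by apply: (rel_mul rel) => //; apply: up'.
Qed.

Lemma circuit_rel N m p (c : circuit R N m p) (M : R) : circuit_ok Ar c -> 1 <= M ->
  exists2 M', M <= M' & forall T1 T2 (o1 : arith R T1) (o2 : arith R T2) Rel,
    arith_rel Phi o1 o2 Rel -> forall inp1 inp2, (forall i, Rel M (inp1 i) (inp2 i)) ->
    forall i j, Rel M' (a_circuit o1 c inp1 i j) (a_circuit o2 c inp2 i j).
Proof.
move=> /circuit_ok_const cok M1; have [M' MM hM] := gates_rel M1 cok.
exists M' => // T1 T2 o1 o2 Rel rel inp1 inp2 hinp i j.
rewrite /a_circuit /circuit_eval !mxE; apply: (hM _ _ o1 o2) => // k.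
by rewrite !nth_nil; apply: (rel_point rel) => //; rewrite ?cabs0 ?/crep ?/= ?rep0 //; lra.
Qed.

Lemma mulmx_rel p (M : R) : 1 <= M ->
  exists2 M', M <= M' & forall T1 T2 (o1 : arith R T1) (o2 : arith R T2) Rel,
    arith_rel Phi o1 o2 Rel -> forall m q (X1 : 'M[T1]_(m, p)) (X2 : 'M[T2]_(m, p))
      (Y1 : 'M[T1]_(p, q)) (Y2 : 'M[T2]_(p, q)),
    (forall i j, Rel M (X1 i j) (X2 i j)) -> (forall i j, Rel M (Y1 i j) (Y2 i j)) ->
    forall i j, Rel M' (a_mulmx o1 X1 Y1 i j) (a_mulmx o2 X2 Y2 i j).
Proof.
(* Two growths per summand: one for the product, one for the sum. *)
move=> M1; pose G k := iter k (fun M => Phi (Phi M)) M.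
have G1 k : 1 <= G k.
  elim: k => [|k IH] //=; have h := le_trans IH (PhiP IH).
  exact: le_trans h (PhiP h).
have PG k : 1 <= Phi (G k) by apply: le_trans (G1 k) (PhiP (G1 k)).
have GM k : M <= G k.
  elim: k => [|k IH] //=; have h := G1 k; have h' := le_trans h (PhiP h).
  exact: le_trans (le_trans IH (PhiP h)) (PhiP h').
exists (G p) => // T1 T2 o1 o2 Rel rel m q X1 X2 Y1 Y2 hX hY i j; rewrite !mxE.
have -> : G p = G (size (index_enum 'I_p)) by rewrite /index_enum -enumT size_enum_ord.
elim: (index_enum _) => [|k s IH].
  by rewrite !big_nil; apply: (rel_point rel) => //; rewrite ?cabs0 ?/crep ?/= ?rep0 //; lra.
rewrite !big_cons /=; apply: (rel_add rel) => //; last first.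
  by apply: (rel_mono rel) IH => //; apply: PhiP.
by apply: (rel_mul rel) => //; [apply: (rel_mono rel) (hX _ _) | apply: (rel_mono rel) (hY _ _)].
Qed.

Lemma addmx_rel T1 T2 (o1 : arith R T1) (o2 : arith R T2) Rel : arith_rel Phi o1 o2 Rel ->
  forall (M : R) m q (X1 : 'M[T1]_(m, q)) (X2 : 'M[T2]_(m, q))
    (Y1 : 'M[T1]_(m, q)) (Y2 : 'M[T2]_(m, q)), 1 <= M ->
  (forall i j, Rel M (X1 i j) (X2 i j)) -> (forall i j, Rel M (Y1 i j) (Y2 i j)) ->
  forall i j, Rel (Phi M) (a_addmx o1 X1 Y1 i j) (a_addmx o2 X2 Y2 i j).
Proof. by move=> rel M m q X1 X2 Y1 Y2 M1 hX hY i j; rewrite !mxE; apply: (rel_add rel). Qed.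

Lemma oppmx_rel T1 T2 (o1 : arith R T1) (o2 : arith R T2) Rel : arith_rel Phi o1 o2 Rel ->
  forall (M : R) m q (X1 : 'M[T1]_(m, q)) (X2 : 'M[T2]_(m, q)), 1 <= M ->
  (forall i j, Rel M (X1 i j) (X2 i j)) ->
  forall i j, Rel (Phi M) (a_oppmx o1 X1 i j) (a_oppmx o2 X2 i j).
Proof. by move=> rel M m q X1 X2 M1 hX i j; rewrite !mxE; apply: (rel_neg rel). Qed.

Lemma mx_rel T1 T2 (o1 : arith R T1) (o2 : arith R T2) Rel : arith_rel Phi o1 o2 Rel ->
  forall (M : R) m q (A : 'M[R[i]]_(m, q)), 1 <= M -> mxrep Ar A -> cnorm A <= M ->
  forall i j, Rel M (a_mx o1 A i j) (a_mx o2 A i j).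
Proof.
move=> rel M m q A M1 Arep AM i j; rewrite !mxE; apply: (rel_point rel) => //.
exact: le_trans (cabs_cnorm _ _ _) AM.
Qed.

(** The last factor is an argument because the exact counterpart of the ball is a single vector in
    it: one relation then covers [krawczyk] and its exact value at each such vector. *)
Definition krawczyk_on T (o : arith R T) n (r : R) (A : 'M[R[i]]_n) (fx : 'cV[T]_n)
    (dfX : 'M[T]_n) (ball : 'cV[T]_n) : 'cV[T]_n :=
  a_addmx o (a_oppmx o (map_mx (fun X => a_div o X r) (a_mulmx o (a_mx o A) fx)))
    (a_mulmx o (a_addmx o (a_mx o 1%:M) (a_oppmx o (a_mulmx o (a_mx o A) dfX))) ball).

Lemma mxrep1 n : mxrep Ar (1%:M : 'M[R[i]]_n).
Proof. by move=> i j; rewrite mxE; case: (i == j); rewrite /crep /= ?rep1 ?rep0. Qed.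

Lemma cnorm1_le n : cnorm (1%:M : 'M[R[i]]_n) <= 1.
Proof. by apply/cnorm_le => // i j; rewrite mxE; case: (i == j); rewrite ?cabs1 ?cabs0. Qed.

(** Division enters as a hypothesis on its own: it involves the radius, so only division by the
    given [r] has to be compatible with [Phi]. *)
Lemma krawczyk_rel n (M : R) : 1 <= M ->
  exists2 M', M <= M' & forall T1 T2 (o1 : arith R T1) (o2 : arith R T2) Rel (r : R),
    arith_rel Phi o1 o2 Rel ->
    (forall M x y, 1 <= M -> Rel M x y -> Rel (Phi M) (a_div o1 x r) (a_div o2 y r)) ->
    forall (A : 'M[R[i]]_n) (f1 : 'cV[T1]_n) (f2 : 'cV[T2]_n) (d1 : 'M[T1]_n)
      (d2 : 'M[T2]_n) (b1 : 'cV[T1]_n) (b2 : 'cV[T2]_n),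
    mxrep Ar A -> cnorm A <= M ->
    (forall i j, Rel M (f1 i j) (f2 i j)) -> (forall i j, Rel M (d1 i j) (d2 i j)) ->
    (forall i j, Rel M (b1 i j) (b2 i j)) ->
    forall i j, Rel M' (krawczyk_on o1 r A f1 d1 b1 i j) (krawczyk_on o2 r A f2 d2 b2 i j).
Proof.
move=> M1; have [M2 MM2 h2] := mulmx_rel n M1.
have M2_1 : 1 <= M2 by apply: le_trans MM2.
have P1 := PhiP M2_1; have P1' := le_trans M2_1 P1.
have P2 := PhiP P1'; have P2' := le_trans P1' P2.
have [M3 MM3 h3] := mulmx_rel n P2'.
have M3_1 : 1 <= M3 by apply: le_trans MM3.
have P3 := PhiP M3_1.
exists (Phi M3); first by do ?[apply: le_trans P3 | apply: le_trans MM3 | apply: le_trans P2 | apply: le_trans P1].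
move=> T1 T2 o1 o2 Rel r rel hdiv A f1 f2 d1 d2 b1 b2 Arep AM hf hd hb.
have hA := mx_rel rel M1 Arep AM.
apply: (addmx_rel rel) => //.
  move=> i j; apply: (rel_mono rel) MM3 _ => //.
  apply: (oppmx_rel rel) => // {}i {}j; rewrite !mxE; apply: hdiv => //.
  by have := h2 _ _ _ _ _ rel _ _ _ _ _ _ hA hf i j; rewrite !mxE.
apply: (h3 _ _ _ _ _ rel) => i j.
  apply: (addmx_rel rel) => // [k l|k l].
    apply: (mx_rel rel) => //; first exact: mxrep1.
    exact: le_trans (cnorm1_le _) P1'.
  by apply: (oppmx_rel rel) => // ? ?; apply: (h2 _ _ _ _ _ rel).
apply: (rel_mono rel) (hb i j) => //.
by do ?[apply: le_trans P2 | apply: le_trans P1].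
Qed.

End Uniform.

(** Exact complex arithmetic in the format of [arith]. A box is read through its lower corner, which
    for a point box is the point. *)
Definition pt_arith : arith R R[i] :=
  Arith (fun X => lo (bRe X) +i* lo (bIm X)) +%R (fun z => - z) *%R (fun z r => (r^-1)%:C * z).

Lemma pt_point z : a_box pt_arith (cb_point z) = z.
Proof. by case: z. Qed.

Lemma a_circuit_pt N m p (c : circuit R N m p) inp :
  a_circuit pt_arith c inp = circuit_eval id +%R *%R c inp.
Proof. by rewrite /a_circuit; congr circuit_eval; apply/funext => z; apply: pt_point. Qed.

Lemma a_mx_pt m p (A : 'M[R[i]]_(m, p)) : a_mx pt_arith A = A.
Proof. by apply/matrixP => i j; rewrite mxE pt_point. Qed.

Lemma a_mulmx_pt m p q (A : 'M[R[i]]_(m, p)) (B : 'M[R[i]]_(p, q)) : a_mulmx pt_arith A B = A *m B.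
Proof. by apply/matrixP => i j; rewrite !mxE. Qed.

Lemma a_addmx_pt m p (A B : 'M[R[i]]_(m, p)) : a_addmx pt_arith A B = A + B.
Proof. by apply/matrixP => i j; rewrite !mxE. Qed.

Lemma a_oppmx_pt m p (A : 'M[R[i]]_(m, p)) : a_oppmx pt_arith A = - A.
Proof. by apply/matrixP => i j; rewrite !mxE. Qed.

Lemma krawczyk_on_pt n r (A d : 'M[R[i]]_n) (f b : 'cV[R[i]]_n) :
  krawczyk_on pt_arith r A f d b =
  (- (r^-1)%:C) *: (A *m f) + (1%:M - A *m d) *m b.
Proof.
rewrite /krawczyk_on !a_mx_pt !a_mulmx_pt !a_oppmx_pt !a_addmx_pt.
by congr (_ + _); apply/matrixP => i j; rewrite !mxE mulNr.
Qed.

Section BoxRelations.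
Variable u : R.
Hypothesis u01 : 0 < u < 1.
Notation B := (box_arith Ar u).

Definition encloses (M : R) (X : cbox R) z := cvalid Ar X /\ in_cbox X z.

(** Containment is the same relation for all [M], so it is preserved under any growth and [Phi] can
    be taken to be [id]. *)
Lemma arith_rel_encloses Phi : arith_rel Phi B pt_arith encloses.
Proof.
split => //.
- by move=> M z _ zr _; rewrite pt_point; split; [apply: cvalid_point | apply: in_cb_point].
- by move=> M x1 x2 y1 y2 _ [? ?] [? ?]; split; [apply: cb_add_valid | apply: (cb_add_incl u01)].
- by move=> M x1 x2 _ [? ?]; split; [apply: cb_neg_valid | apply: cb_neg_incl].
- by move=> M x1 x2 y1 y2 _ [? ?] [? ?]; split; [apply: cb_mul_valid | apply: (cb_mul_incl u01)].
Qed.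

Variable kappa : R.
Hypothesis uk : u <= kappa.

Definition cnear (M : R) X E :=
  near_ival Ar kappa M (bRe X) (bRe E) /\ near_ival Ar kappa M (bIm X) (bIm E).
Definition cnear_point (M : R) X z := cnear M X (cb_point z).

(** A real product turns [M] into [3 * M ^+ 2] and a sum multiplies by 3; a complex product does
    both in turn. *)
Definition box_growth (M : R) := 9 * M ^+ 2.

Lemma box_growthP : growth box_growth.
Proof. by move=> M M1; rewrite /box_growth expr2; nra. Qed.

Let k0 : 0 <= kappa. Proof. by apply: le_trans uk; apply/ltW; case/andP: u01. Qed.

Lemma cnear_mono M M' X E : M <= M' -> cnear M X E -> cnear M' X E.
Proof. by move=> MM [? ?]; split; apply: near_mono MM _. Qed.

Lemma cnear_neg M X E : 1 <= M -> cnear M X E -> cnear (box_growth M) (cb_neg X) (cb_neg E).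
Proof.
move=> /box_growthP MM [h1 h2]; apply: (cnear_mono MM); split; exact: near_neg.
Qed.

Lemma near_self M I : is_ival (rep Ar) I -> bounded_by M I -> 0 <= M -> near_ival Ar kappa M I I.
Proof.
move=> Iv Ib M0; have Mk : 0 <= M * kappa by rewrite mulr_ge0.
by split => //; [case: Iv | split; lra].
Qed.

Lemma near_valid k M I E : near_ival Ar k M I E -> is_ival (rep Ar) I.
Proof. by case. Qed.

Lemma iadd_bounded M I J : 1 <= M -> is_ival (rep Ar) I -> is_ival (rep Ar) J ->
  bounded_by M I -> bounded_by M J -> bounded_by (3 * M) (iadd Ar u I J).
Proof.
move=> M1 Iv Jv Ib Jb; have /andP[u0 u1] := u01.
have [] := iadd_tight u01 M1 Iv Jv Ib Jb.
have : M * u <= M by rewrite ler_piMr //; lra.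
by case: Ib Jb => ? ? [? ?]; split; lra.
Qed.

Lemma imul_bounded M I J : 1 <= M -> is_ival (rep Ar) I -> is_ival (rep Ar) J ->
  bounded_by M I -> bounded_by M J -> bounded_by (3 * M ^+ 2) (imul Ar u I J).
Proof.
move=> M1 Iv Jv Ib Jb; have M0 : 0 <= M by lra.
have /andP[u0 u1] := u01.
have [t1 t2] := imul_tight u01 M1 Iv Jv Ib Jb.
have M20 : 0 <= M ^+ 2 by rewrite exprn_ge0.
have Mu : M ^+ 2 * u <= M ^+ 2 by rewrite ler_piMr //; lra.
have corner x y : -M <= x <= M -> - M <= y <= M -> - M ^+ 2 <= x * y <= M ^+ 2.
  by rewrite -!ler_norml normrM expr2 => *; rewrite ler_pM.
case: Iv Jv Ib Jb => _ _ I1 [_ _ J1] [I2 I3] [J2 J3].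
have lI : - M <= lo I <= M by apply/andP; split; lra.
have hI : - M <= hi I <= M by apply/andP; split; lra.
have lJ : - M <= lo J <= M by apply/andP; split; lra.
have hJ : - M <= hi J <= M by apply/andP; split; lra.
have /andP[a1 a2] := corner _ _ lI lJ; have /andP[b1 b2] := corner _ _ lI hJ.
have /andP[c1 c2] := corner _ _ hI lJ; have /andP[d1 d2] := corner _ _ hI hJ.
split.
  apply: le_trans t1; have : - M ^+ 2 <= Num.min (Num.min (lo I * lo J) (lo I * hi J))
    (Num.min (hi I * lo J) (hi I * hi J)) by rewrite !le_min a1 b1 c1 d1.
  by lra.
apply: le_trans t2 _; have : Num.max (Num.max (lo I * lo J) (lo I * hi J))
    (Num.max (hi I * lo J) (hi I * hi J)) <= M ^+ 2 by rewrite !ge_max a2 b2 c2 d2.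
by lra.
Qed.

Lemma in_ipoint (x y : R) : in_ival (ipoint x) y -> y = x.
Proof. by move=> /andP[/= a b]; apply/eqP; rewrite eq_le a b. Qed.

Lemma ipoint_bounded (M x : R) : `|x| <= M -> bounded_by M (ipoint x).
Proof. by rewrite ler_norml => /andP. Qed.

Lemma bounded_ipoint (M x : R) : bounded_by M (ipoint x) -> `|x| <= M.
Proof. by move=> [? ?]; rewrite ler_norml; apply/andP. Qed.

Lemma near_add_point M I J x y : 1 <= M -> near_ival Ar kappa M I (ipoint x) ->
  near_ival Ar kappa M J (ipoint y) -> near_ival Ar kappa (3 * M) (iadd Ar u I J) (ipoint (x + y)).
Proof.
move=> M1 nI nJ; have [_ _ /bounded_ipoint xM _ _] := nI.
have [_ _ /bounded_ipoint yM _ _] := nJ.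
apply: (near_add u01 uk M1 nI nJ) => //.
  by apply: ipoint_bounded; apply: le_trans (ler_normD _ _) _; lra.
by move=> x' y' /in_ipoint -> /in_ipoint ->; rewrite /in_ival /= !lexx.
Qed.

Lemma near_mul_point M I J x y : 1 <= M -> near_ival Ar kappa M I (ipoint x) ->
  near_ival Ar kappa M J (ipoint y) -> near_ival Ar kappa (3 * M ^+ 2) (imul Ar u I J) (ipoint (x * y)).
Proof.
move=> M1 nI nJ; have [_ _ /bounded_ipoint xM _ _] := nI.
have [_ _ /bounded_ipoint yM _ _] := nJ.
apply: (near_mul u01 uk M1 nI nJ) => //.
  apply: ipoint_bounded; rewrite normrM.
  have : `|x| * `|y| <= M * M by rewrite ler_pM.
  have : 0 <= M * M by rewrite mulr_ge0 //; lra.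
  by rewrite expr2; lra.
by move=> x' y' /in_ipoint -> /in_ipoint ->; rewrite /in_ival /= !lexx.
Qed.

(** Here both computations round. The rounded sum of [E] and [E'] is an admissible reference because
    it contains all exact sums. *)
Lemma near_add_box M I J E E' : 1 <= M -> is_ival (rep Ar) E -> is_ival (rep Ar) E' ->
  near_ival Ar kappa M I E -> near_ival Ar kappa M J E' ->
  near_ival Ar kappa (3 * M) (iadd Ar u I J) (iadd Ar u E E').
Proof.
move=> M1 Ev Ev' nI nJ; have [_ _ ? _ _] := nI; have [_ _ ? _ _] := nJ.
apply: (near_add u01 uk M1 nI nJ); first exact: iadd_bounded.
  by have [] := iadd_ival u01 Ev Ev'.
by move=> x y; apply: iadd_incl.
Qed.

Lemma near_mul_box M I J E E' : 1 <= M -> is_ival (rep Ar) E -> is_ival (rep Ar) E' ->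
  near_ival Ar kappa M I E -> near_ival Ar kappa M J E' ->
  near_ival Ar kappa (3 * M ^+ 2) (imul Ar u I J) (imul Ar u E E').
Proof.
move=> M1 Ev Ev' nI nJ; have [_ _ ? _ _] := nI; have [_ _ ? _ _] := nJ.
apply: (near_mul u01 uk M1 nI nJ); first exact: imul_bounded.
  by have [] := imul_ival u01 Ev Ev'.
by move=> x y; apply: imul_incl.
Qed.

Let M3 (M : R) : 1 <= M -> 3 * M <= box_growth M.
Proof. by rewrite /box_growth expr2; nra. Qed.

Let M32 (M : R) : 1 <= M -> 1 <= 3 * M ^+ 2.
Proof. by rewrite expr2; nra. Qed.

Let M9 (M : R) : 3 * (3 * M ^+ 2) = box_growth M.
Proof. by rewrite /box_growth mulrA -natrM. Qed.

Lemma cnear_add_point M X Y z w : 1 <= M -> cnear_point M X z -> cnear_point M Y w ->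
  cnear_point (box_growth M) (cb_add Ar u X Y) (z + w).
Proof.
move=> M1 [? ?] [? ?]; apply: (cnear_mono (M3 M1)).
by split; rewrite /= ?cReD ?cImD; apply: near_add_point.
Qed.

Lemma cnear_mul_point M X Y z w : 1 <= M -> cnear_point M X z -> cnear_point M Y w ->
  cnear_point (box_growth M) (cb_mul Ar u X Y) (z * w).
Proof.
move=> M1 [? ?] [? ?]; rewrite -M9; have M1' := M32 M1.
split; rewrite /= ?cReM ?cImM; apply: near_add_point => //; do ?[exact: near_mul_point].
apply: (@near_neg R Ar kappa _ _ (ipoint (complex.Im z * complex.Im w))).
exact: near_mul_point.
Qed.

Lemma cnear_add_box M X Y E E' : 1 <= M -> cvalid Ar E -> cvalid Ar E' ->
  cnear M X E -> cnear M Y E' -> cnear (box_growth M) (cb_add Ar u X Y) (cb_add Ar u E E').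
Proof.
move=> M1 [? ?] [? ?] [? ?] [? ?]; apply: (cnear_mono (M3 M1)).
by split; apply: near_add_box.
Qed.

Lemma cnear_mul_box M X Y E E' : 1 <= M -> cvalid Ar E -> cvalid Ar E' ->
  cnear M X E -> cnear M Y E' -> cnear (box_growth M) (cb_mul Ar u X Y) (cb_mul Ar u E E').
Proof.
move=> M1 [? ?] [? ?] [? ?] [? ?]; rewrite -M9; have M1' := M32 M1.
split; apply: near_add_box => //; do ?[exact: near_mul_box | exact: imul_ival].
  by apply: ival_neg; apply: imul_ival.
by apply: near_neg; apply: near_mul_box.
Qed.

Lemma cnear_self M X : 0 <= M -> cvalid Ar X -> cbounded M X -> cnear M X X.
Proof. by move=> M0 [? ?] [? ?]; split; apply: near_self. Qed.

Lemma cnear_valid M X E : cnear M X E -> cvalid Ar X.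
Proof. by case=> /near_valid ? /near_valid ?. Qed.

Lemma cnear_bounded M X E : cnear M X E -> cbounded M X.
Proof. by case=> -[? ? ? ? ?] [? ? ? ? ?]. Qed.

Lemma arith_rel_near : arith_rel box_growth B pt_arith cnear_point.
Proof.
split => //.
- by move=> M M' x y _; apply: cnear_mono.
- move=> M z M1 zr zM; rewrite /= -[X in cnear_point _ _ X]/(a_box pt_arith (cb_point z)) pt_point.
  apply: cnear_self; first lra.
    exact: cvalid_point.
  exact: cbounded_point.
- by move=> M x1 x2 y1 y2; apply: cnear_add_point.
- move=> M x1 x2 M1 /(cnear_neg M1) [h1 h2]; split; rewrite /= ?cReN ?cImN; [exact: h1|exact: h2].
- by move=> M x1 x2 y1 y2; apply: cnear_mul_point.
Qed.

Lemma cnear_cbounded M a X E : cnear M X E -> cbounded a E -> cbounded (a + M * kappa) X.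
Proof. by move=> [[_ _ _ _ [? ?]] [_ _ _ _ [? ?]]] [[? ?] [? ?]]; split; split; lra. Qed.

Lemma cnear_point_cbounded M a c X z : cnear_point M X z -> cabs z <= a ->
  a + M * kappa <= c -> cbounded c X.
Proof. by move=> nX /cbounded_point za h; apply: cbounded_mono h (cnear_cbounded nX za). Qed.

Lemma cnear_point_dist M X z w : cnear_point M X z -> in_cbox X w -> cabs (w - z) <= M * kappa.
Proof.
move=> [[_ _ _ _ /= [a b]] [_ _ _ _ /= [c d]]] [/andP[e f] /andP[g h]].
by apply/cabs_le; rewrite cReD cReN cImD cImN !ler_norml; split; apply/andP; split; lra.
Qed.

End BoxRelations.
End Relations.

Arguments pt_arith {R}.

(** * Enclosure and accuracy of the boxes computed by the algorithm *)

Section BoxEvaluation.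
Variables (R : realType) (n : nat) (Ar : interval_arith R).
Implicit Types (X : 'cV[cbox R]_n) (x : 'cV[R[i]]_n).

Lemma point_rel T1 T2 (Rel : T1 -> T2 -> Prop) t1 t2 (x1 : 'cV[T1]_n) (x2 : 'cV[T2]_n) :
  Rel t1 t2 -> (forall i j, Rel (x1 i j) (x2 i j)) ->
  forall k, Rel (Defs.point t1 x1 k) (Defs.point t2 x2 k).
Proof. by move=> ht hx k; rewrite /Defs.point; case: (unlift _ _) => [j|] /=; [apply: hx|]. Qed.

Lemma circuit_at_point m p (c : circuit R n.+1 m p) (P : polymx R n.+1 m p) t x :
  represents c P -> a_circuit pt_arith c (Defs.point t%:C x) = at_point P t x.
Proof. by move=> h; rewrite a_circuit_pt h. Qed.

Lemma id_growth : growth (@id R).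
Proof. by []. Qed.

Section Enclosure.
Variable u t : R.
Hypothesis u01 : 0 < u < 1.
Hypothesis trep : t \in rep Ar.
Notation B := (box_arith Ar u).
Notation encl := (encloses Ar 1).

Let rel := @arith_rel_encloses R Ar u u01 (@id R).

Lemma crep_real (a : R) : a \in rep Ar -> crep Ar a%:C.
Proof. by rewrite /crep /= => ->; rewrite rep0. Qed.

Lemma encl_point z : crep Ar z -> encl (cb_point z) z.
Proof. by move=> zr; split; [apply: cvalid_point | apply: in_cb_point]. Qed.

Lemma encl_mx m p (A : 'M[R[i]]_(m, p)) : mxrep Ar A -> forall i j, encl (a_mx B A i j) (A i j).
Proof. by move=> Ar' i j; rewrite mxE; apply: encl_point. Qed.

Lemma encl_circuit m p (c : circuit R n.+1 m p) (P : polymx R n.+1 m p) X x :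
  circuit_ok Ar c -> represents c P -> (forall i j, encl (X i j) (x i j)) ->
  forall i j, encl (box_at Ar u t c X i j) (at_point P t x i j).
Proof.
move=> cok cP hX i j; rewrite -(circuit_at_point t x cP).
have [M' _ h] := circuit_rel id_growth cok (lexx (1 : R)).
apply: (h _ _ _ _ _ rel) => k; apply: (point_rel (Rel := encl)) => //.
by apply: encl_point; apply: crep_real.
Qed.

Lemma encl_mulmx m p q (X1 : 'M[cbox R]_(m, p)) (X2 : 'M[R[i]]_(m, p))
    (Y1 : 'M[cbox R]_(p, q)) (Y2 : 'M[R[i]]_(p, q)) :
  (forall i j, encl (X1 i j) (X2 i j)) -> (forall i j, encl (Y1 i j) (Y2 i j)) ->
  forall i j, encl (a_mulmx B X1 Y1 i j) ((X2 *m Y2) i j).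
Proof.
move=> hX hY; rewrite -a_mulmx_pt; have [M' _ h] := mulmx_rel Ar id_growth p (lexx (1 : R)).
exact: (h _ _ _ _ _ rel).
Qed.

Lemma encl_ball k (r : R) (v : 'cV[R[i]]_k) : r \in rep Ar -> cnorm v <= r ->
  forall i j, encl (a_ball B k r i j) (v i j).
Proof.
move=> rr vr i j; rewrite mxE.
have r0 : 0 <= r by apply: le_trans vr; apply: cnorm_ge0.
have rN : - r <= r by lra.
split; first by split; split; rewrite /= ?repN.
have /cabs_le[] := le_trans (cabs_cnorm _ i j) vr.
by rewrite !ler_norml => ? ?; split.
Qed.

Lemma encl_addmx m p (X1 Y1 : 'M[cbox R]_(m, p)) (X2 Y2 : 'M[R[i]]_(m, p)) :
  (forall i j, encl (X1 i j) (X2 i j)) -> (forall i j, encl (Y1 i j) (Y2 i j)) ->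
  forall i j, encl (a_addmx B X1 Y1 i j) ((X2 + Y2) i j).
Proof. by move=> hX hY i j; rewrite -a_addmx_pt; apply: (addmx_rel rel) hX hY i j. Qed.

Lemma encl_oppmx m p (X1 : 'M[cbox R]_(m, p)) (X2 : 'M[R[i]]_(m, p)) :
  (forall i j, encl (X1 i j) (X2 i j)) ->
  forall i j, encl (a_oppmx B X1 i j) ((- X2) i j).
Proof. by move=> hX i j; rewrite -a_oppmx_pt; apply: (oppmx_rel rel) hX i j. Qed.

Lemma encl_krawczyk r (A d2 : 'M[R[i]]_n) (f1 : 'cV[cbox R]_n) (f2 v : 'cV[R[i]]_n)
    (d1 : 'M[cbox R]_n) : mxrep Ar A -> r \in rep Ar -> 0 < r ->
  (forall i j, encl (f1 i j) (f2 i j)) -> (forall i j, encl (d1 i j) (d2 i j)) ->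
  cnorm v <= 1 ->
  forall i j, encl (krawczyk B r A f1 d1 i j)
    ((- (r^-1)%:C *: (A *m f2) + (1%:M - A *m d2) *m v) i j).
Proof.
move=> Arep rr r0 hf hd v1 i j; rewrite -krawczyk_on_pt.
have M1 : 1 <= 1 + cnorm A by rewrite lerDl cnorm_ge0.
have [M' _ h] := krawczyk_rel Ar id_growth n M1.
apply: (h _ _ _ _ _ r rel) => //.
- by move=> M x y _ [? ?]; split; [apply: cb_div_valid | apply: cb_div_incl].
- by rewrite lerDr.
- exact: (encl_ball (rep1 Ar) v1).
Qed.

End Enclosure.

Lemma encl_valid m p M (X : 'M[cbox R]_(m, p)) (z : 'M[R[i]]_(m, p)) :
  (forall i j, encloses Ar M (X i j) (z i j)) -> mxvalid Ar X /\ box_set X z.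
Proof. by move=> h; split=> i j; case: (h i j). Qed.

Section Tests.
Variables (F : polymx R n.+1 n 1).
Variables (cF : circuit R n.+1 n 1) (cdF : circuit R n.+1 n n) (cFdot : circuit R n.+1 n 1).
Hypotheses (cF_ok : circuit_ok Ar cF) (cdF_ok : circuit_ok Ar cdF).
Hypothesis (cFdot_ok : circuit_ok Ar cFdot).
Hypotheses (cFE : represents cF F) (cdFE : represents cdF (jacobian_x F)).
Hypothesis (cFdotE : represents cFdot (derivative_t F)).

Notation test_box u t m := (krawczyk (box_arith Ar u) (box_rad m) (box_mat m)
    (box_at Ar u t cF (a_mx (box_arith Ar u) (box_ctr m)))
    (box_at Ar u t cdF (a_addmx (box_arith Ar u) (a_mx (box_arith Ar u) (box_ctr m))
       (a_ball (box_arith Ar u) n (box_rad m))))).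

Lemma encl_test_box u t (m : mbox R n) (w v : 'cV[R[i]]_n) : 0 < u < 1 -> t \in rep Ar ->
  mbox_rep Ar m -> 0 < box_rad m -> unit_ball w -> unit_ball v ->
  forall i j, encloses Ar 1 (test_box u t m i j)
    ((- ((box_rad m)^-1)%:C *: (box_mat m *m at_point F t (box_ctr m))
      + (1%:M - box_mat m *m at_point (jacobian_x F) t (box_ctr m + (box_rad m)%:C *: w)) *m v) i j).
Proof.
move=> u01 trep [xr rr Arep] r0 w1 v1; apply: (encl_krawczyk u01) => //.
  by apply: (encl_circuit u01 trep cF_ok cFE); apply: encl_mx.
apply: (encl_circuit u01 trep cdF_ok cdFE); apply: (encl_addmx u01); first exact: encl_mx.
by apply: encl_ball => //; rewrite cnormZ gtr0_norm // ler_piMr // ltW.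
Qed.

Lemma unit_ball0 : unit_ball (0 : 'cV[R[i]]_n).
Proof. by rewrite /unit_ball /= cnorm0. Qed.

Lemma test_box_valid u t (m : mbox R n) : 0 < u < 1 -> t \in rep Ar ->
  mbox_rep Ar m -> 0 < box_rad m -> mxvalid Ar (test_box u t m).
Proof.
by move=> u01 tr mr r0; case: (encl_valid (encl_test_box u01 tr mr r0 unit_ball0 unit_ball0)).
Qed.

Lemma moore_test_sound u t (m : mbox R n) rho : 0 < u < 1 -> t \in rep Ar ->
  mbox_rep Ar m -> 0 < box_rad m -> moore_test Ar cF cdF u t m rho -> moore_box_at F t rho m.
Proof.
move=> u01 trep mr r0 h; split => // w v w1 v1; apply: le_trans h.
apply: box_norm_ge.
by case: (encl_valid (encl_test_box u01 trep mr r0 w1 v1)).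
Qed.

Lemma encl_newton_delta u t (A : 'M[R[i]]_n) y : 0 < u < 1 -> t \in rep Ar ->
  mxrep Ar A -> mxrep Ar y ->
  forall i j, encloses Ar 1 (newton_delta Ar cF u t A y i j) ((A *m at_point F t y) i j).
Proof.
move=> u01 trep Arep yrep; apply: (encl_mulmx u01); first exact: encl_mx.
by apply: (encl_circuit u01 trep cF_ok cFE); apply: encl_mx.
Qed.

Lemma newton_box_incl u t (A : 'M[R[i]]_n) y d : 0 < u < 1 -> t \in rep Ar ->
  mxrep Ar A -> mxrep Ar y -> box_set (newton_delta Ar cF u t A y) d ->
  mxvalid Ar (newton_box Ar cF u t A y) /\ box_set (newton_box Ar cF u t A y) (y - d).
Proof.
move=> u01 trep Arep yrep hd; apply: (@encl_valid _ _ 1); apply: (encl_addmx u01).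
  exact: encl_mx.
apply: (encl_oppmx u01) => i j; split; last exact: hd.
by case: (encl_newton_delta u01 trep Arep yrep i j).
Qed.

Section Uniform.
Notation G := (@box_growth R).
Let GP : growth G := @box_growthP R.

Lemma cnear_mx u kappa (M : R) m p (A : 'M[R[i]]_(m, p)) : 0 < u < 1 -> u <= kappa ->
  1 <= M -> mxrep Ar A -> cnorm A <= M ->
  forall i j, cnear_point Ar kappa M (a_mx (box_arith Ar u) A i j) (A i j).
Proof.
move=> u01 uk M1 Arep AM i j.
by have := mx_rel (arith_rel_near Ar u01 uk) M1 Arep AM i j; rewrite a_mx_pt.
Qed.

Lemma cnear_time u kappa (M t : R) : 0 < u < 1 -> u <= kappa -> 1 <= M -> t \in rep Ar ->
  `|t| <= M -> cnear_point Ar kappa M (cb_point t%:C) t%:C.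
Proof.
move=> u01 uk M1 tr tM; apply: (rel_point (arith_rel_near Ar u01 uk)) => //.
  exact: crep_real.
by rewrite cabs_real.
Qed.

Lemma circuit_near m p (c : circuit R n.+1 m p) (P : polymx R n.+1 m p) (M : R) :
  circuit_ok Ar c -> represents c P -> 1 <= M ->
  exists2 M', M <= M' & forall u kappa t X x, 0 < u < 1 -> u <= kappa -> t \in rep Ar ->
    `|t| <= M -> (forall i j, cnear_point Ar kappa M (X i j) (x i j)) ->
    forall i j, cnear_point Ar kappa M' (box_at Ar u t c X i j) (at_point P t x i j).
Proof.
move=> cok cP M1; have [M' MM h] := circuit_rel GP cok M1.
exists M' => // u kappa t X x u01 uk trep tM hX i j; rewrite -(circuit_at_point t x cP).
apply: (h _ _ _ _ _ (arith_rel_near Ar u01 uk)) => k.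
by apply: (point_rel (Rel := cnear_point Ar kappa M)) => //; apply: cnear_time u01 uk M1 _ _.
Qed.

Lemma newton_delta_near (M : R) : 1 <= M ->
  exists2 M', M <= M' & forall u t A y, 0 < u < 1 -> t \in rep Ar -> mxrep Ar A -> mxrep Ar y ->
    `|t| <= M -> cnorm A <= M -> cnorm y <= M -> forall i j,
    cnear_point Ar u M' (newton_delta Ar cF u t A y i j) ((A *m at_point F t y) i j).
Proof.
move=> M1; have [M2 MM2 h2] := circuit_near cF_ok cFE M1.
have M21 : 1 <= M2 by apply: le_trans MM2.
have [M3 MM3 h3] := mulmx_rel Ar GP n M21.
exists M3 => [|u t A y u01 trep Arep yrep tM AM yM i j]; first exact: le_trans MM3.
rewrite -a_mulmx_pt; apply: (h3 _ _ _ _ _ (arith_rel_near Ar u01 (lexx u))).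
  by apply: (cnear_mx u01) => //; apply: le_trans MM2.
by apply: h2 => //; apply: (cnear_mx u01).
Qed.

(** Both operands are within [O(u)] of exact points, hence so is the difference. This is what
    refutes an endless demand for precision in refine. *)
Lemma newton_box_width (M : R) : 1 <= M ->
  exists2 C, 0 <= C & forall u t A y, 0 < u < 1 -> t \in rep Ar -> mxrep Ar A -> mxrep Ar y ->
    `|t| <= M -> cnorm A <= M -> cnorm y <= M ->
    box_width (newton_box Ar cF u t A y) <= C * u.
Proof.
move=> M1; have [M2 MM2 h2] := newton_delta_near M1.
have M21 : 1 <= M2 by apply: le_trans MM2.
have P1 := GP M21; have P11 := le_trans M21 P1.
have C0 : 0 <= G (G M2) by apply: le_trans (GP P11); lra.
exists (2 * G (G M2)) => [|u t A y u01 trep Arep yrep tM AM yM]; first lra.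
have rel := arith_rel_near Ar u01 (lexx u).
have nb i j : cnear_point Ar u (G (G M2)) (newton_box Ar cF u t A y i j)
    ((y - A *m at_point F t y) i j).
  rewrite -a_oppmx_pt -a_addmx_pt; apply: (addmx_rel rel) => // k l.
    by apply: (cnear_mx u01) => //; apply: le_trans P1; apply: le_trans MM2.
  by apply: (oppmx_rel rel) => // ? ?; apply: h2.
have nv : mxvalid Ar (newton_box Ar cF u t A y) by move=> i j; apply: cnear_valid (nb i j).
apply: (box_width_le nv) => z w zb wb; apply/cnorm_le => [|i j].
  by have /andP[u0 _] := u01; have := mulr_ge0 C0 (ltW u0); lra.
have := cnear_point_dist (nb i j) (zb i j); have := cnear_point_dist (nb i j) (wb i j).
have := cabsD (z i j - (y - A *m at_point F t y) i j) (- (w i j - (y - A *m at_point F t y) i j)).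
rewrite cabsN opprB addrA subrK !mxE; lra.
Qed.

Lemma tangent_box_bounded (M : R) : 1 <= M ->
  exists2 M', M <= M' & forall u t m, 0 < u < 1 -> t \in rep Ar -> mbox_rep Ar m ->
    `|t| <= M -> cnorm (box_mat m) <= M -> cnorm (box_ctr m) <= M ->
    forall v, box_set (tangent_box Ar cFdot u t m) v -> cnorm v <= M'.
Proof.
move=> M1; have [M2 MM2 h2] := circuit_near cFdot_ok cFdotE M1.
have M21 : 1 <= M2 by apply: le_trans MM2.
have [M3 MM3 h3] := mulmx_rel Ar GP n M21.
have M31 : 1 <= M3 by apply: le_trans MM3.
have P1 := GP M31.
exists (G M3) => [|u t m u01 trep [xr rr Arep] tM AM xM v hv].
  by apply: le_trans P1; apply: le_trans MM3.
have rel := arith_rel_near Ar u01 (lexx u).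
apply/cnorm_le => [|i j]; first by lra.
apply: in_cbox_bounded (hv i j).
apply: (@cnear_bounded R Ar u); apply: (oppmx_rel rel) => // k l.
apply: (h3 _ _ _ _ _ rel) => [a b|a b].
  by apply: (cnear_mx u01) => //; apply: le_trans MM2.
by apply: h2 => // *; apply: (cnear_mx u01).
Qed.

End Uniform.
End Tests.
End BoxEvaluation.

(** * Products and quotients of small boxes *)

Section SmallBoxes.
Variables (R : realType) (Ar : interval_arith R) (u : R).
Hypothesis u01 : 0 < u < 1.
Implicit Types (I J : ival R) (X Y : cbox R).

Lemma iadd_bounded2 (M e e' : R) I J : 1 <= M -> is_ival (rep Ar) I -> is_ival (rep Ar) J ->
  e <= M -> e' <= M -> bounded_by e I -> bounded_by e' J ->
  bounded_by (e + e' + M * u) (iadd Ar u I J).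
Proof.
move=> M1 Iv Jv eM eM' [I1 I2] [J1 J2].
have Ib : bounded_by M I by split; lra.
have Jb : bounded_by M J by split; lra.
by have [] := iadd_tight u01 M1 Iv Jv Ib Jb; split; lra.
Qed.

(** The main term uses the actual bounds [e] and [e'], and [M] scales only the rounding error; a
    single bound [M] for both factors would lose the smallness of one of them. *)
Lemma imul_bounded2 (M e e' : R) I J : 1 <= M -> is_ival (rep Ar) I -> is_ival (rep Ar) J ->
  0 <= e <= M -> 0 <= e' <= M -> bounded_by e I -> bounded_by e' J ->
  bounded_by (e * e' + M ^+ 2 * u) (imul Ar u I J).
Proof.
move=> M1 Iv Jv /andP[e0 eM] /andP[e0' eM'] [I1 I2] [J1 J2].
have Ib : bounded_by M I by split; lra.
have Jb : bounded_by M J by split; lra.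
have [t1 t2] := imul_tight u01 M1 Iv Jv Ib Jb.
have corner x y : - e <= x <= e -> - e' <= y <= e' -> - (e * e') <= x * y <= e * e'.
  by rewrite -!ler_norml normrM => *; rewrite ler_pM.
have [_ _ Il] := Iv; have [_ _ Jl] := Jv.
have lI : - e <= lo I <= e by apply/andP; split; lra.
have hI : - e <= hi I <= e by apply/andP; split; lra.
have lJ : - e' <= lo J <= e' by apply/andP; split; lra.
have hJ : - e' <= hi J <= e' by apply/andP; split; lra.
have /andP[a1 a2] := corner _ _ lI lJ; have /andP[b1 b2] := corner _ _ lI hJ.
have /andP[c1 c2] := corner _ _ hI lJ; have /andP[d1 d2] := corner _ _ hI hJ.
split.
  apply: le_trans t1; have : - (e * e') <= Num.min (Num.min (lo I * lo J) (lo I * hi J))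
    (Num.min (hi I * lo J) (hi I * hi J)) by rewrite !le_min a1 b1 c1 d1.
  by lra.
apply: le_trans t2 _; have : Num.max (Num.max (lo I * lo J) (lo I * hi J))
    (Num.max (hi I * lo J) (hi I * hi J)) <= e * e' by rewrite !ge_max a2 b2 c2 d2.
by lra.
Qed.

(** The error of [idiv] is relative to its result, here of size at most 1, so dividing a box bounded
    by [c * s] by a tiny [s] costs only [u]. *)
Lemma idiv_bounded (c s : R) I : 0 <= c <= 1 -> is_ival (rep Ar) I -> s \in rep Ar -> 0 < s ->
  bounded_by (c * s) I -> bounded_by (c + u) (idiv Ar u I s).
Proof.
move=> /andP[c0 c1] Iv sr s0 [I1 I2].
have b1 : - c <= lo I / s by rewrite ler_pdivlMr // mulNr.
have b2 : hi I / s <= c by rewrite ler_pdivrMr.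
have [] := idiv_tight u01 (lexx 1) Iv sr s0 (_ : bounded_by 1 (Ival (lo I / s) (hi I / s))).
  by split; rewrite /=; lra.
by split; lra.
Qed.

Lemma cb_add_bounded2 (M e e' : R) X Y : 1 <= M -> cvalid Ar X -> cvalid Ar Y ->
  e <= M -> e' <= M -> cbounded e X -> cbounded e' Y ->
  cbounded (e + e' + M * u) (cb_add Ar u X Y).
Proof. by move=> M1 [? ?] [? ?] ? ? [? ?] [? ?]; split; apply: iadd_bounded2. Qed.

Lemma cb_neg_bounded (M : R) X : cbounded M X -> cbounded M (cb_neg X).
Proof. by move=> [? ?]; split; apply: ineg_bounded. Qed.

Lemma cb_mul_bounded2 (M e e' : R) X Y : 1 <= M -> cvalid Ar X -> cvalid Ar Y ->
  0 <= e <= M -> 0 <= e' <= M -> cbounded e X -> cbounded e' Y ->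
  cbounded (2 * (e * e') + 4 * M ^+ 2 * u) (cb_mul Ar u X Y).
Proof.
move=> M1 [? ?] [? ?] eM eM' [X1 X2] [Y1 Y2].
have M2 : 1 <= 2 * M ^+ 2 by rewrite expr2; nra.
have bm I J : is_ival (rep Ar) I -> is_ival (rep Ar) J -> bounded_by e I -> bounded_by e' J ->
    bounded_by (e * e' + M ^+ 2 * u) (imul Ar u I J).
  by move=> Iv Jv Ib Jb; apply: imul_bounded2.
have eM2 : e * e' + M ^+ 2 * u <= 2 * M ^+ 2.
  have [[/andP[u0 u1] /andP[e0 e1]] /andP[e0' e1']] := (u01, eM, eM').
  have : M ^+ 2 * u <= M ^+ 2 by rewrite ler_piMr ?ltW // exprn_gt0 //; lra.
  have : e * e' <= M ^+ 2 by rewrite expr2 ler_pM.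
  by lra.
have sum I J : is_ival (rep Ar) I -> is_ival (rep Ar) J ->
    bounded_by (e * e' + M ^+ 2 * u) I -> bounded_by (e * e' + M ^+ 2 * u) J ->
    bounded_by (2 * (e * e') + 4 * M ^+ 2 * u) (iadd Ar u I J).
  move=> Iv Jv Ib Jb; have [] := iadd_bounded2 M2 Iv Jv eM2 eM2 Ib Jb.
  by split; lra.
split; apply: sum; do ?[exact: imul_ival | exact: bm].
  by apply: ival_neg; apply: imul_ival.
by apply: ineg_bounded; apply: bm.
Qed.

End SmallBoxes.

(** * Sufficient conditions for the Moore test to pass *)

Section TestPasses.
Variables (R : realType) (n : nat) (Ar : interval_arith R).

Lemma small_mulmx p (M : R) : 1 <= M -> exists2 C, 0 <= C &
  forall u e m q (X : 'M[cbox R]_(m, p)) (Y : 'M[cbox R]_(p, q)), 0 < u < 1 -> 0 <= e <= M ->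
  (forall i j, cvalid Ar (X i j) /\ cbounded e (X i j)) ->
  (forall i j, cvalid Ar (Y i j) /\ cbounded 1 (Y i j)) ->
  forall i j, cvalid Ar (a_mulmx (box_arith Ar u) X Y i j) /\
              cbounded (C * (e + u)) (a_mulmx (box_arith Ar u) X Y i j).
Proof.
move=> M1.
suff [C C0 h] : exists2 C, 0 <= C & forall u e (f g : 'I_p -> cbox R), 0 < u < 1 ->
    0 <= e <= M -> (forall k, cvalid Ar (f k) /\ cbounded e (f k)) ->
    (forall k, cvalid Ar (g k) /\ cbounded 1 (g k)) ->
    let S := \big[cb_add Ar u/cb_point 0]_k cb_mul Ar u (f k) (g k) in
    cvalid Ar S /\ cbounded (C * (e + u)) S.
  by exists C => // u e m q X Y u01 eM hX hY i j; rewrite mxE; apply: (h u e).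
elim: (index_enum _) => [|k s [C C0 IH]].
  exists 0 => // u e f g _ _ _ _; rewrite big_nil mul0r; split.
    by apply: cvalid_point; rewrite /crep /= rep0.
  by apply: cbounded_point; rewrite cabs0.
(* [D] accounts for the value and the rounding error of one complex product; [N] bounds both
   operands of the sum, as [cb_add_bounded2] requires. *)
pose D := 4 * M ^+ 2.
have D4 : 4 <= D by rewrite /D expr2; nra.
pose N := (D + C) * (M + 1).
have N1 : 1 <= N by rewrite /N; nra.
exists (D + C + N) => [|u e f g u01 eM hf hg]; first by lra.
rewrite big_cons; have [Sv Sb] := IH u e f g u01 eM hf hg.
have [fv fb] := hf k; have [gv gb] := hg k.
have one : 0 <= (1 : R) <= M by rewrite ler01.
have := cb_mul_bounded2 u01 M1 fv gv eM one fb gb; rewrite mulr1 => mb.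
have mv := cb_mul_valid u01 fv gv.
have /andP[u0 u1] := u01; have /andP[e0 eM'] := eM.
have eu : e + u <= M + 1 by lra.
have b1 : 2 * e + D * u <= D * (e + u) by rewrite mulrDr lerD2r ler_wpM2r //; lra.
have b2 : D * (e + u) <= N by rewrite /N ler_pM //; lra.
have b3 : C * (e + u) <= N by rewrite /N ler_pM //; lra.
have b4 := le_trans b1 b2.
split; first exact: cb_add_valid.
apply: cbounded_mono (cb_add_bounded2 u01 N1 mv Sv b4 b3 mb Sb).
have : N * u <= N * (e + u) by rewrite ler_wpM2l //; lra.
by rewrite !mulrDl; move: b1; rewrite -/D; lra.
Qed.

Variables (F : polymx R n.+1 n 1).
Variables (cF : circuit R n.+1 n 1) (cdF : circuit R n.+1 n n).
Hypotheses (cF_ok : circuit_ok Ar cF) (cdF_ok : circuit_ok Ar cdF).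
Hypotheses (cFE : represents cF F) (cdFE : represents cdF (jacobian_x F)).

(** The ball of radius [s] is compared with the point 0, so [s + u] measures the extent of the box
    and the rounding at once. *)
Lemma deriv_near (M : R) : 1 <= M -> exists2 M', 1 <= M' &
  forall u t (y : 'cV[R[i]]_n) (s : R) (U : 'M[R[i]]_n), 0 < u < 1 -> t \in rep Ar ->
  mxrep Ar y -> s \in rep Ar -> mxrep Ar U -> 0 < s <= 1 ->
  `|t| <= M -> cnorm U <= M -> cnorm y <= M -> forall i j,
  cnear_point Ar (s + u) M'
    (a_addmx (box_arith Ar u) (a_mx (box_arith Ar u) 1%:M) (a_oppmx (box_arith Ar u)
      (a_mulmx (box_arith Ar u) (a_mx (box_arith Ar u) U)
        (box_at Ar u t cdF (a_addmx (box_arith Ar u) (a_mx (box_arith Ar u) y)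
          (a_ball (box_arith Ar u) n s))))) i j)
    ((1%:M - U *m at_point (jacobian_x F) t y) i j).
Proof.
move=> M1; pose G := @box_growth R; have GP : growth G := @box_growthP R.
have P1 := GP _ M1; have P11 := le_trans M1 P1.
have [M2 MM2 h2] := circuit_near cdF_ok cdFE P11; have M21 := le_trans P11 MM2.
have [M3 MM3 h3] := mulmx_rel Ar GP n M21; have M31 := le_trans M21 MM3.
have P3 := GP _ M31; have P31 := le_trans M31 P3.
exists (G (G M3)); first by apply: le_trans (GP _ P31).
move=> u t y s U u01 tr yr sr Ur s01 tM UM yM.
have /andP[u0 u1] := u01; have /andP[s0 s1] := s01.
have uk : u <= s + u by lra.
have rel := arith_rel_near Ar u01 uk.
rewrite -{1}a_oppmx_pt -a_addmx_pt; apply: (addmx_rel rel) => //.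
  by apply: (cnear_mx u01) => //; [apply: mxrep1 | apply: le_trans (cnorm1_le _ _) P31].
apply: (oppmx_rel rel) => //; rewrite -a_mulmx_pt; apply: (h3 _ _ _ _ _ rel).
  by apply: (cnear_mx u01) => //; apply: le_trans UM _; apply: le_trans P1 MM2.
apply: h2 => // [|i j]; first exact: le_trans P1.
(* Writing [y] as [y + 0] provides the point with which the ball is compared. *)
rewrite -[y in X in cnear_point _ _ _ _ X]addr0 -a_addmx_pt.
apply: (addmx_rel rel) => // [|k l]; first exact: (cnear_mx u01).
have k0 : s <= M * (s + u) by nra.
have nb : near_ival Ar (s + u) M (Ival (- s) s) (ipoint 0).
  by apply: near_ival_ball => //; apply/andP; split; lra.
by rewrite !mxE; split.
Qed.

Lemma krawczyk_arith (M C c e s u : R) : 1 <= M -> 0 <= C -> 0 <= c <= 1 -> 0 <= e <= 1 ->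
  0 < s <= 1 -> 0 < u < 1 ->
  let D := C * (1 + M) in let N := 2 + 3 * D in let e' := e + M * (s + u) in
  [/\ 0 <= e' <= 1 + 2 * M, 1 <= N, c + u <= N, C * (e' + u) <= N &
      (c + u) + C * (e' + u) + N * u <= c + (1 + D + N) * (e + s + u) ] /\
  0 <= c + (1 + D + N) * (e + s + u).
Proof.
move=> M1 C0 /andP[c0 c1] /andP[e0 e1] /andP[s0 s1] /andP[u0 u1] D N e'.
have D0 : 0 <= D by rewrite mulr_ge0 //; lra.
have k0 : 0 <= M * (s + u) by rewrite mulr_ge0 //; lra.
have k1 : M * (s + u) <= M * 2 by rewrite ler_wpM2l //; lra.
have Wle : C * (e' + u) <= D * (e + s + u).
  have : e' + u <= (1 + M) * (e + s + u).
    rewrite /e' (_ : (1 + M) * (e + s + u) = e + M * (s + u) + u + (s + M * e)); last by ring.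
    by rewrite lerDl addr_ge0 ?mulr_ge0 //; lra.
  by rewrite /D -mulrA => h; rewrite ler_wpM2l.
have W3 : D * (e + s + u) <= D * 3 by rewrite ler_wpM2l //; lra.
have Nu : N * u <= N * (e + s + u) by rewrite ler_wpM2l // /N; lra.
have DN0 : 0 <= (1 + D + N) * (e + s + u) by rewrite mulr_ge0 // /N; lra.
rewrite mulrDl [(1 + D) * _]mulrDl in DN0 *.
split; last by lra.
by split; [rewrite /e'; apply/andP; split; lra | rewrite /N; lra | rewrite /N; lra
  | rewrite /N; lra | lra].
Qed.

(** The residual box is bounded relative to [s] before the division: an absolute rounding error
    would become [u / s] after it. The linear part differs from the exact defect, bounded by [e], by
    [O(s + u)]. *)
Lemma moore_test_passes (M : R) : 1 <= M -> exists2 C, 0 <= C &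
  forall u t (y : 'cV[R[i]]_n) (s : R) (U : 'M[R[i]]_n) (c e : R), 0 < u < 1 -> t \in rep Ar ->
  mxrep Ar y -> s \in rep Ar -> mxrep Ar U -> 0 < s <= 1 ->
  `|t| <= M -> cnorm U <= M -> cnorm y <= M ->
  (forall i j, cbounded (c * s) (newton_delta Ar cF u t U y i j)) ->
  0 <= c <= 1 -> cnorm (1%:M - U *m at_point (jacobian_x F) t y) <= e -> 0 <= e <= 1 ->
  forall rho, c + C * (e + s + u) <= rho -> moore_test Ar cF cdF u t (MBox y s U) rho.
Proof.
move=> M1; have [M2 M21 h2] := deriv_near M1.
have M31 : 1 <= 1 + 2 * M2 by lra.
have [C C0 hC] := small_mulmx n M31.
pose D := C * (1 + M2); pose N := 2 + 3 * D.
have D0 : 0 <= D by rewrite mulr_ge0 //; lra.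
exists (1 + D + N) => [|u t y s U c e u01 tr yr sr Ur s01 tM UM yM hD c01 he e01 rho hrho].
  by rewrite /N; lra.
have [[e'b N1 cuN WN final] tot0] := krawczyk_arith M21 C0 c01 e01 s01 u01.
rewrite -/D -/N in N1 cuN WN final tot0.
have /andP[s0 _] := s01.
have mr : mbox_rep Ar (MBox y s U) by [].
have tv := test_box_valid cF_ok cdF_ok cFE cdFE u01 tr mr s0.
apply: le_trans hrho; apply/(box_norm_bounded tv) => // i j.
have near_V := h2 u t y s U u01 tr yr sr Ur s01 tM UM yM.
set V := (a_addmx _ _ _) in near_V.
have Vb k l : cvalid Ar (V k l) /\ cbounded (e + M2 * (s + u)) (V k l).
  split; first exact: cnear_valid (near_V k l).
  exact: cnear_point_cbounded (near_V k l) (le_trans (cabs_cnorm _ k l) he) (lexx _).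
have ballb k l : cvalid Ar (a_ball (box_arith Ar u) n 1 k l) /\
    cbounded 1 (a_ball (box_arith Ar u) n 1 k l).
  by rewrite mxE; split; [apply: cb_ball_valid => //; apply: rep1 | apply: cb_ball_bounded].
have [Wv Wb] := hC u _ _ _ _ _ u01 e'b Vb ballb i j.
have [qv _] := encl_newton_delta cF_ok cFE u01 tr Ur yr i j.
have db := hD i j.
rewrite /krawczyk {1}/a_addmx mxE {1}/a_oppmx mxE mxE /=.
set q := newton_delta _ _ _ _ _ _ in qv db.
have Qb : cbounded (c + u) (cb_neg (cb_div Ar u (q i j) s)).
  by apply: cb_neg_bounded; case: db qv => ? ? [? ?]; split; apply: idiv_bounded.
have Qv : cvalid Ar (cb_neg (cb_div Ar u (q i j) s)).
  by apply: cb_neg_valid; apply: cb_div_valid.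
exact: cbounded_mono final (cb_add_bounded2 u01 N1 Qv Wv cuN WN Qb Wb).
Qed.

End TestPasses.

(** * Taylor models *)

Section TaylorEnclosure.
Variables (R : realType) (Ar : interval_arith R) (u : R).
Hypothesis u01 : 0 < u < 1.
Notation zero := (cb_point (0 : R[i])).
Implicit Types (p : tmodel R) (q : {poly R[i]}).

Lemma cvalid0 : cvalid Ar zero.
Proof. by apply: cvalid_point; rewrite /crep /= rep0. Qed.

Definition tm_valid p := forall i, cvalid Ar (nth zero p i).
(** Past the end of the list the default box is the point 0, so the condition also forces the
    further coefficients of [q] to vanish. *)
Definition tm_coefs p q := forall i, in_cbox (nth zero p i) q`_i.

Lemma nth_tm_add p p' i : size p = size p' ->
  nth zero (tm_add Ar u p p') i =
  if (i < size p)%N then cb_add Ar u (nth zero p i) (nth zero p' i) else zero.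
Proof.
move=> sp; rewrite /tm_add; case: ltnP => ip; last first.
  by rewrite nth_default // size_map size_zip -sp minnn.
rewrite (nth_map (zero, zero)) ?size_zip -?sp ?minnn //.
by rewrite nth_zip.
Qed.

Lemma nth_tm_map (f : cbox R -> cbox R) p i :
  nth zero (map f p) i = if (i < size p)%N then f (nth zero p i) else zero.
Proof.
by case: ltnP => ip; [rewrite (nth_map zero) | rewrite nth_default // size_map].
Qed.

Lemma nth_tm_squeeze J p k i : size p = k.+2 ->
  nth zero (tm_squeeze Ar u J p) i =
  if (i < k)%N then nth zero p i
  else if i == k then cb_add Ar u (nth zero p k) (cb_mul Ar u (nth zero p k.+1) (cb_real J))
  else zero.
Proof.
move=> sp; rewrite /tm_squeeze sp subn2 subn1 /= nth_rcons size_take sp.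
by rewrite ltnS leqnSn; case: ltnP => // ik; rewrite nth_take.
Qed.

Lemma size_tm_squeeze J p : (1 < size p)%N -> size (tm_squeeze Ar u J p) = (size p).-1.
Proof.
case: p => [|a [|b p]] //= _.
by rewrite /tm_squeeze size_rcons size_take /= subn2 /= ltnS leqnSn.
Qed.

Lemma tm_polymul_coef p p' k : nth zero (tm_polymul Ar u p p') k =
  if (k < (size p + size p').-1)%N then
    \big[cb_add Ar u/zero]_(i < k.+1 | (i < size p)%N && (k - i < size p')%N)
       cb_mul Ar u (nth zero p i) (nth zero p' (k - i))
  else zero.
Proof.
by rewrite /tm_polymul; case: ltnP => h; [rewrite nth_mkseq | rewrite nth_default ?size_mkseq].
Qed.

Lemma in_zero_coef p q i : tm_coefs p q -> (size p <= i)%N -> q`_i = 0.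
Proof. by move=> h ip; have := h i; rewrite nth_default // => /in_cb_pointE. Qed.

Lemma size_tm_coefs p q : tm_coefs p q -> (size q <= size p)%N.
Proof. by move=> h; apply/leq_sizeP => j; apply: in_zero_coef. Qed.

Lemma tm_polymul_valid p p' : tm_valid p -> tm_valid p' -> tm_valid (tm_polymul Ar u p p').
Proof.
move=> h h' k; rewrite tm_polymul_coef; case: ifP => _; last exact: cvalid0.
elim/big_ind: _ => [|X Y|i _]; [exact: cvalid0 | exact: cb_add_valid |].
exact: cb_mul_valid.
Qed.

Lemma tm_polymul_coefs p p' q q' : tm_valid p -> tm_valid p' -> tm_coefs p q -> tm_coefs p' q' ->
  tm_coefs (tm_polymul Ar u p p') (q * q').
Proof.
move=> pv pv' h h' k; rewrite tm_polymul_coef coefM.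
have term0 i : ~~ ((i < size p)%N && (k - i < size p')%N) -> q`_i * q'`_(k - i) = 0.
  rewrite negb_and -!leqNgt => /orP[] hi; first by rewrite (in_zero_coef h) ?mul0r.
  by rewrite (in_zero_coef h') ?mulr0.
rewrite (bigID (fun i : 'I_k.+1 => (i < size p)%N && (k - i < size p')%N)) /=.
rewrite [X in _ + X]big1 ?addr0; last by move=> i /term0.
case: ltnP => hk.
  suff : forall X z, cvalid Ar X /\ in_cbox X z -> in_cbox X z by apply; elim/big_ind2: _ =>
    [|X1 z1 X2 z2 [? ?] [? ?]|i _]; [split; [exact: cvalid0 | exact: in_cb_point]
    | split; [exact: cb_add_valid | exact: (cb_add_incl u01)]
    | split; [exact: cb_mul_valid | apply: (cb_mul_incl u01)]].
  by move=> X z [].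
rewrite big1 => [|i /andP[i1 i2]]; first exact: in_cb_point.
suff : (k < (size p + size p').-1)%N by rewrite ltnNge hk.
have ik : (i <= k)%N by rewrite -ltnS.
by rewrite -(subnKC ik); case: (size p) i1 => // a i1; rewrite addSn /= -addnS leq_add.
Qed.

Section Interval.
Variables (J : ival R) (e : R).
Hypotheses (Jv : is_ival (rep Ar) J) (eJ : in_ival J e).

Let real_J : cvalid Ar (cb_real J) /\ in_cbox (cb_real J) e%:C.
Proof. by split; split => //; [split; rewrite /= ?rep0 | rewrite /in_ival /= lexx]. Qed.

Lemma tm_squeeze_valid p k : size p = k.+2 -> tm_valid p -> tm_valid (tm_squeeze Ar u J p).
Proof.
move=> sp h i; rewrite (nth_tm_squeeze _ _ sp); case: ifP => _ //.
case: ifP => _; last exact: cvalid0.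
by apply: cb_add_valid => //; apply: cb_mul_valid => //; case: real_J.
Qed.

(** Squeezing changes the polynomial but keeps its value at [e]: the top coefficient times [e] moves
    one degree down. *)
Lemma tm_squeeze_coefs p q k : size p = k.+2 -> tm_valid p -> tm_coefs p q ->
  exists2 q', tm_coefs (tm_squeeze Ar u J p) q' & q'.[e%:C] = q.[e%:C].
Proof.
move=> sp pv h.
exists (\poly_(i < k.+1) (if (i == k)%N then q`_k + q`_k.+1 * e%:C else q`_i)) => [i|].
  rewrite (nth_tm_squeeze _ _ sp) coef_poly ltnS.
  case: ltngtP => [ik|ik|ik]; [exact: h | exact: in_cb_point |].
  by apply: (cb_add_incl u01) => //; [apply: cb_mul_valid => //; case: real_J
    | apply: (cb_mul_incl u01) => //; case: real_J].
have sq : (size q <= k.+2)%N by rewrite -sp; apply: size_tm_coefs.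
rewrite (horner_coef_wide _ sq) horner_poly !big_ord_recr /= eqxx.
rewrite mulrDl addrA exprS mulrA; congr (_ + _ + _).
by apply: eq_bigr => i _; rewrite ltn_eqF.
Qed.

(** A model of order 2 has 4 coefficients. Enclosure is stated at one [e] at a time because the
    polynomial left by a squeezing depends on [e]. *)
Definition tm_encloses (M : R) p (z : R[i]) :=
  [/\ size p = 4, tm_valid p & exists2 q, tm_coefs p q & z = q.[e%:C]].

Lemma tm_encloses_const M X z : cvalid Ar X -> in_cbox X z ->
  tm_encloses M (@tm_const R 2 X) z.
Proof.
move=> Xv zX; split=> [|i|]; first by [].
  by case: i => [|[|[|[|i]]]] //=; rewrite ?nth_nil; apply: cvalid0.
exists z%:P; last by rewrite hornerC.
move=> i; rewrite coefC; case: i => [|[|[|[|i]]]] //=; rewrite ?nth_nil; exact: in_cb_point.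
Qed.

Lemma tm_encloses_affine M a b : crep Ar a -> crep Ar b ->
  tm_encloses M (tm_affine 2 a b) (a + e%:C * b).
Proof.
move=> ar br; split=> [|i|]; first by [].
  by case: i => [|[|[|[|i]]]] //=; rewrite ?nth_nil; do ?[exact: cvalid0 | exact: cvalid_point].
exists (a%:P + b *: 'X); last by rewrite !hornerE mulrC.
move=> i; rewrite coefD coefC coefZ coefX.
by case: i => [|[|[|[|i]]]] /=; rewrite ?nth_nil ?mulr0 ?mulr1 ?addr0 ?add0r; exact: in_cb_point.
Qed.

Lemma tm_encloses_mul M p p' z z' : tm_encloses M p z -> tm_encloses M p' z' ->
  tm_encloses M (tm_mul Ar u 2 J p p') (z * z').
Proof.
move=> [sp pv [q hq ->]] [sp' pv' [q' hq' ->]]; rewrite -hornerM.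
(* Two lists of length 4 have a product of length 7, which three squeezings bring back to 4. *)
have s7 : size (tm_polymul Ar u p p') = 7 by rewrite size_mkseq sp sp'.
have v7 := tm_polymul_valid pv pv'; have c7 := tm_polymul_coefs pv pv' hq hq'.
have s6 := size_tm_squeeze J (_ : 1 < size (tm_polymul Ar u p p'))%N.
rewrite s7 in s6; have {}s6 := s6 isT.
have v6 := tm_squeeze_valid s7 v7; have [q6 c6 <-] := tm_squeeze_coefs s7 v7 c7.
have s5 := size_tm_squeeze J (_ : 1 < size (tm_squeeze Ar u J (tm_polymul Ar u p p')))%N.
rewrite s6 in s5; have {}s5 := s5 isT.
have v5 := tm_squeeze_valid s6 v6; have [q5 c5 <-] := tm_squeeze_coefs s6 v6 c6.
have s4 := size_tm_squeeze J (_ : 1 < size (tm_squeeze Ar u J (tm_squeeze Ar u J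
  (tm_polymul Ar u p p'))))%N.
rewrite s5 in s4; have {}s4 := s4 isT.
have v4 := tm_squeeze_valid s5 v5; have [q4 c4 <-] := tm_squeeze_coefs s5 v5 c5.
by split => //; exists q4.
Qed.

Lemma arith_rel_tm_encloses Phi : arith_rel Ar Phi (tm_arith Ar u 2 J) pt_arith tm_encloses.
Proof.
split => //.
- move=> M z _ zr _; rewrite pt_point; apply: tm_encloses_const; first exact: cvalid_point.
  exact: in_cb_point.
- move=> M p z p' z' _ [sp pv [q hq ->]] [sp' pv' [q' hq' ->]].
  have sE : size p = size p' by rewrite sp sp'.
  split => [|i|]; first by rewrite size_map size_zip sp sp'.
    by rewrite nth_tm_add //; case: ifP => _; [apply: cb_add_valid | apply: cvalid0].
  exists (q + q'); last by rewrite hornerD.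
  move=> i; rewrite nth_tm_add // coefD; case: ltnP => ip; first exact: (cb_add_incl u01).
  by rewrite (in_zero_coef hq ip) (in_zero_coef hq') -?sE // addr0; apply: in_cb_point.
- move=> M p z _ [sp pv [q hq ->]]; split => [|i|]; first by rewrite size_map.
    by rewrite nth_tm_map; case: ifP => _; [apply: cb_neg_valid | apply: cvalid0].
  exists (- q); last by rewrite hornerN.
  move=> i; rewrite nth_tm_map coefN; case: ltnP => ip; first exact: cb_neg_incl.
  by rewrite (in_zero_coef hq ip) oppr0; apply: in_cb_point.
- by move=> M p z p' z' _; apply: tm_encloses_mul.
Qed.

Lemma tm_encloses_div M p z r : r \in rep Ar -> 0 < r -> tm_encloses M p z ->
  tm_encloses M [seq cb_div Ar u a r | a <- p] ((r^-1)%:C * z).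
Proof.
move=> rr r0 [sp pv [q hq ->]]; split => [|i|]; first by rewrite size_map.
  by rewrite nth_tm_map; case: ifP => _; [apply: cb_div_valid | apply: cvalid0].
exists ((r^-1)%:C *: q); last by rewrite hornerZ.
move=> i; rewrite nth_tm_map coefZ; case: ltnP => ip; first exact: cb_div_incl.
by rewrite (in_zero_coef hq ip) mulr0; apply: in_cb_point.
Qed.

Lemma tm_eval_coefs p (c : nat -> R[i]) : (forall i, (i < size p)%N -> cvalid Ar (nth zero p i)) ->
  (forall i, (i < size p)%N -> in_cbox (nth zero p i) (c i)) ->
  cvalid Ar (tm_eval Ar u p J) /\ in_cbox (tm_eval Ar u p J) (\sum_(i < size p) c i * e%:C ^+ i).
Proof.
elim: p c => [|X p IH] c pv h.
  by rewrite big_ord0; split; [apply: cvalid0 | apply: in_cb_point].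
have [v1 i1] := IH (fun i => c i.+1) (fun i => pv i.+1) (fun i => h i.+1).
have Xv : cvalid Ar X := pv 0%N isT; have [Jv' eJ'] := real_J.
have mv : cvalid Ar (cb_mul Ar u (cb_real J) (tm_eval Ar u p J)) by apply: cb_mul_valid.
split; first exact: cb_add_valid.
rewrite big_ord_recl expr0 mulr1; apply: (cb_add_incl u01) => //; first exact: (h 0%N).
under eq_bigr => i _ do rewrite lift0 exprS mulrCA.
by rewrite -mulr_sumr; apply: (cb_mul_incl u01).
Qed.

Lemma tm_eval_incl M p z : tm_encloses M p z ->
  cvalid Ar (tm_eval Ar u p J) /\ in_cbox (tm_eval Ar u p J) z.
Proof.
move=> [sp pv [q hq ->]]; rewrite (horner_coef_wide _ (size_tm_coefs hq)).
exact: tm_eval_coefs.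
Qed.

End Interval.
End TaylorEnclosure.

(** * Size of Taylor coefficients and comparison of models with boxes *)

Section TaylorBounds.
Variables (R : realType) (Ar : interval_arith R) (u : R).
Hypothesis u01 : 0 < u < 1.
Notation zero := (cb_point (0 : R[i])).
Notation G := (@box_growth R).
Implicit Types (p : tmodel R) (X Y : cbox R).

Definition tm_bounded (M : R) p := forall i, cbounded M (nth zero p i).

Lemma cbounded0 (M : R) : 0 <= M -> cbounded M zero.
Proof. by move=> M0; apply: cbounded_point; rewrite cabs0. Qed.

Lemma cb_add_bounded M X Y : 1 <= M -> cvalid Ar X -> cvalid Ar Y ->
  cbounded M X -> cbounded M Y -> cbounded (G M) (cb_add Ar u X Y).
Proof.
move=> M1 Xv Yv Xb Yb; apply: (@cnear_bounded R Ar u _ _ (cb_add Ar u X Y)).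
by apply: cnear_add_box => //; apply: (cnear_self u01) => //; lra.
Qed.

Lemma cb_mul_bounded M X Y : 1 <= M -> cvalid Ar X -> cvalid Ar Y ->
  cbounded M X -> cbounded M Y -> cbounded (G M) (cb_mul Ar u X Y).
Proof.
move=> M1 Xv Yv Xb Yb; apply: (@cnear_bounded R Ar u _ _ (cb_mul Ar u X Y)).
by apply: cnear_mul_box => //; apply: (cnear_self u01) => //; lra.
Qed.

(** One iteration pays for a product followed by a sum. *)
Definition growth_iter k (M : R) := iter k (fun M => G (G M)) M.

Lemma growth_iter1 k M : 1 <= M -> M <= growth_iter k M.
Proof.
move=> M1; elim: k => [|k IH] //=; apply: (le_trans IH).
have h := le_trans M1 IH; have h' := box_growthP h.
exact: le_trans h' (box_growthP (le_trans h h')).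
Qed.

Lemma growth_iterD j k M : growth_iter (j + k) M = growth_iter j (growth_iter k M).
Proof. by rewrite /growth_iter iterD. Qed.

Lemma growth_iter_le j k M : 1 <= M -> (j <= k)%N -> growth_iter j M <= growth_iter k M.
Proof.
move=> M1 jk; rewrite -(subnK jk) growth_iterD; apply: growth_iter1.
exact: le_trans M1 (growth_iter1 _ M1).
Qed.

Lemma G_growth_iter M : 1 <= M -> G M <= growth_iter 1 M.
Proof. by move=> M1; apply: box_growthP; apply: le_trans (box_growthP M1). Qed.

Lemma tm_polymul_bounded M p p' : 1 <= M -> size p = 4 -> size p' = 4 ->
  tm_valid Ar p -> tm_valid Ar p' -> tm_bounded M p -> tm_bounded M p' ->
  tm_bounded (growth_iter 7 M) (tm_polymul Ar u p p').
Proof.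
move=> M1 sp sp' pv pv' pb pb' k; rewrite tm_polymul_coef sp sp'.
have M0 j : 0 <= growth_iter j M by have := growth_iter1 j M1; lra.
case: ltnP => hk; last exact/cbounded0/M0.
have sum (s : seq 'I_k.+1) : let S := \big[cb_add Ar u/zero]_(i <- s | (i < 4)%N && (k - i < 4)%N)
      cb_mul Ar u (nth zero p i) (nth zero p' (k - i)) in
    cvalid Ar S /\ cbounded (growth_iter (size s) M) S.
  elim: s => [|i s [IHv IHb]] /=; first by rewrite big_nil; split; [apply: cvalid0 | exact/cbounded0/(M0 0%N)].
  rewrite big_cons; case: ifP => _; last first.
    by split => //; apply: cbounded_mono (growth_iter_le M1 (leqnSn (size s))) IHb.
  have mv : cvalid Ar (cb_mul Ar u (nth zero p i) (nth zero p' (k - i))) by apply: cb_mul_valid.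
  have N1 : 1 <= growth_iter (size s) M by apply: le_trans M1 (growth_iter1 _ M1).
  have MN := growth_iter1 (size s) M1.
  have NG := box_growthP N1.
  split; first exact: cb_add_valid.
  apply: cb_add_bounded => //; first exact: le_trans N1 NG.
    by apply: cb_mul_bounded => //; apply: cbounded_mono MN _.
  exact: cbounded_mono NG IHb.
have [_ h] := sum (index_enum _); apply: cbounded_mono h.
by apply: growth_iter_le => //; rewrite /index_enum -enumT size_enum_ord.
Qed.

Section Model.
Variables (h : R).
Hypothesis h01 : 0 <= h <= 1.
Hypothesis hrep : h \in rep Ar.
Notation J := (Ival 0 h).

Lemma J_ival : is_ival (rep Ar) J.
Proof. by case/andP: h01 => h0 _; split; rewrite //= rep0. Qed.

Lemma J_valid : cvalid Ar (cb_real J).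
Proof. by split; [exact: J_ival | split; rewrite /= ?rep0]. Qed.

Lemma J_bounded (e : R) : h <= e -> cbounded e (cb_real J).
Proof. by case/andP: h01 => h0 _ he; split; split => /=; lra. Qed.

Lemma tm_squeeze_bounded M p k : 1 <= M -> size p = k.+2 -> tm_valid Ar p -> tm_bounded M p ->
  tm_bounded (growth_iter 1 M) (tm_squeeze Ar u J p).
Proof.
move=> M1 sp pv pb i; have M1' := growth_iter1 1 M1.
rewrite (nth_tm_squeeze _ _ _ _ sp); case: ifP => _; first exact: cbounded_mono M1' _.
case: ifP => _; last by apply: cbounded0; lra.
have mv : cvalid Ar (cb_mul Ar u (nth zero p k.+1) (cb_real J)).
  by apply: cb_mul_valid => //; apply: J_valid.
have MG := box_growthP M1.
apply: cb_add_bounded => //; first exact: le_trans M1 MG.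
  exact: cbounded_mono MG _.
by apply: cb_mul_bounded => //; [apply: J_valid | apply: J_bounded; case/andP: h01; lra].
Qed.

(** [X] stands for the box that plain interval arithmetic computes at time [t]. The constant
    coefficient undergoes the same operations as [X]; the others need only be bounded, since their
    contribution vanishes with [h]. *)
Definition tm_near (M : R) p X :=
  [/\ size p = 4, tm_valid Ar p, tm_bounded M p, cvalid Ar X & cnear Ar u M (nth zero p 0) X].

(** Eleven iterations dominate the ten of a product, seven for its sums and three for the
    squeezings; [2 * K] pays for a division by [r] with [r^-1 <= K] and for its rounding. *)
Definition tm_growth (K M : R) := growth_iter 11 (2 * K * M).

Variable K : R.
Hypothesis K1 : 1 <= K.

Let MK M : 1 <= M -> M <= 2 * K * M.
Proof. by move=> M1; have : M <= K * M; [rewrite ler_peMl //; lra | lra]. Qed.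

Lemma tm_growthP : growth (tm_growth K).
Proof.
by move=> M M1; have h1 := MK M1; apply: (le_trans h1); apply: growth_iter1; apply: le_trans h1.
Qed.

Lemma tm_growth_ge k M : (k <= 11)%N -> 1 <= M -> growth_iter k M <= tm_growth K M.
Proof.
move=> k11 M1; have M0 : 0 <= M by lra.
have mono j a b : 1 <= a -> a <= b -> growth_iter j a <= growth_iter j b.
  move=> a1 ab; elim: j => [|j IH] //=.
  have Gm x y : 1 <= x -> x <= y -> G x <= G y.
    by move=> x1 xy; rewrite /box_growth !expr2; nra.
  have x1 := le_trans a1 (growth_iter1 j a1).
  by apply: (Gm _ _ (le_trans x1 (box_growthP x1))); apply: (Gm _ _ x1).
apply: le_trans (growth_iter_le _ k11); last exact: le_trans M1 (MK M1).
by apply: mono => //; apply: MK.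
Qed.

Let uu : u <= u. Proof. by []. Qed.

Lemma tm_near_mono M M' p X : M <= M' -> tm_near M p X -> tm_near M' p X.
Proof.
move=> MM [sp pv pb Xv pX]; split => //; first by move=> i; apply: cbounded_mono (pb i).
exact: (cnear_mono u01 uu MM).
Qed.

Lemma tm_near_const M X : 1 <= M -> cvalid Ar X -> cbounded M X -> tm_near M (@tm_const R 2 X) X.
Proof.
move=> M1 Xv Xb; split => //.
- by case=> [|[|[|[|i]]]] //=; rewrite ?nth_nil; apply: cvalid0.
- by case=> [|[|[|[|i]]]] //=; rewrite ?nth_nil; apply: cbounded0; lra.
- by apply: (cnear_self u01 uu) => //; lra.
Qed.

Lemma tm_near_affine M a b : 1 <= M -> crep Ar a -> crep Ar b -> cabs a <= M -> cabs b <= M ->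
  tm_near M (tm_affine 2 a b) (cb_point a).
Proof.
move=> M1 ar br aM bM; have av := cvalid_point ar; have bv := cvalid_point br.
have ab := cbounded_point aM; have bb := cbounded_point bM.
split => //.
- by case=> [|[|[|[|i]]]] //=; rewrite ?nth_nil; apply: cvalid0.
- by case=> [|[|[|[|i]]]] //=; rewrite ?nth_nil; apply: cbounded0; lra.
- by apply: (cnear_self u01 uu) => //; lra.
Qed.

Lemma tm_near_add M p X p' X' : 1 <= M -> tm_near M p X -> tm_near M p' X' ->
  tm_near (G M) (tm_add Ar u p p') (cb_add Ar u X X').
Proof.
move=> M1 [sp pv pb Xv pX] [sp' pv' pb' Xv' pX'].
have sE : size p = size p' by rewrite sp sp'.
have G0 : 0 <= G M by have := box_growthP M1; lra.
split.
- by rewrite size_map size_zip sp sp'.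
- by move=> i; rewrite nth_tm_add //; case: ifP => _; [apply: cb_add_valid | apply: cvalid0].
- by move=> i; rewrite nth_tm_add //; case: ifP => _; [apply: cb_add_bounded | apply: cbounded0].
- exact: cb_add_valid.
- by rewrite nth_tm_add // sp; apply: cnear_add_box.
Qed.

(* Order 2 products are squeezed three times, and the squeezing never reaches
   the constant coefficient. *)
Lemma tm_near_mul M p X p' X' : 1 <= M -> tm_near M p X -> tm_near M p' X' ->
  tm_near (growth_iter 10 M) (tm_mul Ar u 2 J p p') (cb_mul Ar u X X').
Proof.
move=> M1 [sp pv pb Xv pX] [sp' pv' pb' Xv' pX'].
have step7 : size (tm_polymul Ar u p p') = 7 by rewrite size_mkseq sp sp'.
have v7 := tm_polymul_valid u01 pv pv'; have b7 := tm_polymul_bounded M1 sp sp' pv pv' pb pb'.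
have next k M0 q : 1 <= M0 -> size q = k.+3 -> tm_valid Ar q -> tm_bounded M0 q ->
    [/\ size (tm_squeeze Ar u J q) = k.+2, tm_valid Ar (tm_squeeze Ar u J q),
        tm_bounded (growth_iter 1 M0) (tm_squeeze Ar u J q) &
        nth zero (tm_squeeze Ar u J q) 0 = nth zero q 0].
  move=> M01 sq qv qb; split.
  - by rewrite size_tm_squeeze sq.
  - have J0 : in_ival J 0 by rewrite /in_ival /= lexx; case/andP: h01.
    exact: (tm_squeeze_valid u01 J_ival J0 sq).
  - exact: (tm_squeeze_bounded M01 sq).
  - by rewrite (nth_tm_squeeze _ _ _ _ sq).
have i7 : 1 <= growth_iter 7 M by apply: le_trans M1 (growth_iter1 _ M1).
have [s6 v6 b6 e6] := next 4%N _ _ i7 step7 v7 b7.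
have i8 : 1 <= growth_iter 1 (growth_iter 7 M) by apply: le_trans i7 (growth_iter1 _ i7).
have [s5 v5 b5 e5] := next 3%N _ _ i8 s6 v6 b6.
have i9 := le_trans i8 (growth_iter1 1 i8).
have [s4 v4 b4 e4] := next 2%N _ _ i9 s5 v5 b5.
split => //; first exact: cb_mul_valid.
(* The constant coefficient is a sum over a single index, which still ends with a rounded addition
   of the box 0. *)
have -> : nth zero (tm_mul Ar u 2 J p p') 0 = cb_add Ar u (cb_mul Ar u (nth zero p 0) (nth zero p' 0)) zero.
  rewrite [LHS]e4 e5 e6 tm_polymul_coef sp sp' /=.
  have -> : index_enum 'I_1 = [:: ord0].
    by rewrite /index_enum -enumT enum_ordSl [enum 'I_0](size0nil (size_enum_ord 0)).
  by rewrite big_cons big_nil.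
have nm := cnear_mul_box u01 uu M1 Xv Xv' pX pX'.
have G1 : 1 <= G M by apply: le_trans M1 (box_growthP M1).
have E3 : bounded_by (3 * G M) (bRe (cb_mul Ar u X X')) /\ bounded_by (3 * G M) (bIm (cb_mul Ar u X X')).
  by case: nm => -[_ _ [? ?] _ _] [_ _ [? ?] _ _]; split; split; lra.
have n0 : near_ival Ar u (G M) (ipoint 0) (ipoint 0).
  by apply: (near_self u01 uu); [split; rewrite /= ?rep0 | split; rewrite /=; lra | lra].
have add0 E : forall x y : R, in_ival E x -> in_ival (ipoint 0) y -> in_ival E (x + y).
  by move=> x y hx /in_ipoint ->; rewrite addr0.
apply: (@cnear_mono R Ar u u01 u uu (3 * G M)).
  apply: (@le_trans _ _ (growth_iter 1 M)); last exact: growth_iter_le.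
  have G3 a : 1 <= a -> 3 * a <= G a by rewrite /box_growth expr2; nra.
  exact: G3.
have [nr ni] := nm; have [Er Ei] := E3.
split; [apply: (near_add u01 uu G1 nr n0 Er) | apply: (near_add u01 uu G1 ni n0 Ei)] => //.
- by case: nr.
- exact: add0.
- by case: ni.
- exact: add0.
Qed.

Lemma arith_rel_tm_near :
  arith_rel Ar (tm_growth K) (tm_arith Ar u 2 J) (box_arith Ar u) tm_near.
Proof.
split => //.
- by move=> M M' p X _; apply: tm_near_mono.
- move=> M z M1 zr zM; apply: tm_near_const => //; first exact: cvalid_point.
  exact: cbounded_point.
- move=> M p X p' X' M1 hX hX'; apply: tm_near_mono (tm_near_add M1 hX hX').
  by apply: le_trans (G_growth_iter M1) _; apply: tm_growth_ge.
- move=> M p X M1 [sp pv pb Xv pX]; apply: (@tm_near_mono (G M)).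
    by apply: le_trans (G_growth_iter M1) _; apply: tm_growth_ge.
  have MG := box_growthP M1.
  split.
  + by rewrite size_map.
  + by move=> i; rewrite nth_tm_map; case: ifP => _; [apply: cb_neg_valid | apply: cvalid0].
  + move=> i; rewrite nth_tm_map; case: ifP => _; last by apply: cbounded0; lra.
    by apply: cb_neg_bounded; apply: cbounded_mono MG _.
  + exact: cb_neg_valid.
  + by rewrite nth_tm_map sp; apply: (cnear_neg u01 uu).
- move=> M p X p' X' M1 hX hX'; apply: tm_near_mono (tm_near_mul M1 hX hX').
  exact: tm_growth_ge.
Qed.

(** Division multiplies bounds and errors by at most [K], and rounding adds at most as much again
    because [u < 1]. *)
Lemma tm_near_div M r p X : r \in rep Ar -> 0 < r -> r^-1 <= K -> 1 <= M -> tm_near M p X ->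
  tm_near (tm_growth K M) [seq cb_div Ar u a r | a <- p] (cb_div Ar u X r).
Proof.
move=> rr r0 rK M1 [sp pv pb Xv pX].
have /andP[u0 u1] := u01.
have r0' : 0 < r^-1 by rewrite invr_gt0.
have K0 : 0 <= K by lra.
have M0 : 0 <= M by lra.
have KM1 : 1 <= K * M by rewrite mulr_ege1.
have KMu : K * M * u <= K * M by rewrite ler_piMr // ?ltW //; lra.
have scaled I c : 0 <= c -> bounded_by c I -> bounded_by (K * c) (Ival (lo I / r) (hi I / r)).
  move=> c0 [I1 I2]; have cr : c / r <= K * c by rewrite mulrC ler_wpM2r.
  split => /=.
    apply: (@le_trans _ _ (- c / r)); first by rewrite mulNr lerN2.
    by rewrite ler_pM2r.
  by apply: le_trans cr; rewrite ler_pM2r.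
have dv I : is_ival (rep Ar) I -> bounded_by M I -> bounded_by (2 * K * M) (idiv Ar u I r).
  move=> Iv Ib; have [b1 b2] := scaled _ _ M0 Ib.
  have [] := idiv_tight u01 KM1 Iv rr r0 (conj b1 b2).
  by move: b1 b2 => /= b1 b2; split; lra.
have db i : cbounded (2 * K * M) (cb_div Ar u (nth zero p i) r).
  by case: (pb i) (pv i) => ? ? [? ?]; split; apply: dv.
have nv I E : is_ival (rep Ar) E -> near_ival Ar u M I E ->
    near_ival Ar u (2 * K * M) (idiv Ar u I r) (idiv Ar u E r).
  move=> Ev [Iv Ib Eb El [I1 I2]]; have [b1 b2] := scaled _ _ M0 Ib.
  have [t1 t2] := idiv_tight u01 KM1 Iv rr r0 (conj b1 b2).
  have /andP[q1 _] : in_ival (idiv Ar u E r) (lo E / r).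
    by apply: idiv_incl => //; rewrite /in_ival /= lexx.
  have /andP[_ q2] : in_ival (idiv Ar u E r) (hi E / r).
    by apply: idiv_incl => //; rewrite /in_ival /= lexx andbT.
  have Muk : M * u / r <= K * M * u by rewrite mulrC -mulrA ler_wpM2r // mulr_ge0 // ltW.
  have w1 : lo E / r - M * u / r <= lo I / r by rewrite -mulrBl ler_pM2r.
  have w2 : hi I / r <= hi E / r + M * u / r by rewrite -mulrDl ler_pM2r.
  split; [exact: idiv_ival | exact: dv | exact: dv | by case: (idiv_ival u01 Ev rr r0) | ].
  by split; lra.
have big : 2 * K * M <= tm_growth K M.
  by apply: growth_iter1; apply: le_trans (MK M1).
apply: (tm_near_mono big); split.
- by rewrite size_map.
- by move=> i; rewrite nth_tm_map; case: ifP => _; [apply: cb_div_valid | apply: cvalid0].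
- move=> i; rewrite nth_tm_map; case: ifP => _ //; apply: cbounded0.
  by have := MK M1; lra.
- exact: cb_div_valid.
- by rewrite nth_tm_map sp; case: pX Xv => ? ? [? ?]; split; apply: nv.
Qed.

End Model.

End TaylorBounds.

Section TaylorEval.
Variables (R : realType) (Ar : interval_arith R).
Notation zero := (cb_point (0 : R[i])).

Lemma tm_eval_growth (u M h : R) (p : tmodel R) : 0 < u < 1 -> 1 <= M -> 0 <= h <= 1 ->
  h \in rep Ar -> tm_valid Ar p -> tm_bounded M p ->
  cvalid Ar (tm_eval Ar u p (Ival 0 h)) /\
  cbounded (growth_iter (size p) M) (tm_eval Ar u p (Ival 0 h)).
Proof.
move=> u01 M1 h01 hr; elim: p => [|X p IH] pv pb.
  by split; [apply: cvalid0 | apply: cbounded0; rewrite /growth_iter /=; lra].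
have [IHv IHb] := IH (fun i => pv i.+1) (fun i => pb i.+1).
have Jv := J_valid h01 hr; have Xv : cvalid Ar X := pv 0%N.
have mv := cb_mul_valid u01 Jv IHv.
have N1 := le_trans M1 (growth_iter1 (size p) M1); have NG := box_growthP N1.
split; first exact: cb_add_valid.
apply: cb_add_bounded => //; first exact: le_trans N1 NG.
  by apply: (@cbounded_mono _ M); [apply: le_trans NG; apply: growth_iter1 | apply: (pb 0%N)].
by apply: cb_mul_bounded => //; apply: J_bounded => //; apply: le_trans N1; case/andP: h01.
Qed.

(** In Horner's scheme everything beyond the constant coefficient is multiplied by the interval from
    0 to [h], so it contributes [O(h + u)]. *)
Lemma tm_eval_bounded (M : R) : 1 <= M -> exists2 C, 0 <= C & forall u p h c,
  0 < u < 1 -> 0 <= h <= 1 -> h \in rep Ar -> size p = 4 -> tm_valid Ar p -> tm_bounded M p ->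
  cbounded c (nth zero p 0) -> c <= 1 ->
  cvalid Ar (tm_eval Ar u p (Ival 0 h)) /\ cbounded (c + C * (h + u)) (tm_eval Ar u p (Ival 0 h)).
Proof.
move=> M1; pose M' := growth_iter 3 M; have M'1 : 1 <= M' by apply: le_trans M1 (growth_iter1 _ M1).
pose D := 4 * M' ^+ 2; have D2 : 2 * M' <= D by rewrite /D expr2; nra.
exists (D + (D + D)) => [|u [|X p] h c u01 h01 hr // [sp] pv pb hc c1]; first by lra.
have [av ab] := tm_eval_growth u01 M1 h01 hr (fun i => pv i.+1) (fun i => pb i.+1).
rewrite sp -/M' in ab; have Jv := J_valid h01 hr; have Xv : cvalid Ar X := pv 0%N.
have mv := cb_mul_valid u01 Jv av.
have [/andP[u0 u1] /andP[h0 h1]] := (u01, h01).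
have hM : 0 <= h <= M' by apply/andP; split; lra.
have MM : 0 <= M' <= M' by apply/andP; split; lra.
have mb := cb_mul_bounded2 u01 M'1 Jv av hM MM (J_bounded h01 (lexx h)) ab.
split; first exact: cb_add_valid.
have hD : 2 * (h * M') <= D * h by rewrite mulrCA mulrC ler_wpM2r.
have Dh : D * h <= D by rewrite ler_piMr //; lra.
have Du : D * u <= D by rewrite ler_piMr //; lra.
have le1 : 2 * (h * M') + D * u <= D + D by lra.
have DD1 : 1 <= D + D by lra.
have cD : c <= D + D by lra.
apply: cbounded_mono (cb_add_bounded2 u01 DD1 Xv mv cD le1 hc mb).
have : 0 <= (D + D) * h by rewrite mulr_ge0 //; lra.
by rewrite !mulrDr !mulrDl; lra.
Qed.

End TaylorEval.

(** * The predictor test: soundness and success *)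

Section Predictor.
Variables (R : realType) (n : nat) (Ar : interval_arith R) (F : polymx R n.+1 n 1).
Variables (cF : circuit R n.+1 n 1) (cdF : circuit R n.+1 n n).
Hypotheses (cF_ok : circuit_ok Ar cF) (cdF_ok : circuit_ok Ar cdF).
Hypotheses (cFE : represents cF F) (cdFE : represents cdF (jacobian_x F)).

Lemma encl_predictor u t h e (m : mbox R n) (v w v' : 'cV[R[i]]_n) : 0 < u < 1 ->
  t \in rep Ar -> h \in rep Ar -> mbox_rep Ar m -> mxrep Ar v -> 0 < box_rad m ->
  0 <= e <= h -> unit_ball w -> unit_ball v' ->
  let m' := advance m v e in
  forall i j, tm_encloses Ar e 1 (predictor_model Ar cF cdF u t h m v i j)
    ((- ((box_rad m')^-1)%:C *: (box_mat m' *m at_point F (t + e) (box_ctr m'))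
      + (1%:M - box_mat m' *m at_point (jacobian_x F) (t + e)
           (box_ctr m' + (box_rad m')%:C *: w)) *m v') i j).
Proof.
move=> u01 tr hr [xr rr Arep] vr r0 e01 w1 v1 /= i j.
have /andP[e0 eh] := e01.
have Jv : is_ival (rep Ar) (Ival 0 h) by split; rewrite /= ?rep0 //; lra.
have rel := arith_rel_tm_encloses u01 Jv e01 (@id R).
rewrite -krawczyk_on_pt.
have M1 : 1 <= 1 + cnorm (box_mat m) by rewrite lerDl cnorm_ge0.
have [M' _ hK] := krawczyk_rel Ar (@id_growth R) n M1.
have [M2 _ h2] := circuit_rel (@id_growth R) cF_ok (lexx (1 : R)).
have [M3 _ h3] := circuit_rel (@id_growth R) cdF_ok (lexx (1 : R)).
set o := tm_arith Ar u 2 (Ival 0 h) in rel *.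
have tau : tm_encloses Ar e 1 (tm_affine 2 t%:C 1) (t + e)%:C.
  rewrite rmorphD /= -[e%:C]mulr1; apply: tm_encloses_affine => //.
    exact: crep_real.
  by rewrite /crep /= rep1 rep0.
have X k l : tm_encloses Ar e 1 ((\col_i tm_affine 2 (box_ctr m i ord0) (v i ord0)) k l)
    ((box_ctr m + e%:C *: v) k l).
  by rewrite !mxE (ord1 l); apply: tm_encloses_affine.
have ball k (r : R) (z : 'cV[R[i]]_k) : r \in rep Ar -> cnorm z <= r ->
    forall i j, tm_encloses Ar e 1 (a_ball o k r i j) (z i j).
  move=> rr' zr k' l; have [] := encl_ball u rr' zr k' l.
  by rewrite !mxE; apply: tm_encloses_const.
apply: (hK _ _ _ _ _ (box_rad m) rel) => //.
- by move=> M p z _; apply: (tm_encloses_div u01).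
- by rewrite lerDr.
- move=> k l; rewrite -(circuit_at_point (t + e) (box_ctr m + e%:C *: v) cFE).
  by apply: (h2 _ _ _ _ _ rel) => q; apply: (point_rel (Rel := tm_encloses Ar e 1)).
- move=> k l; rewrite -(circuit_at_point (t + e) (_ + _) cdFE).
  apply: (h3 _ _ _ _ _ rel) => q; apply: (point_rel (Rel := tm_encloses Ar e 1)) => // k' l'.
  rewrite -a_addmx_pt; apply: (addmx_rel rel) => // a b; apply: ball => //.
  by rewrite cnormZ gtr0_norm // ler_piMr // ltW.
- by apply: (ball _ 1) => //; apply: rep1.
Qed.

(** The model may be computed up to [h] with precision [u] and evaluated up to a smaller [h'] with
    precision [u'], as happens after a halving of the step. *)
Lemma predictor_sound u u' t h h' e (m : mbox R n) (v : 'cV[R[i]]_n) : 0 < u < 1 ->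
  0 < u' < 1 -> t \in rep Ar -> h \in rep Ar -> h' \in rep Ar -> mbox_rep Ar m ->
  mxrep Ar v -> 0 < box_rad m -> 0 <= e <= h' -> h' <= h ->
  model_test Ar u' (predictor_model Ar cF cdF u t h m v) h' ->
  moore_box_at F (t + e) (7 / 8) (advance m v e).
Proof.
move=> u01 u01' tr hr hr' mr vr r0 e01 hh test; split => // w v' w1 v1.
have /andP[e0 eh] := e01.
have e01' : 0 <= e <= h by rewrite e0 (le_trans eh).
apply: le_trans test; apply: box_norm_ge => i j; rewrite mxE.
have Jv : is_ival (rep Ar) (Ival 0 h') by split; rewrite /= ?rep0 //; lra.
have enc := encl_predictor u01 tr hr mr vr r0 e01' w1 v1 i j.
by have [] := tm_eval_incl u01' Jv e01 enc.
Qed.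

Lemma predictor_arith (M C u h : R) : 1 <= M -> 0 <= C -> 0 < u < 1 -> 0 <= h <= 1 ->
  (M + C) * (h + u) <= 6 / 8 ->
  1 / 8 + M * u <= 1 /\ 1 / 8 + M * u + C * (h + u) <= 7 / 8.
Proof.
move=> M1 C0 /andP[u0 _] /andP[h0 _]; rewrite mulrDl mulrDr => small.
have Mu : 0 <= M * u by rewrite mulr_ge0 //; lra.
have Mh : 0 <= M * h by rewrite mulr_ge0 //; lra.
have Chu : 0 <= C * (h + u) by rewrite mulr_ge0 //; lra.
by split; lra.
Qed.

(** The constant coefficients follow the computation of the Moore test, whose result is at most 1/8;
    rounding and the higher terms add at most 6/8. The lower bound on the radius controls the
    division by it. *)
Lemma predictor_passes (M rmin : R) : 1 <= M -> 0 < rmin -> exists2 C, 0 <= C &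
  forall u t h (m : mbox R n) (v : 'cV[R[i]]_n), 0 < u < 1 ->
  t \in rep Ar -> h \in rep Ar -> mbox_rep Ar m -> mxrep Ar v -> rmin <= box_rad m <= M ->
  `|t| <= M -> cnorm (box_ctr m) <= M -> cnorm (box_mat m) <= M -> cnorm v <= M ->
  0 <= h <= 1 -> moore_test Ar cF cdF u t m (1 / 8) -> C * (h + u) <= 6 / 8 ->
  model_test Ar u (predictor_model Ar cF cdF u t h m v) h.
Proof.
move=> M1 rmin0; pose K := Num.max 1 rmin^-1.
have K1 : 1 <= K by rewrite /K le_max lexx.
have GP := tm_growthP K1.
have P1 := GP _ M1; have P11 := le_trans M1 P1.
have [M2 MM2 h2] := circuit_rel GP cF_ok P11; have M21 := le_trans P11 MM2.
have [M3 MM3 h3] := circuit_rel GP cdF_ok M21; have M31 := le_trans M21 MM3.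
have [M4 MM4 h4] := krawczyk_rel Ar GP n M31; have M41 := le_trans M31 MM4.
have [C C0 hC] := tm_eval_bounded Ar M41.
exists (M4 + C) => [|u t h m v u01 tr hr mr vr /andP[rmin_r rM] tM xM AM vM h01 test small].
  by lra.
have [xr rr Arep] := mr; have r0 : 0 < box_rad m by apply: lt_le_trans rmin_r.
have rel := arith_rel_tm_near u01 h01 hr K1.
have M3M : M <= M3 by apply: le_trans P1 _; apply: le_trans MM2 MM3.
have upM p X a b : a <= b -> tm_near Ar u a p X -> tm_near Ar u b p X by apply: tm_near_mono.
pose B := box_arith Ar u; pose o := tm_arith Ar u 2 (Ival 0 h).
have near_ball k (r M0 : R) : 1 <= M0 -> r \in rep Ar -> 0 <= r <= M0 -> forall i j,
    tm_near Ar u M0 (a_ball o k r i j) (a_ball B k r i j).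
  move=> M01 rr' /andP[r0' rM'] i j; rewrite !mxE; apply: (tm_near_const u01) => //.
    exact: cb_ball_valid.
  exact: cb_ball_bounded.
have tau M0 : 1 <= M0 -> `|t| <= M0 -> tm_near Ar u M0 (tm_affine 2 t%:C 1) (cb_point t%:C).
  move=> M01 tM0; apply: tm_near_affine => //; first exact: crep_real.
  - by rewrite /crep /= rep1 rep0.
  - by rewrite cabs_real.
  - by rewrite cabs1.
have X M0 k l : 1 <= M0 -> M <= M0 -> tm_near Ar u M0
    ((\col_i tm_affine 2 (box_ctr m i ord0) (v i ord0)) k l) (a_mx B (box_ctr m) k l).
  move=> M01 MM0; rewrite !mxE (ord1 l); apply: tm_near_affine => //.
    by apply: le_trans (cabs_cnorm _ _ _) _; apply: le_trans xM MM0.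
  by apply: le_trans (cabs_cnorm _ _ _) _; apply: le_trans vM MM0.
pose KB := krawczyk B (box_rad m) (box_mat m) (box_at Ar u t cF (a_mx B (box_ctr m)))
  (box_at Ar u t cdF (a_addmx B (a_mx B (box_ctr m)) (a_ball B n (box_rad m)))).
have nK i j : tm_near Ar u M4 (predictor_model Ar cF cdF u t h m v i j) (KB i j).
  apply: (h4 _ _ _ _ _ (box_rad m) rel) => //.
  - move=> M0 p Y M01; apply: tm_near_div => //.
    by rewrite /K le_max; apply/orP; right; rewrite lef_pV2 ?posrE.
  - exact: le_trans AM M3M.
  - move=> k l; apply: upM MM3 _; apply: (h2 _ _ _ _ _ rel) => q.
    apply: (point_rel (Rel := tm_near Ar u (tm_growth K M))); last by move=> *; apply: X.
    by apply: tau => //; apply: le_trans tM P1.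
  - move=> k l; apply: (h3 _ _ _ _ _ rel) => q.
    apply: (point_rel (Rel := tm_near Ar u M2)).
      by apply: tau => //; apply: le_trans tM _; apply: le_trans P1 MM2.
    move=> k' l'; apply: upM MM2 _; apply: (addmx_rel rel) => // a b; first exact: X.
    by apply: near_ball => //; apply/andP; split; lra.
  - by apply: near_ball => //; [apply: rep1 | rewrite ler01].
have KBv : mxvalid Ar KB by move=> i j; case: (nK i j).
have KBb i j : cbounded (1 / 8) (KB i j).
  by apply: (iffLR (box_norm_bounded KBv _)) => //; lra.
have [c1 c78] := predictor_arith M41 C0 u01 h01 small.
have res i j : cvalid Ar (tm_eval Ar u (predictor_model Ar cF cdF u t h m v i j) (Ival 0 h)) /\
    cbounded (7 / 8) (tm_eval Ar u (predictor_model Ar cF cdF u t h m v i j) (Ival 0 h)).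
  have [sp pv pb _ near0] := nK i j.
  have [ev eb] := hC u _ h _ u01 h01 hr sp pv pb (cnear_cbounded near0 (KBb i j)) c1.
  by split; [exact: ev | exact: cbounded_mono c78 eb].
have rv : mxvalid Ar (map_mx (fun p => tm_eval Ar u p (Ival 0 h))
    (predictor_model Ar cF cdF u t h m v)).
  by move=> i j; rewrite mxE; case: (res i j).
apply/(box_norm_bounded rv) => [|i j]; first by lra.
by rewrite mxE; case: (res i j).
Qed.

End Predictor.

(** * Continuation of a zero *)

Section RealInduction.
Variable R : realType.

(** The supremum of the [e] up to which [P] holds throughout is attained by the closedness
    hypothesis, and equals [h] by the openness hypothesis. *)
Lemma real_induction (P : R -> Prop) (h : R) : 0 <= h -> P 0 ->
  (forall e, 0 < e <= h -> (forall e', 0 <= e' < e -> P e') -> P e) ->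
  (forall e, 0 <= e < h -> (forall e', 0 <= e' <= e -> P e') ->
     exists2 d, 0 < d & forall e', e <= e' < e + d -> e' <= h -> P e') ->
  forall e, 0 <= e <= h -> P e.
Proof.
move=> h0 P0 hclosed hopen.
pose S := [set e | 0 <= e <= h /\ forall e', 0 <= e' <= e -> P e'].
have S0 : S 0.
  by split=> [|e' /andP[a b]]; rewrite ?lexx // (_ : e' = 0) //; apply/eqP; rewrite eq_le a b.
have Ss : has_sup S by split; [exists 0 | exists h => e [/andP[]]].
set b := sup S.
have b0 : 0 <= b by apply: sup_upper_bound.
have bh : b <= h by apply: ge_sup; [exists 0 | move=> e [/andP[]]].
have below e : 0 <= e < b -> P e.
  case/andP=> e0 eb; have [e' [_ He'] ee'] := sup_gt (ex_intro _ 0 S0) eb.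
  by apply: He'; rewrite e0 ltW.
have Pb : P b.
  have [->|bn0] := eqVneq b 0 => //; apply: hclosed => //.
  by rewrite lt_neqAle eq_sym bn0 b0.
have leb e : 0 <= e <= b -> P e.
  case/andP=> e0; rewrite le_eqVlt => /orP[/eqP -> //|eb]; apply: below.
  by rewrite e0.
have bE : b = h.
  apply/eqP; rewrite eq_le bh leNgt /=; apply/negP => bh'.
  have [|d d0 hd] := hopen b _ leb; first by rewrite b0.
  have Sc : S (Num.min h (b + d / 2)).
    split; first by rewrite ge_min lexx le_min h0 addr_ge0 // divr_ge0 // ltW.
    move=> e /andP[e0]; rewrite le_min => /andP[eh ed].
    have [eb|be] := leP e b; first by apply: leb; rewrite e0.
    apply: hd => //; rewrite (ltW be) /=; apply: le_lt_trans ed _.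
    by rewrite ltrD2l ltr_pdivrMr // ltr_pMr // ltr1n.
  have : Num.min h (b + d / 2) <= b by apply: sup_upper_bound.
  by rewrite leNgt lt_min bh' ltrDl divr_gt0.
by move=> e; rewrite -bE; apply: leb.
Qed.

End RealInduction.

(** * Bounds on determinants *)

Section DeterminantBound.
Variables (R : realType).

Lemma cabs_prod (I : Type) (s : seq I) (f : I -> R[i]) (c : R) : 0 <= c ->
  (forall i, cabs (f i) <= c) -> cabs (\prod_(i <- s) f i) <= (2 * c) ^+ size s.
Proof.
move=> c0 h; elim: s => [|i s IH]; first by rewrite big_nil cabs1 expr0.
rewrite big_cons exprS -mulrA; apply: le_trans (cabsM _ _) _.
by rewrite ler_wpM2l // ler_pM ?cabs_ge0.
Qed.

Lemma cabs_det n (c : R) : 0 <= c -> exists2 K, 0 <= K &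
  forall M : 'M[R[i]]_n, cnorm M <= c -> cabs (\det M) <= K.
Proof.
move=> c0; exists (\sum_(s : {perm 'I_n}) 2 * ((2 * c) ^+ n)) => [|M Mc].
  by apply: sumr_ge0 => s _; rewrite mulr_ge0 // exprn_ge0 // mulr_ge0.
rewrite /determinant; elim/big_ind2: _ => [|x1 x2 y1 y2 h1 h2|s _]; first by rewrite cabs0.
  by apply: le_trans (cabsD _ _) _; rewrite lerD.
apply: le_trans (cabsM _ _) _; rewrite ler_wpM2l //.
have -> : cabs ((-1) ^+ s : R[i]) = 1 by case: (odd_perm s); rewrite ?expr0 ?expr1 ?cabsN cabs1.
have := @cabs_prod _ (index_enum 'I_n) (fun i => M i (s i)) c c0
  (fun i => le_trans (cabs_cnorm _ _ _) Mc).
by rewrite mul1r [size _](_ : _ = n) // /index_enum -enumT size_enum_ord.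
Qed.

(** The inverse of [M] is bounded by [(1 - rho)^-1], so the Leibniz formula bounds its determinant;
    that of [M] is then bounded from below, uniformly in [M]. *)
Lemma det_near_id n (rho : R) : rho < 1 -> exists2 K, 0 < K &
  forall M : 'M[R[i]]_n, (forall v : 'cV_n, cnorm ((1%:M - M) *m v) <= rho * cnorm v) ->
  K <= cabs (\det M).
Proof.
move=> rho1; have r1 : 0 < 1 - rho by rewrite subr_gt0.
have ir1 : 0 <= (1 - rho)^-1 by rewrite invr_ge0 ltW.
have [K K0 hK] := cabs_det n ir1.
(* The factor 2 is that of [cabsM]; adding 1 keeps the denominator positive. *)
exists (2 * (K + 1))^-1 => [|M hM]; first by rewrite invr_gt0 mulr_gt0 //; lra.
have Mu := unitmx_near_id rho1 hM.
have iM : cnorm (invmx M) <= (1 - rho)^-1.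
  apply: cnorm_mulmx_le => // v; rewrite mulrC ler_pdivlMr // mulrC.
  by have := expanding_near_id (hM (invmx M *m v)); rewrite mulmxA mulmxV // mul1mx.
have := hK _ iM; rewrite det_inv => hd.
have d0 : \det M != 0 by move: Mu; rewrite unitmxE unitfE.
have := cabsM ((\det M)^-1) (\det M); rewrite mulVf // cabs1 => h1.
have h2 : cabs (\det M)^-1 * cabs (\det M) <= (K + 1) * cabs (\det M).
  by rewrite ler_wpM2r ?cabs_ge0 //; lra.
by rewrite -div1r ler_pdivrMr; lra.
Qed.

End DeterminantBound.

(** * Lipschitz bounds for polynomial maps *)

Section Lipschitz.
Variables (R : realType) (n : nat) (Ar : interval_arith R).

(** Lipschitz continuity as a relation between two exact evaluations of a circuit at nearby inputs,
    so that [circuit_rel] produces the constant. *)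
Definition cclose (kappa M : R) (z w : R[i]) :=
  [/\ cabs z <= M, cabs w <= M & cabs (z - w) <= M * kappa].

Lemma arith_rel_close kappa : 0 <= kappa ->
  arith_rel Ar (@box_growth R) pt_arith pt_arith (cclose kappa).
Proof.
move=> k0.
have M2 (M : R) : 1 <= M -> [/\ M + M <= 9 * M ^+ 2, 2 * (M * M) <= 9 * M ^+ 2, 0 <= M & 0 <= M * M].
  by move=> M1; rewrite expr2; split; nra.
split.
- move=> M M' z w _ MM [a b c]; have : M * kappa <= M' * kappa by rewrite ler_wpM2r.
  by split; lra.
- by move=> M z M1 _ zM; rewrite pt_point; split => //; rewrite subrr cabs0 mulr_ge0 //; lra.
- move=> M z w z' w' M1 [a b c] [a' b' c']; have [m1 m2 m3 m4] := M2 _ M1; rewrite /box_growth /=.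
  have h : (M + M) * kappa <= 9 * M ^+ 2 * kappa by rewrite ler_wpM2r.
  split; do ?[by apply: le_trans (cabsD _ _) _; lra].
  by rewrite opprD addrACA; apply: le_trans (cabsD _ _) _; lra.
- move=> M z w M1 [a b c]; have [m1 m2 m3 m4] := M2 _ M1; rewrite /box_growth /cclose /= !cabsN.
  have h : (M + M) * kappa <= 9 * M ^+ 2 * kappa by rewrite ler_wpM2r.
  have Mk : 0 <= M * kappa by rewrite mulr_ge0.
  by split; [lra | lra | rewrite -opprD cabsN; lra].
- move=> M z w z' w' M1 [a b c] [a' b' c']; have [m1 m2 m3 m4] := M2 _ M1; rewrite /box_growth /=.
  have Mk : 0 <= M * kappa by rewrite mulr_ge0.
  have pr x y : cabs x <= M -> cabs y <= M -> cabs (x * y) <= 9 * M ^+ 2.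
    move=> hx hy; apply: le_trans (cabsM _ _) _; apply: le_trans m2.
    by rewrite ler_wpM2l // ler_pM ?cabs_ge0.
  split; [exact: pr | exact: pr |].
  rewrite (_ : z * z' - w * w' = z * (z' - w') + (z - w) * w'); last by ring.
  apply: le_trans (cabsD _ _) _.
  have h1 : cabs (z * (z' - w')) <= 2 * (M * (M * kappa)).
    by apply: le_trans (cabsM _ _) _; rewrite ler_wpM2l // ler_pM ?cabs_ge0.
  have h2 : cabs ((z - w) * w') <= 2 * ((M * kappa) * M).
    by apply: le_trans (cabsM _ _) _; rewrite ler_wpM2l // ler_pM ?cabs_ge0.
  have : 0 <= M * M * kappa by rewrite mulr_ge0.
  by move: h1 h2; rewrite expr2 -!mulrA (mulrC kappa) ; lra.
Qed.

Lemma at_point_lipschitz m p (c : circuit R n.+1 m p) (P : polymx R n.+1 m p) (M : R) :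
  circuit_ok Ar c -> represents c P -> 1 <= M ->
  exists2 L, 1 <= L & forall t t' x x' d, `|t| <= M -> `|t'| <= M -> cnorm x <= M -> cnorm x' <= M ->
    `|t - t'| <= d -> cnorm (x - x') <= d ->
    cnorm (at_point P t x) <= L /\ cnorm (at_point P t x - at_point P t' x') <= L * d.
Proof.
move=> cok cP M1; have [L ML h] := circuit_rel (@box_growthP R) cok M1.
have L1 := le_trans M1 ML.
exists L => // t t' x x' d tM tM' xM xM' td xd.
have d0 : 0 <= d by apply: le_trans td; apply: normr_ge0.
have Md : d <= M * d by rewrite ler_peMl.
have key i j : cclose d L (at_point P t x i j) (at_point P t' x' i j).
  rewrite -!(circuit_at_point _ _ cP); apply: (h _ _ _ _ _ (arith_rel_close d0)) => k.
  apply: (point_rel (Rel := cclose d M)).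
    by split; rewrite ?cabs_real // -rmorphB /= cabs_real; apply: le_trans Md.
  move=> k' l; split; do ?[by apply: le_trans (cabs_cnorm _ _ _) _].
  by have := le_trans (le_trans (cabs_cnorm (x - x') k' l) xd) Md; rewrite !mxE.
have L0 : 0 <= L by lra.
have Ld0 : 0 <= L * d by rewrite mulr_ge0.
split; first by apply/(cnorm_le _ L0) => i j; case: (key i j).
by apply/(cnorm_le _ Ld0) => i j; rewrite !mxE; case: (key i j); rewrite !mxE.
Qed.

End Lipschitz.

Lemma div_bound (R : realType) (a V e : R) : 0 <= V -> 0 <= e -> a <= e / (V + 1) -> a * V <= e.
Proof.
move=> V0 e0 h; apply: le_trans (ler_wpM2r V0 h) _.
have V1 : 0 < V + 1 by lra.
by rewrite mulrAC ler_pdivrMr // ler_wpM2l //; lra.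
Qed.

Lemma cnorm_sub_affine (R : realType) k (z c v : 'cV[R[i]]_k) (a b : R) :
  cnorm (z - (c + a%:C *: v)) <= cnorm (z - (c + b%:C *: v)) + `|a - b| * cnorm v.
Proof.
have shift (V : zmodType) (z' c' x y : V) : z' - (c' + x) = z' - (c' + y) + (y - x).
  by rewrite !opprD !addrA subrK.
have E : b%:C *: v - a%:C *: v = (b - a)%:C *: v by rewrite rmorphB scalerBl.
rewrite distrC -cnormZ -E; move: (a%:C *: v) (b%:C *: v) => x y.
by rewrite (shift _ z c x y); apply: cnormD.
Qed.

Lemma half_expanding_le (R : realType) (p q a w : R) :
  (1 - 1 / 2) * p <= q -> q <= a * w -> p <= 2 * a * w.
Proof. by lra. Qed.

Section Continuation.
Variables (R : realType) (n : nat) (F : polymx R n.+1 n 1) (zeta : 'cV[R[i]]_n).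
Variables (I : set R) (Z : R -> 'cV[R[i]]_n).
Hypothesis IZ : continuation F zeta I Z.
Notation df t := (at_point (jacobian_x F) t).

Lemma continuation_local t (e : R) : I t -> 0 < e -> exists2 d, 0 < d &
  forall s, `|s - t| < d -> I s /\ cnorm (Z s - Z t) <= e.
Proof.
move=> It e0; have Io := cont_open IZ.
have cont (f : R -> R) : {within I, continuous f} -> \forall s \near t, `|f s - f t| <= e.
  rewrite continuous_open_subspace // => /(_ t (mem_set It)) /cvgr_dist_le /(_ e e0).
  by apply: filterS => s; rewrite distrC.
have hn : \forall s \near t, forall i, `|complex.Re (Z s i ord0) - complex.Re (Z t i ord0)| <= e /\
    `|complex.Im (Z s i ord0) - complex.Im (Z t i ord0)| <= e.
  apply: (@filter_forall _ 'I_n (fun i s =>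
    `|complex.Re (Z s i ord0) - complex.Re (Z t i ord0)| <= e /\
    `|complex.Im (Z s i ord0) - complex.Im (Z t i ord0)| <= e)
    (nbhs t) (nbhs_filter t)) => i.
  have [c1 c2] := cont_continuous IZ i.
  exact: filterI (cont _ c1) (cont _ c2).
have hI : \forall s \near t, I s by apply: open_nbhs_nbhs.
have hIn : nbhs t (I `&` [set s | forall i,
    `|complex.Re (Z s i ord0) - complex.Re (Z t i ord0)| <= e /\
    `|complex.Im (Z s i ord0) - complex.Im (Z t i ord0)| <= e]) by apply: filterI.
have [d /= d0 hd] := iffLR (nbhs_ballP _ _) hIn.
exists d => // s sd; have [Is hs] : I s /\ (forall i, `|complex.Re (Z s i ord0) - complex.Re (Z t i ord0)| <= e /\
    `|complex.Im (Z s i ord0) - complex.Im (Z t i ord0)| <= e) by apply: hd; rewrite /ball /= distrC.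
split => //; apply/cnorm_le => [|i j]; first exact: ltW.
by rewrite (ord1 j) !mxE; apply/cabs_le; rewrite cReD cReN cImD cImN.
Qed.

(** Times of [I] close to [b] with bounded norm and determinant away from 0 put [b] in the closure
    of [I] and contradict both alternatives of maximality. *)
Lemma not_maximal (b bound c : R) : ~ I b -> 0 < c ->
  (forall d, 0 < d -> exists t, [/\ I t, `|t - b| < d, cnorm (Z t) <= bound &
     c <= cabs (\det (df t (Z t)))]) -> False.
Proof.
move=> nIb c0 h.
have cl : closure I b.
  move=> B /(iffLR (nbhs_ballP _ _))[d /= d0 hd]; have [t [It td _ _]] := h d d0.
  by exists t; split => //; apply: hd; rewrite /ball /= distrC.
have bad (P : R -> Prop) : (\forall t \near within I (nbhs b), P t) ->
    exists t, [/\ P t, cnorm (Z t) <= bound & c <= cabs (\det (df t (Z t)))].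
  rewrite near_withinE => /(iffLR (nbhs_ballP _ _))[d /= d0 hd]; have [t [It td h1 h2]] := h d d0.
  by exists t; split => //; apply: hd => //; rewrite /ball /= distrC.
have [/cvgryPgt /(_ bound) /bad[t [h1 h2 _]]|] := cont_maximal IZ cl nIb.
  by move: h2; rewrite leNgt h1.
move=> /cvgr0Pnorm_lt /(_ c c0) /bad[t [h1 _ h2]].
by move: h2; rewrite leNgt -[X in X < _]ger0_norm ?cabs_ge0 // h1.
Qed.

(* The predicted boxes contain their zeros in their interiors, so the
   continuation cannot leave them, nor can it stop inside them. *)
Lemma continuation_in_boxes (t0 h : R) (m : mbox R n) (v : 'cV[R[i]]_n) : 0 <= h ->
  (forall e, 0 <= e <= h -> moore_box_at F (t0 + e) (7 / 8) (advance m v e)) ->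
  I t0 -> in_mbox m (Z t0) ->
  forall e, 0 <= e <= h -> I (t0 + e) /\ in_mbox (advance m v e) (Z (t0 + e)).
Proof.
move=> h0 mm It0 Zt0.
have r0 : 0 < box_rad m by have [] := mm 0; rewrite ?lexx.
have mv : 0 <= cnorm v by apply: cnorm_ge0.
have lip (a b : R) z : cnorm (z - box_ctr (advance m v a)) <=
    cnorm (z - box_ctr (advance m v b)) + `|a - b| * cnorm v.
  exact: cnorm_sub_affine.
have chain1 (p q w x y r e : R) : p <= q + w -> q <= x + y -> x <= e / 2 -> y <= r ->
  w <= e / 2 -> p <= r + e by move=> *; lra.
have chain2 (p q w x y r : R) : p <= q + w -> q <= x + y -> x <= r / 16 -> y <= 7 / 8 * r ->
  w <= r / 16 -> p <= r by move=> *; lra.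
apply: real_induction => //.
- by rewrite addr0; split => //; rewrite /in_mbox /advance /= scale0r addr0.
- move=> b /andP[b0 bh] hb.
  have near_b d : 0 < d -> exists2 e, 0 <= e < b & `|e - b| < d.
    move=> d0; have [bd|bd] := leP b (d / 2).
      exists 0; first by rewrite lexx.
      by rewrite sub0r normrN gtr0_norm //; lra.
    exists (b - d / 2); first by apply/andP; split; lra.
    by rewrite addrAC subrr sub0r normrN gtr0_norm; lra.
  have Ib : I (t0 + b).
    apply: contrapT => nIb.
    have rho1 : 7 / 8 < 1 :> R by lra.
    have [K K0 hK] := det_near_id n rho1.
    (* From [K <= cabs (\det (A *m dF))], with [dF] the differential, and [cabsM]; adding 1 keeps
       the denominator positive. *)
    pose c := K / (2 * (cabs (\det (box_mat m)) + 1)).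
    have dA := cabs_ge0 (\det (box_mat m)).
    have c0 : 0 < c by rewrite divr_gt0 // mulr_gt0 //; lra.
    apply: (@not_maximal _ (box_rad m + b * cnorm v + cnorm (box_ctr m)) c nIb c0) => d d0.
    have [e /andP[e0 eb] ed] := near_b d d0.
    have [Ie Ze] := hb e (introT andP (conj e0 eb)).
    exists (t0 + e); split => //; first by rewrite opprD addrACA subrr add0r.
      have Ze' : cnorm (Z (t0 + e) - box_ctr (advance m v e)) <= box_rad m by [].
      have := lip 0 e (Z (t0 + e)); rewrite /advance /= scale0r addr0 sub0r normrN ger0_norm //.
      have := cnormD (Z (t0 + e) - box_ctr m) (box_ctr m); rewrite subrK.
      have : e * cnorm v <= b * cnorm v by rewrite ler_wpM2r // ltW.
      by move: Ze'; rewrite /advance /=; lra.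
    have e0h : 0 <= e <= h by rewrite e0 (le_trans (ltW eb)).
    have := hK _ (fun w => moore_deriv (mm e e0h) w Ze); rewrite det_mulmx /= => hd.
    have := cabsM (\det (box_mat m)) (\det (df (t0 + e) (Z (t0 + e)))).
    have := cabs_ge0 (\det (df (t0 + e) (Z (t0 + e)))); move: hd dA; rewrite /c.
    move: (cabs _) (cabs (_ * _)) (cabs (\det _)) => x y z yK x0 z0 yxz.
    rewrite ler_pdivrMr; last by rewrite mulr_gt0 //; lra.
    by rewrite mulrC -mulrA mulrDl mul1r; lra.
  (* Half of [e] allows for the motion of the zero between the times of [a] and [b], the other half
     for the motion of the box. *)
  split => //; rewrite /in_mbox; apply/ler_addgt0Pr => e e0.
  have [|d d0 hd] := @continuation_local (t0 + b) (e / 2) Ib; first by rewrite divr_gt0.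
  pose d' := Num.min d (e / 2 / (cnorm v + 1)).
  have v1 : 0 < cnorm v + 1 by lra.
  have d'0 : 0 < d' by rewrite lt_min d0 !divr_gt0.
  have [a /andP[a0 ab] ad] := near_b d' d'0.
  have [Ia Za] := hb a (introT andP (conj a0 ab)).
  have [] := hd (t0 + a); first by rewrite opprD addrACA subrr add0r (lt_le_trans ad) // ge_min lexx.
  move=> _ hZ; have h1 := lip b a (Z (t0 + b)).
  have h2 := cnormD (Z (t0 + b) - Z (t0 + a)) (Z (t0 + a) - box_ctr (advance m v a)).
  rewrite addrA subrK in h2; rewrite cnormB in hZ.
  have h3 : `|b - a| * cnorm v <= e / 2.
    have ad' : `|a - b| <= e / 2 / (cnorm v + 1).
      by apply: le_trans (ltW ad) _; rewrite ge_min lexx orbT.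
    by rewrite distrC; apply: div_bound ad' => //; rewrite divr_ge0 // ltW.
  have Za' : cnorm (Z (t0 + a) - box_ctr (advance m v a)) <= box_rad m by [].
  exact (chain1 _ _ _ _ _ _ _ h1 h2 hZ Za' h3).
move=> b /andP[b0 bh] hb; have bh' : 0 <= b <= h by rewrite b0 ltW.
have [Ib Zb] := hb b (introT andP (conj b0 (lexx b))).
have inner := moore_zero_inner (mm b bh') Zb (cont_zero IZ Ib).
(* The zero is within 7/8 of the radius. Of the remaining eighth, one sixteenth is left to the
   motion of the zero and one to that of the centre. *)
pose e := box_rad m / 16; have e0 : 0 < e by apply: (divr_gt0 r0); rewrite ltr0n.
have [d d0 hd] := continuation_local Ib e0.
have v1 : 0 < cnorm v + 1 by lra.
exists (Num.min d (e / (cnorm v + 1))); first by rewrite lt_min d0 !divr_gt0.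
move=> a /andP[ba ab] ah; have ab' : `|a - b| < Num.min d (e / (cnorm v + 1)).
  by rewrite ger0_norm ?subr_ge0 // ltrBlDl.
have [|Ia hZ] := hd (t0 + a).
  by rewrite opprD addrACA subrr add0r (lt_le_trans ab') // ge_min lexx.
split; first exact: Ia.
have h1 := lip a b (Z (t0 + a)).
have h2 := cnormD (Z (t0 + a) - Z (t0 + b)) (Z (t0 + b) - box_ctr (advance m v b)).
rewrite addrA subrK in h2.
have h3 : `|a - b| * cnorm v <= e.
  have ad' : `|a - b| <= e / (cnorm v + 1).
    by apply: le_trans (ltW ab') _; rewrite ge_min lexx orbT.
  by apply: div_bound ad' => //; apply: ltW.
exact (chain2 _ _ _ _ _ _ h1 h2 hZ inner h3).
Qed.

Variables (Ar : interval_arith R) (cdF : circuit R n.+1 n n).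
Hypotheses (cdF_ok : circuit_ok Ar cdF) (cdFE : represents cdF (jacobian_x F)).

(** A neighbourhood of one time is enough, as this is applied at the supremum of the times of an
    infinite run. The inverse at [t0] serves as an approximate inverse nearby. *)
Lemma continuation_bounds (t0 : R) : I t0 -> exists d M, [/\ 0 < d, 1 <= M &
  forall t, `|t - t0| < d -> [/\ I t, `|t| <= M, cnorm (Z t) <= M,
    df t (Z t) \in unitmx & cnorm (invmx (df t (Z t))) <= M]].
Proof.
move=> It0; set N0 := invmx (df t0 (Z t0)).
have u0 : df t0 (Z t0) \in unitmx by rewrite unitmxE unitfE; apply: cont_regular IZ _ It0.
pose M1 := 1 + `|t0| + cnorm (Z t0).
have [a0 b0] := (normr_ge0 t0, cnorm_ge0 (Z t0)).
have M11 : 1 <= M1 by rewrite /M1; lra.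
have M21 : 1 <= M1 + 1 by lra.
have [L L1 hL] := at_point_lipschitz cdF_ok cdFE M21.
pose k : R := 2 * n%:R.
have k0 : 0 <= k by rewrite mulr_ge0.
(* [q * e] bounds [1%:M - N0 *m df t (Z t)] as an operator: two matrix products give two factors
   [k], and [L] is the Lipschitz constant of the differential. *)
pose q := k * k * cnorm N0 * L.
have q0 : 0 <= q by rewrite !mulr_ge0 ?cnorm_ge0 //; lra.
pose e := Num.min 1 (2 * (q + 1))^-1.
have e0 : 0 < e by rewrite lt_min ltr01 invr_gt0 mulr_gt0 //; lra.
have e1 : e <= 1 by rewrite ge_min lexx.
have qe : q * e <= 1 / 2.
  have : e <= (2 * (q + 1))^-1 by rewrite ge_min lexx orbT.
  have q1 : 0 < 2 * (q + 1) by lra.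
  move=> he; apply: (@le_trans _ _ ((q + 1) * (2 * (q + 1))^-1)); first by rewrite ler_pM //; lra.
  by rewrite invfM mulrCA divff ?mulr1 ?gt_eqF; lra.
have [d d0 hd] := continuation_local It0 e0.
exists (Num.min d e), (M1 + 1 + 2 * (k * cnorm N0)).
have kN : 0 <= k * cnorm N0 by rewrite mulr_ge0 ?cnorm_ge0.
split => [||t]; [by rewrite lt_min d0 | lra |].
rewrite lt_min => /andP[td te]; have [It Zt] := hd t td.
have tM : `|t| <= M1 + 1.
  by have := ler_normD (t - t0) t0; rewrite subrK; move: te; rewrite /M1; lra.
have ZM : cnorm (Z t) <= M1 + 1.
  by have := cnormD (Z t - Z t0) (Z t0); rewrite subrK; rewrite /M1; lra.
have t0M : `|t0| <= M1 + 1 by rewrite /M1; lra.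
have Z0M : cnorm (Z t0) <= M1 + 1 by rewrite /M1; lra.
have [_ hdf] := hL t t0 (Z t) (Z t0) e tM t0M ZM Z0M (ltW te) Zt.
have small (w : 'cV[R[i]]_n) : cnorm ((1%:M - N0 *m df t (Z t)) *m w) <= 1 / 2 * cnorm w.
  rewrite -(mulVmx u0) -/N0 -mulmxBr -mulmxA.
  apply: le_trans (cnorm_mulmx _ _) _; rewrite -/k.
  have h1 : cnorm ((df t0 (Z t0) - df t (Z t)) *m w) <= k * (L * e * cnorm w).
    rewrite cnormB in hdf; apply: le_trans (cnorm_mulmx _ _) _.
    exact: (ler_wpM2l k0 (ler_wpM2r (cnorm_ge0 w) hdf)).
  apply: (@le_trans _ _ (k * (cnorm N0 * (k * (L * e * cnorm w))))).
    by rewrite ler_wpM2l // ler_wpM2l ?cnorm_ge0.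
  rewrite (_ : k * _ = q * e * cnorm w); last by rewrite /q; ring.
  by rewrite ler_wpM2r ?cnorm_ge0.
have half : 1 / 2 < 1 :> R by lra.
have := unitmx_near_id half small; rewrite unitmx_mul => /andP[_ ut].
split => //; [lra | lra |].
apply: (@le_trans _ _ (2 * (k * cnorm N0))); last by rewrite /M1; lra.
apply: cnorm_mulmx_le => [|w]; first by lra.
have := expanding_near_id (small (invmx (df t (Z t)) *m w)).
rewrite mulmxA -[N0 *m _ *m _]mulmxA mulmxV // mulmx1 => h1.
have := cnorm_mulmx N0 w; rewrite -/k mulrA => h2.
exact: half_expanding_le h1 h2.
Qed.

End Continuation.

(** * Constants of the quasi-Newton iteration *)

Section RealInequalities.
Variable R : realType.
Implicit Types a b w N d r : R.

(** The width is tested against the norm of the residual box, itself known only up to that width;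
    relative to the exact step [b], 1/40 becomes 1/39. *)
Lemma newton_error_le W N b : W <= 1 / 40 * N -> N <= b + W -> W <= b / 39.
Proof. by lra. Qed.

Lemma newton_center_le a b W d e r : W <= b / 39 -> b <= d + e -> d <= 12 / 13 * r -> e <= 7 / 8 * r ->
  0 <= r -> a <= W + e -> a <= 12 / 13 * r.
Proof. by lra. Qed.

(** The constant is [7 / 8 + (15 / 8) / 39 = 12 / 13]: the exact contraction plus the error of a
    step of length at most [15 / 8 * d]. *)
Lemma newton_dist_le a b W e d : W <= b / 39 -> b <= (1 + 7 / 8) * d -> e <= 7 / 8 * d ->
  a <= W + e -> a <= 12 / 13 * d.
Proof. by lra. Qed.

Lemma shrink_le a r : 0 <= r -> a <= 12 / 13 * r -> a <= r.
Proof. by lra. Qed.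

(** Since [1 / 16 + 12 / 13 < 1], the zero of a certified box of at most half the radius still lies
    in the original box. *)
Lemma small_box_le a b s r w : 0 <= r -> s <= r / 2 -> a <= 1 / 8 * s -> b <= 12 / 13 * r -> w <= a + b -> w <= r.
Proof. by lra. Qed.

End RealInequalities.

(** * Invariants of the algorithm *)

Section Algorithm.
Variables (R : realType) (n : nat) (Ar : interval_arith R) (F : polymx R n.+1 n 1).
Variables (cF : circuit R n.+1 n 1) (cdF : circuit R n.+1 n n) (cFdot : circuit R n.+1 n 1).
Hypotheses (cF_ok : circuit_ok Ar cF) (cdF_ok : circuit_ok Ar cdF).
Hypothesis (cFdot_ok : circuit_ok Ar cFdot).
Hypotheses (cFE : represents cF F) (cdFE : represents cdF (jacobian_x F)).
Hypothesis (cFdotE : represents cFdot (derivative_t F)).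
Variables (zeta : 'cV[R[i]]_n) (I : set R) (Z : R -> 'cV[R[i]]_n).
Hypothesis IZ : continuation F zeta I Z.
Variables (R0 : R) (cap : bool).
Hypothesis R01 : 1 <= R0.
Notation f t := (at_point F t).
Notation df t := (at_point (jacobian_x F) t).
Notation mtest := (moore_test Ar cF cdF).

(** Enlarging stops at radius 1 and refine otherwise never increases a radius, so all radii stay
    below [R0], later taken as the maximum of 1 and the initial radius. *)
Definition tracked t (m : mbox R n) : Prop :=
  [/\ mbox_rep Ar m, moore_box_at F t (7 / 8) m, I t, in_mbox m (Z t) & box_rad m <= R0].

(** [rf_rad] and [rf_dist] identify the zero of a certified box. At the original radius it contains
    [Z t] by [rf_dist]; after a halving its zero lies in the original box, where zeros are unique.
    The bound 12/13 survives Newton steps and leaves room for the halved box. *)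
Record refining t (m m1 : mbox R n) : Prop := Refining {
  rf_tracked : tracked t m;
  rf_rep : mbox_rep Ar m1;
  rf_pos : 0 < box_rad m1;
  rf_rad : box_rad m1 = box_rad m \/ box_rad m1 <= box_rad m / 2;
  rf_center : cnorm (box_ctr m1 - box_ctr m) <= 12 / 13 * box_rad m;
  rf_dist : cnorm (box_ctr m1 - Z t) <= 7 / 8 * box_rad m }.

Record certified u t (m : mbox R n) : Prop := Certified {
  ct_rep : mbox_rep Ar m;
  ct_pos : 0 < box_rad m;
  ct_test : mtest u t m (1 / 8);
  ct_time : I t;
  ct_zero : in_mbox m (Z t);
  ct_rad : box_rad m <= R0 }.

Definition state_invariant (st : state R n) : Prop :=
  let t := time st in
  [/\ 0 < uprec st < 1, t \in rep Ar, 0 < stepsize st /\ stepsize st \in rep Ar,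
      0 <= t /\ (cap -> t <= 1) &
      match ctl st with
      | Track m => tracked t m
      | Refine m m1 | Raise m m1 | Tune m m1 | Invert m m1 => t < 1 /\ refining t m m1
      | Enlarge m | Predict m => t < 1 /\ certified (uprec st) t m
      | Return m => 1 <= t /\ tracked t m
      end].

Lemma tracked_pos t m : tracked t m -> 0 < box_rad m.
Proof. by case=> _ []. Qed.

Lemma refining_start t m : tracked t m -> refining t m m.
Proof.
move=> tm; have r0 := tracked_pos tm; have [mr mm It Zm Rm] := tm.
split => //; first by left.
  by rewrite subrr cnorm0; apply: mulr_ge0; [lra | exact: ltW].
by rewrite cnormB; exact: (moore_zero_inner mm Zm (cont_zero IZ It)).
Qed.

Lemma refining_in_mbox t m m1 : refining t m m1 -> in_mbox m (box_ctr m1).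
Proof. by move=> rf; apply: shrink_le (rf_center rf); apply/ltW/tracked_pos/(rf_tracked rf). Qed.

(** The steps use the matrix of the Moore box [m], whatever [U] has become, so they inherit its
    contraction. The last conclusion bounds the distance to the zero from below when a step is
    taken, which makes such steps finitely many while the radius stays away from 0. *)
Lemma refining_newton u t m m1 y' : 0 < u < 1 -> t \in rep Ar -> refining t m m1 ->
  let nb := newton_box Ar cF u t (box_mat m) (box_ctr m1) in
  let N := box_norm (newton_delta Ar cF u t (box_mat m) (box_ctr m1)) in
  box_width nb <= 1 / 40 * N -> is_mid Ar nb y' ->
  [/\ cnorm (y' - box_ctr m) <= 12 / 13 * box_rad m,
      cnorm (y' - Z t) <= 12 / 13 * cnorm (box_ctr m1 - Z t) &
      N <= 2 * cnorm (box_ctr m1 - Z t)].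
Proof.
move=> u01 tr rf nb N hw [y'r y'nb]; have ym := refining_in_mbox rf.
have [[xr rr Ar'] mm It Zm _] := rf_tracked rf.
have r0 := tracked_pos (rf_tracked rf).
have [yr _ _] := rf_rep rf; set y := box_ctr m1 in ym yr nb N hw y'nb *.
have fz := cont_zero IZ It.
(* [b] is the exact quasi-Newton step; any midpoint differs from [y - b] by at most the width of the
   box. *)
pose b := box_mat m *m f t y.
have enc := encl_newton_delta cF_ok cFE u01 tr Ar' yr.
have [dv db] := encl_valid enc.
have [nv ynb] := newton_box_incl cF_ok cFE u01 tr Ar' yr db.
have hNb : N <= cnorm b + box_width nb.
  apply: (box_norm_le dv) => d dd; have [_ yd] := newton_box_incl cF_ok cFE u01 tr Ar' yr dd.
  have := box_width_ge ynb yd; rewrite -/b opprB [y - b + _]addrC addrA subrK => h2.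
  have := cnormD b (d - b); rewrite [b + _]addrC subrK => h1.
  by apply: le_trans h1 _; rewrite lerD2l.
have hW := newton_error_le hw hNb.
have ye : cnorm (y' - (y - b)) <= box_width nb by apply: box_width_ge.
have c1 : cnorm (y - box_ctr m - b) <= 7 / 8 * box_rad m by exact: (moore_self_map mm ym).
have c2 : cnorm (y - Z t - b) <= 7 / 8 * cnorm (y - Z t).
  by have := moore_contraction mm Zm ym; rewrite fz subr0.
have c3 : cnorm b <= (1 + 7 / 8) * cnorm (y - Z t) by exact: (moore_residual_le mm Zm ym fz).
have c4 : cnorm b <= cnorm (y - box_ctr m) + cnorm (y - box_ctr m - b).
  have := cnormD (y - box_ctr m) (- (y - box_ctr m - b)).
  by rewrite cnormN opprB [y - _ + (_ - _)]addrC subrK.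
have tri (z : 'cV[R[i]]_n) : cnorm (y' - z) <= box_width nb + cnorm (y - z - b).
  apply: le_trans (_ : _ <= cnorm (y' - (y - b)) + cnorm (y - z - b)) _; last by rewrite lerD2r.
  apply: le_trans (cnormD _ _); rewrite le_eqVlt; apply/orP; left; apply/eqP; congr cnorm.
  by rewrite [y - z - b]addrAC addrA subrK.
split.
- exact: newton_center_le hW c4 (rf_center rf) c1 (ltW r0) (tri _).
- exact: newton_dist_le hW c3 c2 (tri _).
apply: le_trans hNb _; apply: le_trans (_ : _ <= cnorm b + cnorm b / 39) _; first by rewrite lerD2l.
have := cnorm_ge0 (y - Z t); move: c3; move: (cnorm b) (cnorm _) => p q; lra.
Qed.

Lemma certified_zero u t m m1 : 0 < u < 1 -> t \in rep Ar -> refining t m m1 ->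
  mtest u t m1 (1 / 8) -> in_mbox m1 (Z t).
Proof.
move=> u01 tr rf test; have [mr mm It Zm _] := rf_tracked rf.
have r0 := tracked_pos (rf_tracked rf).
have mm1 := moore_test_sound cF_ok cdF_ok cFE cdFE u01 tr (rf_rep rf) (rf_pos rf) test.
case: (rf_rad rf) => rs.
  rewrite /in_mbox cnormB rs; apply: le_trans (rf_dist rf) _.
  by rewrite ler_piMl //; [apply: ltW | lra].
have lt1 : 1 / 8 < 1 :> R by lra.
have [z zm1 fz] := moore_exists mm1 lt1.
have zin := moore_zero_inner mm1 zm1 fz.
have zm : in_mbox m z.
  apply: small_box_le (ltW r0) rs zin (rf_center rf) _.
  by have := cnormD (z - box_ctr m1) (box_ctr m1 - box_ctr m); rewrite addrA subrK.
have lt2 : 7 / 8 < 1 :> R by lra.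
by rewrite (moore_unique mm lt2 Zm zm (cont_zero IZ It) fz).
Qed.

Lemma certified_tracked u t m : 0 < u < 1 -> t \in rep Ar -> certified u t m -> tracked t m.
Proof.
move=> u01 tr [mr r0 test It Zt mR].
have [_ h] := moore_test_sound cF_ok cdF_ok cFE cdFE u01 tr mr r0 test.
split => //; split => // w v w1 v1; apply: le_trans (h w v w1 v1) _; lra.
Qed.

Lemma next_stepsize_props t h : t \in rep Ar -> h \in rep Ar -> 0 < h -> t < 1 ->
  let h1 := next_stepsize cap t h in
  [/\ 0 < h1, h1 \in rep Ar, (cap -> t + h1 <= 1) & h1 <= 5 / 4 * h].
Proof.
move=> tr hr h0 t1; rewrite /next_stepsize.
have r54 : 5 / 4 * h \in rep Ar.
  (* Only operations under which [rep] is closed: a multiplication by 5 and two halvings. *)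
  have -> : 5 / 4 * h = (5 * h) / 2 / 2 by lra.
  by rewrite !rep_div2 // repM // rep_nat.
have p54 : 0 < 5 / 4 * h by lra.
case: cap => //=; split => //.
- by rewrite lt_min p54 subr_gt0.
- by rewrite /Num.min; case: ifP => _ //; rewrite repB // rep1.
- by move=> _; rewrite -lerBrDl ge_min lexx orbT.
- by rewrite ge_min lexx.
Qed.

Lemma mxrep_advance m (v : 'cV[R[i]]_n) h : mbox_rep Ar m -> mxrep Ar v -> h \in rep Ar ->
  mbox_rep Ar (advance m v h).
Proof.
move=> [xr rr Ar'] vr hr; split => // i j; rewrite /advance /crep /= !mxE cReD cImD cReZ cImZ.
have /andP[x1 x2] := xr i j; have /andP[v1 v2] := vr i j.
by rewrite !repD ?repM.
Qed.

(** The continuation is followed through all the translated boxes between [t] and [t + h']; the last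
    one alone would not identify its zero as [Z (t + h')]. *)
Lemma tracked_advance u u' t h h' m v : 0 < u < 1 -> 0 < u' < 1 -> t \in rep Ar ->
  h \in rep Ar -> h' \in rep Ar -> 0 < h' <= h -> certified u t m ->
  is_mid Ar (tangent_box Ar cFdot u t m) v ->
  model_test Ar u' (predictor_model Ar cF cdF u t h m v) h' ->
  tracked (t + h') (advance m v h').
Proof.
move=> u01 u01' tr hr h'r /andP[h'0 h'h] ct [vr _] test.
have pos e : 0 <= e <= h' -> moore_box_at F (t + e) (7 / 8) (advance m v e).
  by move=> e01; apply: (predictor_sound cF_ok cdF_ok cFE cdFE u01 u01' tr hr h'r) test => //;
    case: ct.
have [] := continuation_in_boxes IZ (ltW h'0) pos (ct_time ct) (ct_zero ct) (e := h').
  by rewrite lexx ltW.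
move=> Ith Zth; split => //; last by case: ct.
  by apply: mxrep_advance => //; case: ct.
by apply: pos; rewrite lexx ltW.
Qed.

Notation step := (step Ar cF cdF cFdot cap).

Lemma step_invariant st st' : step st st' -> state_invariant st -> state_invariant st'.
Proof.
case=> {st st'} [t h u m t1|t h u m t1|t h u m m1 test|t h u m y s U test hd hs
  |t h u m y s U test hd hs|t h u m y s U test hd hw|t h u m y s U y' test hd hw mid
  |t h u u' m m1 uu|t h u u' m m1 uu|t h u m y s U U' Ur|t h u y s U s1 test
  |t h u y s U hs|t h u m v h1 mid test|t h u m v h1 h2 u2 mid test test2
  |t h u m v h1 h2 u2 mid test test2] [] /= u01 tr [h0 hr] [t0 tcap] hctl.
- by split.
- by split => //; split => //; apply: refining_start.
- case: hctl => t1 rf; split => //; split => //; split => //.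
  + by case: rf.
  + exact: rf_pos rf.
  + by case: (rf_tracked rf).
  + exact: certified_zero u01 tr rf test.
  + have [_ _ _ _ mR] := rf_tracked rf; have r0 := tracked_pos (rf_tracked rf).
    by case: (rf_rad rf) => [->//|]; move: mR r0; lra.
- case: hctl => t1 [tm [yr sr Ur] /= s0 hr' hc hz]; split => //; split => //; split => //=.
  + by split => //=; apply: rep_div2.
  + by rewrite divr_gt0.
  + by right; case: hr' => [->//|]; move: s0; lra.
- case: hctl => t1 [tm [yr sr Ur] /= s0 hr' hc hz]; split => //; split => //; split => //=.
  + by split => //=; apply: rep_div2.
  + by rewrite divr_gt0.
  + by right; case: hr' => [->//|]; move: s0; lra.
- by [].
- case: hctl => t1 rf; split => //; split => //.
  have [c1 c2 _] := refining_newton u01 tr rf hw mid.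
  case: rf c2 => tm [yr sr Ur] /= s0 hr' hc hz c2; split => //=.
    by split => //=; case: mid.
  have r0 := tracked_pos tm.
  by apply: le_trans c2 _; move: hz (cnorm_ge0 (y - Z t)); move: (cnorm _) => q; lra.
- by split => //; case/andP: uu u01 => u'0 u'u /andP[_ u1]; rewrite u'0 (lt_trans u'u u1).
- by split => //; case/andP: uu u01 => u'0 u'u /andP[_ u1]; rewrite u'0 (le_lt_trans u'u u1).
- case: hctl => t1 [tm [yr sr Ur'] /= s0 hr' hc hz]; split => //.
- case: hctl => t1 [[yr sr Ur] s0 tst It Zt sR].
  rewrite /in_mbox /= in s0 Zt sR.
  split; [exact: u01 | exact: tr | by split | by split | split; first exact: t1].
  split; [split=> /= | by rewrite mulr_gt0 | exact: test | exact: It | | exact: le_trans s1 R01].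
  + exact: yr.
  + by rewrite repM // rep_nat.
  + exact: Ur.
  + by apply: (le_trans Zt); rewrite ler_peMl ?ler1n // ltW.
- by case: hctl => t1 ct; split.
- case: hctl => t1 ct; have [h10 h1r h1c _] := next_stepsize_props tr hr h0 t1.
  split => //=.
  + by rewrite repD.
  + by split => //; rewrite addr_ge0 // ltW.
  + by apply: tracked_advance ct mid test => //; rewrite h10 lexx.
- case: hctl => t1 ct; have [h10 h1r h1c _] := next_stepsize_props tr hr h0 t1.
  have h20 : 0 < h2 by rewrite divr_gt0.
  have h21 : h2 <= h1 by rewrite /h2 ler_pdivrMr // ler_peMr ?ler1n // ltW.
  have h2r : h2 \in rep Ar by apply: rep_div2.
  have u201 : 0 < u2 < 1.
    by case/andP: u01 => u0 u1; rewrite lt_min u0 h20 gt_min u1.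
  split => //=.
  + by rewrite repD.
  + split=> [|/h1c]; first by rewrite addr_ge0 // ltW.
    by apply: le_trans; rewrite lerD2l.
  + by apply: tracked_advance ct mid test2 => //; rewrite h20 h21.
- case: hctl => t1 ct; have [h10 h1r h1c _] := next_stepsize_props tr hr h0 t1.
  have h20 : 0 < h2 by rewrite divr_gt0.
  have h2r : h2 \in rep Ar by apply: rep_div2.
  have u201 : 0 < u2 < 1.
    by case/andP: u01 => u0 u1; rewrite lt_min u0 h20 gt_min u1.
  by split => //=; apply: certified_tracked u01 tr ct.
Qed.

End Algorithm.

Section Decay.
Variable R : realType.

(** Each contraction from a value at least [c] loses at least [(1 - theta) * c]; once the sequence
    is closer than that to its infimum, none can occur. This limits halvings, Newton steps and
    rejected steps. *)
Lemma decay_finite (a : nat -> R) (theta c : R) : (forall j, 0 <= a j) ->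
  (forall j, a j.+1 <= a j) -> theta < 1 -> 0 < c ->
  exists N, forall j, (N <= j)%N -> c <= a j -> theta * a j < a j.+1.
Proof.
move=> a0 dec th c0.
have mono i j : (i <= j)%N -> a j <= a i.
  by move=> /subnKC <-; elim: (j - i)%N => [|k IH]; rewrite ?addn0 // addnS (le_trans (dec _)).
pose S := [set a j | j in [set: nat]].
have Si : has_inf S by split; [exists (a 0%N), 0%N | exists 0 => _ [j _ <-]].
have g0 : 0 < (1 - theta) * c by rewrite mulr_gt0 // subr_gt0.
have [_ [N _ <-] hN] := inf_adherent g0 Si.
exists N => j Nj cj; rewrite ltNge; apply/negP => h.
have h1 : inf S <= a j.+1 by apply: ge_inf; [case: Si | exists j.+1].
have h2 := mono _ _ Nj.
have h3 : (1 - theta) * c <= (1 - theta) * a j by rewrite ler_wpM2l // subr_ge0 ltW.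
by move: h3; rewrite [X in _ <= X]mulrBl mul1r; lra.
Qed.

Lemma exists_small (q b : R) : 0 <= q -> 0 < b -> exists2 e, 0 < e <= 1 & q * e <= b.
Proof.
move=> q0 b0; have q1 : 0 < q + 1 by lra.
exists (Num.min 1 (b / (q + 1))).
  by rewrite lt_min ltr01 divr_gt0 // ge_min lexx.
apply: (@le_trans _ _ (q * (b / (q + 1)))).
  by rewrite ler_wpM2l // ge_min lexx orbT.
by rewrite mulrA ler_pdivrMr // mulrC ler_wpM2l ?ltW //; lra.
Qed.

(** The hypotheses give [nf <= s / 32], so the exact residual is at most [4 / 64 * s]; rounding adds
    [1 / 64 * s]. *)
Lemma residual_bound (ne nf d s c w : R) : ne <= 1 -> 0 <= nf -> 1 / 8 * nf <= d ->
  d <= 1 / 64 * (1 / 8) * (2 * s) -> w <= 1 / 64 * s -> c <= nf + ne * nf -> c + w <= 5 / 64 * s.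
Proof.
move=> h1 nf0 h2 h3 h4 h5; have : ne * nf <= nf by rewrite ler_piMl.
by lra.
Qed.

Lemma five_bounds : 0 <= (5 / 64 : R) <= 1.
Proof. by apply/andP; split; lra. Qed.

Lemma seven_eighths : 7 / 8 < 1 :> R.
Proof. by lra. Qed.

Lemma le_one128 (x : R) : x <= 1 / 128 -> x <= 1 / 64 /\ x <= 1.
Proof. by split; lra. Qed.

Lemma five_le (a x y z : R) : a = x + y + z -> x <= 1 / 128 -> y <= 1 / 128 -> z <= 1 / 128 ->
  5 / 64 + a <= 1 / 8.
Proof. by lra. Qed.

End Decay.

(** * Termination of refine *)

Section RefinePhase.
Variables (R : realType) (n : nat) (Ar : interval_arith R) (F : polymx R n.+1 n 1).
Variables (cF : circuit R n.+1 n 1) (cdF : circuit R n.+1 n n) (cFdot : circuit R n.+1 n 1).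
Hypotheses (cF_ok : circuit_ok Ar cF) (cdF_ok : circuit_ok Ar cdF).
Hypotheses (cFE : represents cF F) (cdFE : represents cdF (jacobian_x F)).
Variables (zeta : 'cV[R[i]]_n) (I : set R) (Z : R -> 'cV[R[i]]_n).
Hypothesis IZ : continuation F zeta I Z.
Variables (R0 : R) (cap : bool).
Notation f t := (at_point F t).
Notation df t := (at_point (jacobian_x F) t).
Notation mtest := (moore_test Ar cF cdF).
Notation step := (step Ar cF cdF cFdot cap).
Notation refining := (refining Ar F I Z R0).
Notation state_invariant := (state_invariant Ar F cF cdF I Z R0 cap).
Notation delta := (newton_delta Ar cF).

Definition refine_pair (c : control R n) : option (mbox R n * mbox R n) :=
  match c with
  | Refine m m1 | Raise m m1 | Tune m m1 | Invert m m1 => Some (m, m1)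
  | _ => None
  end.

Definition halved (m : mbox R n) := MBox (box_ctr m) (box_rad m / 2) (box_mat m).
Definition recentered (m : mbox R n) y := MBox y (box_rad m) (box_mat m).

Lemma step_from_refine st st' m m1 : step st st' -> ctl st = Refine m m1 ->
  refine_pair (ctl st') <> None ->
  let N := box_norm (delta (uprec st) (time st) (box_mat m) (box_ctr m1)) in
  let W := box_width (newton_box Ar cF (uprec st) (time st) (box_mat m) (box_ctr m1)) in
  ~~ mtest (uprec st) (time st) m1 (1 / 8) /\
  [\/ ctl st' = Invert m (halved m1) /\ 1 / 16 * (1 / 8) * box_rad m <= box_rad m1 / 2,
      ctl st' = Tune m (halved m1) /\ N <= 1 / 64 * (1 / 8) * box_rad m1,
      ctl st' = Raise m m1 /\ 1 / 64 * (1 / 8) * box_rad m1 < N /\ 1 / 40 * N < W |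
      exists y', [/\ ctl st' = Invert m (recentered m1 y'), 1 / 64 * (1 / 8) * box_rad m1 < N,
         W <= 1 / 40 * N & is_mid Ar (newton_box Ar cF (uprec st) (time st) (box_mat m) (box_ctr m1)) y']].
Proof.
case=> {st st'} [t h u m' t1|t h u m' t1|t h u m' m1' test|t h u m' y s U test hd hs
  |t h u m' y s U test hd hs|t h u m' y s U test hd hw|t h u m' y s U y' test hd hw mid
  |t h u u' m' m1' uu|t h u u' m' m1' uu|t h u m' y s U U' Ur|t h u y s U s1 test
  |t h u y s U hs|t h u m' v h1 mid test|t h u m' v h1 h2 u2 mid test test2
  |t h u m' v h1 h2 u2 mid test test2]; try discriminate; move=> [<- <-] some N W.
- by case: some.
- by split; [exact: test | constructor 1; split; [|exact: hs]].
- by split; [exact: test | constructor 2; split; [|exact: hd]].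
- by split; [exact: test | constructor 3; split; [|split; [exact: hd | exact: hw]]].
- by split; [exact: test | constructor 4; exists y'; split; [|exact: hd|exact: hw|exact: mid]].
Qed.

Lemma step_from_raise st st' m m1 : step st st' -> ctl st = Raise m m1 -> ctl st' = Invert m m1.
Proof. by case=> {st st'}; try discriminate; move=> t' h u u' m' m1' _ [-> ->]. Qed.

Lemma step_from_tune st st' m m1 : step st st' -> ctl st = Tune m m1 -> ctl st' = Invert m m1.
Proof. by case=> {st st'}; try discriminate; move=> t' h u u' m' m1' _ [-> ->]. Qed.

Lemma step_from_invert st st' m m1 : step st st' -> ctl st = Invert m m1 ->
  uprec st' = uprec st /\ exists2 U, mxrep Ar U &
    ctl st' = Refine m (MBox (box_ctr m1) (box_rad m1) U).
Proof.
case=> {st st'}; try discriminate.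
by move=> t h u m' y s U U' Ur [-> <-]; split; [|exists U'].
Qed.

Lemma step_uprec st st' : step st st' -> uprec st' <= uprec st.
Proof.
case=> {st st'}; try by move=> *; exact: lexx.
- by move=> t' h u u' m' m1' /andP[_ /ltW].
- by move=> t' h u u' m' m1' /andP[].
- by move=> t' h u m' v h1 h2 u2 *; rewrite /uprec ge_min lexx.
- by move=> t' h u m' v h1 h2 u2 *; rewrite /uprec ge_min lexx.
Qed.

Variables (Y : nat -> state R n) (t : R) (m : mbox R n).
Hypothesis Ystep : forall j, step (Y j) (Y j.+1).
Hypothesis Yinv : forall j, state_invariant (Y j).
Hypothesis Ytime : forall j, time (Y j) = t.
Variable b : nat -> mbox R n.
Hypothesis Ypair : forall j, refine_pair (ctl (Y j)) = Some (m, b j).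
Hypothesis Ystart : b 0%N = m.
Hypothesis Yraise : (forall N, exists2 k, (N <= k)%N & exists m m1, ctl (Y k) = Raise m m1) ->
  forall e : R, 0 < e -> exists N, forall k, (N <= k)%N -> uprec (Y k) <= e.
Hypothesis Ytune : forall e : R, 0 < e -> exists2 d : R, 0 < d & forall k m m1,
  ctl (Y k) = Tune m m1 -> box_rad m1 < d -> uprec (Y k.+1) <= e * box_rad m1.
Hypothesis Yinvert : forall e : R, 0 < e -> exists2 d : R, 0 < d & forall k m m1 m2,
  ctl (Y k) = Invert m m1 -> ctl (Y k.+1) = Refine m m2 -> uprec (Y k) < d ->
  cnorm (box_mat m2 - invmx (df (time (Y k)) (box_ctr m2))) < e.

Let Yrefining j : refining t m (b j).
Proof.
have [_ _ _ _] := Yinv j; rewrite Ytime; have := Ypair j.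
by case: (ctl (Y j)) => //= m' m1 [-> ->] [].
Qed.

Let Yu j : 0 < uprec (Y j) < 1. Proof. by case: (Yinv j). Qed.
Let trep : t \in rep Ar. Proof. by have [_ + _ _ _] := Yinv 0; rewrite Ytime. Qed.
Let mtr : tracked Ar F I Z R0 t m. Proof. exact: rf_tracked (Yrefining 0). Qed.
Let r0 : 0 < box_rad m. Proof. exact: tracked_pos mtr. Qed.

Let Ysome j : refine_pair (ctl (Y j)) <> None. Proof. by rewrite Ypair. Qed.

Let pair_eq j m' m1 : refine_pair (ctl (Y j)) = Some (m', m1) -> m' = m /\ m1 = b j.
Proof. by rewrite Ypair => -[-> ->]. Qed.

Let Yctl j : [\/ ctl (Y j) = Refine m (b j), ctl (Y j) = Raise m (b j),
  ctl (Y j) = Tune m (b j) | ctl (Y j) = Invert m (b j)].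
Proof.
have := Ypair j; case: (ctl (Y j)) => //= m' m1 [-> ->].
- by constructor 1.
- by constructor 2.
- by constructor 3.
- by constructor 4.
Qed.

Let Yrad j : box_rad (b j.+1) <= box_rad (b j).
Proof.
have p := rf_pos (Yrefining j).
case: (Yctl j) => E.
- have [_ []] := step_from_refine (Ystep j) E (@Ysome j.+1).
  + by case=> /(congr1 refine_pair)/pair_eq[_ <-] _ /=; lra.
  + by case=> /(congr1 refine_pair)/pair_eq[_ <-] _ /=; lra.
  + by case=> /(congr1 refine_pair)/pair_eq[_ <-].
  + by case=> y' [/(congr1 refine_pair)/pair_eq[_ <-]].
- by have /(congr1 refine_pair)/pair_eq[_ <-] := step_from_raise (Ystep j) E.
- by have /(congr1 refine_pair)/pair_eq[_ <-] := step_from_tune (Ystep j) E.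
- by have [_ [U _ /(congr1 refine_pair)/pair_eq[_ <-]]] := step_from_invert (Ystep j) E.
Qed.

Let Ydist j : cnorm (box_ctr (b j.+1) - Z t) <= cnorm (box_ctr (b j) - Z t).
Proof.
case: (Yctl j) => E.
- have [_ []] := step_from_refine (Ystep j) E (@Ysome j.+1).
  + by case=> /(congr1 refine_pair)/pair_eq[_ <-].
  + by case=> /(congr1 refine_pair)/pair_eq[_ <-].
  + by case=> /(congr1 refine_pair)/pair_eq[_ <-].
  + case=> y' [/(congr1 refine_pair)/pair_eq[_ <-] _]; rewrite Ytime => hw mid.
    have [_ c _] := refining_newton cF_ok cFE IZ (Yu j) trep (Yrefining j) hw mid.
    by apply: shrink_le c; apply: cnorm_ge0.
- by have /(congr1 refine_pair)/pair_eq[_ <-] := step_from_raise (Ystep j) E.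
- by have /(congr1 refine_pair)/pair_eq[_ <-] := step_from_tune (Ystep j) E.
- by have [_ [U _ /(congr1 refine_pair)/pair_eq[_ <-]]] := step_from_invert (Ystep j) E.
Qed.

Let visits_refine N : exists2 j, (N <= j)%N & ctl (Y j) = Refine m (b j).
Proof.
have from_invert j : (N <= j)%N -> (exists m1, ctl (Y j) = Invert m m1) ->
    exists2 j, (N <= j)%N & ctl (Y j) = Refine m (b j).
  move=> Nj [m1 E]; have [_ [U _ E']] := step_from_invert (Ystep j) E.
  exists j.+1; first exact: leqW.
  by rewrite E'; have /pair_eq[_ <-] := congr1 refine_pair E'.
case: (Yctl N) => E.
- by exists N.
- by apply: (from_invert N.+1) => //; exists (b N); apply: step_from_raise E.
- by apply: (from_invert N.+1) => //; exists (b N); apply: step_from_tune E.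
- by apply: (from_invert N) => //; exists (b N).
Qed.

(** If the radii stayed above [d], then by [decay_finite], applied to the radius and to the distance
    to the zero, halvings and Newton steps would come to an end. Only demands for precision would
    remain, [u] would tend to 0, and the width of the Newton box would fall below what such a demand
    supposes. *)
Lemma radius_vanishes (d : R) : 0 < d -> exists j, box_rad (b j) < d.
Proof.
move=> d0; apply: contrapT => hn.
have sd j : d <= box_rad (b j) by rewrite leNgt; apply/negP => ?; apply: hn; exists j.
have half1 : 1 / 2 < 1 :> R by lra.
have t1 : 12 / 13 < 1 :> R by lra.
have [N1 hN1] := decay_finite (fun j => ltW (rf_pos (Yrefining j))) Yrad half1 d0.
(* [d / 512] is [1 / 64 * (1 / 8) * d], the threshold on the residual at radius [d]; half of it
   bounds the distance to the zero by [refining_newton]. In [d2], the 64 need only exceed 40. *)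
have d1 : 0 < d / 512 / 2 by apply: divr_gt0; [apply: (divr_gt0 d0)|]; rewrite ltr0n.
have d2 : 0 < d / 512 / 64 by apply: divr_gt0; [apply: (divr_gt0 d0)|]; rewrite ltr0n.
have [N2 hN2] := decay_finite (fun j => cnorm_ge0 (box_ctr (b j) - Z t)) Ydist t1 d1.
have only_raise j : (maxn N1 N2 <= j)%N -> ctl (Y j) = Refine m (b j) ->
    ctl (Y j.+1) = Raise m (b j) /\
    let N := box_norm (delta (uprec (Y j)) t (box_mat m) (box_ctr (b j))) in
    d / 512 < N /\ 1 / 40 * N < box_width (newton_box Ar cF (uprec (Y j)) t (box_mat m) (box_ctr (b j))).
  rewrite geq_max => /andP[j1 j2] E.
  have e1 := hN1 j j1 (sd j); have sdj := sd j.
  have [_ []] := step_from_refine (Ystep j) E (@Ysome j.+1).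
  - case=> /(congr1 refine_pair)/pair_eq[_ bE] _; move: e1; rewrite -bE /=.
    by rewrite ltNge; move: sdj; lra.
  - case=> /(congr1 refine_pair)/pair_eq[_ bE] _; move: e1; rewrite -bE /=.
    by rewrite ltNge; move: sdj; lra.
  - rewrite Ytime => -[E' [h1 h2]]; split => //; split => //.
    by apply: le_lt_trans h1; move: sdj; lra.
  - case=> y' [/(congr1 refine_pair)/pair_eq[_ bE]]; rewrite Ytime => h1 hw mid.
    have [_ c hd] := refining_newton cF_ok cFE IZ (Yu j) trep (Yrefining j) hw mid.
    have : d / 512 / 2 <= cnorm (box_ctr (b j) - Z t).
      have : d / 512 <= 2 * cnorm (box_ctr (b j) - Z t).
        apply: le_trans hd; apply: ltW; apply: le_lt_trans h1; move: sdj; lra.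
      by move: (cnorm _) => q; lra.
    by move=> /(hN2 j j2); rewrite -bE /= ltNge c.
have raises N : exists2 k, (N <= k)%N & exists m m1, ctl (Y k) = Raise m m1.
  have [j Nj E] := visits_refine (maxn N (maxn N1 N2)).
  move: Nj; rewrite geq_max => /andP[Nj Nj']; have [E' _] := only_raise j Nj' E.
  by exists j.+1; [exact: leqW | exists m, (b j)].
pose M := 1 + `|t| + cnorm (box_mat m) + cnorm (box_ctr m) + box_rad m.
have [p1 p2 p3] := And3 (normr_ge0 t) (cnorm_ge0 (box_mat m)) (cnorm_ge0 (box_ctr m)).
have M1 : 1 <= M by rewrite /M; move: r0; lra.
have [C C0 hC] := newton_box_width cF_ok cFE M1.
have [e /andP[e0 _] Ce] := exists_small C0 d2.
have [N3 hN3] := Yraise raises e0.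
have [j Nj E] := visits_refine (maxn N3 (maxn N1 N2)).
move: Nj; rewrite geq_max => /andP[Nj Nj']; have [_ [h1 h2]] := only_raise j Nj' E.
have [[xr rr Arep] _ _ _ _] := mtr; have [yr _ _] := rf_rep (Yrefining j).
have tM : `|t| <= M by rewrite /M; move: r0; lra.
have AM : cnorm (box_mat m) <= M by rewrite /M; move: r0; lra.
have yM : cnorm (box_ctr (b j)) <= M.
  have h3 := refining_in_mbox (Yrefining j); rewrite /in_mbox in h3.
  have := cnormD (box_ctr (b j) - box_ctr m) (box_ctr m); rewrite subrK.
  by move: h3; move: (cnorm _) (cnorm (_ - _)) => q q'; rewrite /M; lra.
have hW := hC _ t (box_mat m) (box_ctr (b j)) (Yu j) trep Arep yr tM AM yM.
have h4 : C * uprec (Y j) <= C * e by rewrite ler_wpM2l // hN3.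
by move: h1 h2 hW h4 Ce d0; set N := box_norm _; set W := box_width _; lra.
Qed.

(** The first radius below [d] is reached by a halving that passes through [Tune], and that same
    branch comes with a residual small relative to the radius. Both facts are needed at one
    moment. *)
Lemma tuned_state (d : R) : d <= box_rad m -> d <= 1 / 16 * (1 / 8) * box_rad m ->
  forall j, box_rad (b j) < d -> exists k, [/\ ctl (Y k) = Refine m (b k),
    ctl (Y k.+1) = Tune m (halved (b k)), box_rad (b k) / 2 < d &
    box_norm (delta (uprec (Y k)) t (box_mat m) (box_ctr (b k))) <= 1 / 64 * (1 / 8) * box_rad (b k)].
Proof.
move=> d1 d2; elim=> [|j IH]; first by rewrite Ystart ltNge d1.
have [/IH //|jd] := ltP (box_rad (b j)) d => jd'.
case: (Yctl j) => E.
- have [_ []] := step_from_refine (Ystep j) E (@Ysome j.+1).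
  + case=> /(congr1 refine_pair)/pair_eq[_ bE] h; move: jd'; rewrite -bE /= ltNge.
    by rewrite (le_trans d2).
  + rewrite Ytime => -[E' h]; have /pair_eq[_ bE] := congr1 refine_pair E'.
    by exists j; split => //; move: jd'; rewrite -bE.
  + by case=> /(congr1 refine_pair)/pair_eq[_ bE] _; move: jd'; rewrite -bE ltNge jd.
  + by case=> y' [/(congr1 refine_pair)/pair_eq[_ bE]] _ _ _; move: jd'; rewrite -bE /= ltNge jd.
- by have /(congr1 refine_pair)/pair_eq[_ bE] := step_from_raise (Ystep j) E; move: jd'; rewrite -bE ltNge jd.
- by have /(congr1 refine_pair)/pair_eq[_ bE] := step_from_tune (Ystep j) E; move: jd'; rewrite -bE ltNge jd.
- have [_ [U _ /(congr1 refine_pair)/pair_eq[_ bE]]] := step_from_invert (Ystep j) E.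
  by move: jd'; rewrite -bE /= ltNge jd.
Qed.

(** The Moore condition makes [A *m df t y] shrink no vector by more than the factor [1 / 8], so [A]
    controls the inverse of the differential and the true Newton step. *)
Let inverse_bound y : in_mbox m y -> let N := invmx (df t y) in
  cnorm N <= 8 * (2 * n%:R * cnorm (box_mat m)) /\
  1 / 8 * cnorm (N *m f t y) <= cnorm (box_mat m *m f t y).
Proof.
move=> ym N; have [_ mm _ _ _] := mtr; have lt1 := seven_eighths R.
have du := moore_df_unit mm lt1 ym.
have key (w : 'cV[R[i]]_n) : 1 / 8 * cnorm (N *m w) <= cnorm (box_mat m *m w).
  have := expanding_near_id (moore_deriv mm (N *m w) ym).
  rewrite mulmxA -(mulmxA (box_mat m)) mulmxV // mulmx1.
  by rewrite (_ : 1 - 7 / 8 = 1 / 8) //; lra.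
split; last exact: key.
have A0 : 0 <= 2 * n%:R * cnorm (box_mat m) by rewrite !mulr_ge0 ?cnorm_ge0.
apply: cnorm_mulmx_le => [|w]; first by rewrite mulr_ge0.
have := key w; have := cnorm_mulmx (box_mat m) w; rewrite mulrA.
by move: (cnorm (N *m w)) (cnorm (_ *m w)) (_ * cnorm (box_mat m)) (cnorm w) => p q a c; lra.
Qed.

(** The halving given by [tuned_state] is followed by [Tune], [Invert] and [Refine]. By then
    [u <= e * s], [U] is within [e] of the inverse and the residual is small relative to [s], so the
    test passes and the run would leave the loop. *)
Lemma refine_phase_ends : False.
Proof.
have [[xr rr Arep] mm _ _ _] := mtr.
have p1 := normr_ge0 t; have p2 := cnorm_ge0 (box_mat m); have p3 := cnorm_ge0 (box_ctr m).
pose k0 : R := 2 * n%:R; have k00 : 0 <= k0 by rewrite mulr_ge0.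
pose NM := 8 * (k0 * cnorm (box_mat m)).
have NM0 : 0 <= NM by rewrite !mulr_ge0.
pose M := 2 + `|t| + (cnorm (box_ctr m) + box_rad m) + NM.
have M1 : 1 <= M by rewrite /M; move: r0; lra.
have tM : `|t| <= M by rewrite /M; move: r0; lra.
have xM : cnorm (box_ctr m) + box_rad m <= M by rewrite /M; lra.
have NMM : NM + 1 <= M by rewrite /M; move: r0; lra.
have [L L1 hL] := at_point_lipschitz cdF_ok cdFE M1.
have [C1 C11 hC1] := newton_delta_near cF_ok cFE M1.
have [C2 C20 hC2] := moore_test_passes cF_ok cdF_ok cFE cdFE M1.
pose K1 := k0 * L; have K10 : 0 <= K1 by rewrite mulr_ge0 //; lra.
have C10 : 0 <= C1 by lra.
(* [Q] dominates every coefficient of [e] below, so one choice of [e] makes all these products at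
   most [1 / 128]. *)
pose Q := k0 * K1 + C1 + C2 * K1 + C2 + K1.
have [q1 q2] : 0 <= k0 * K1 /\ 0 <= C2 * K1 by split; apply: mulr_ge0.
have Q0 : 0 <= Q by rewrite /Q; lra.
have i128 : 0 < 1 / 128 :> R by lra.
have [e /andP[e0 e1] Qe] := exists_small Q0 i128.
have small a : a <= Q -> a * e <= 1 / 128.
  by move=> aQ; apply: le_trans Qe; rewrite ler_wpM2r // ltW.
have s1 : k0 * K1 * e <= 1 / 128 by apply: small; rewrite /Q; lra.
have s2 : C1 * e <= 1 / 128 by apply: small; rewrite /Q; lra.
have s3 : C2 * K1 * e <= 1 / 128 by apply: small; rewrite /Q; lra.
have s4 : C2 * e <= 1 / 128 by apply: small; rewrite /Q; lra.
have s5 : K1 * e <= 1 / 128 by apply: small; rewrite /Q; lra.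
have [dt dt0 hdt] := Ytune e0; have [di di0 hdi] := Yinvert e0.
(* [d] must not exceed the initial radius, the threshold for [Tune], the ranges [dt] and [di] of the
   two conventions, and [e]. *)
pose d := Num.min (Num.min (box_rad m) (1 / 16 * (1 / 8) * box_rad m)) (Num.min (Num.min dt di) e).
have d0 : 0 < d by rewrite !lt_min r0 dt0 di0 e0 !mulr_gt0 //; lra.
have [d1 d2] : d <= box_rad m /\ d <= 1 / 16 * (1 / 8) * box_rad m.
  by rewrite /d !ge_min !lexx /= ?orbT.
have [d3 d4 d5] : [/\ d <= dt, d <= di & d <= e] by rewrite /d !ge_min !lexx /= ?orbT.
have [j jd] := radius_vanishes d0.
have [k [E0 E1 sd hdelta]] := tuned_state d1 d2 jd.
set y := box_ctr (b k) in hdelta *; pose s := box_rad (b k) / 2.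
have s0 : 0 < s by rewrite divr_gt0 // (rf_pos (Yrefining k)).
have sE : box_rad (b k) = 2 * s by rewrite /s mulrC divfK.
have sle1 : s <= 1 by apply: ltW (lt_le_trans sd (le_trans d5 e1)).
have tune := hdt _ _ _ E1 (lt_le_trans sd d3).
have E2 := step_from_tune (Ystep k.+1) E1.
have [uE [U Ur E3]] := step_from_invert (Ystep k.+2) E2.
rewrite -/y -/s in E3; rewrite -/s in tune.
set u := uprec (Y k.+2) in tune uE.
have us : u <= s by apply: le_trans tune _; rewrite ler_piMl // ltW.
have u01 : 0 < u < 1 := Yu k.+2; have [u0 _] := andP u01.
have ui : u < di by apply: le_lt_trans us (lt_le_trans sd d4).
have := hdi _ _ _ _ E2 E3 ui; rewrite Ytime /= => hU.
have ym : in_mbox m y := refining_in_mbox (Yrefining k).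
have [yr sr _] := rf_rep (Yrefining k).
have sr' : s \in rep Ar by apply: rep_div2.
have lt1 := seven_eighths R.
have du := moore_df_unit mm lt1 ym.
have [Nb Nf] := inverse_bound ym; set N := invmx (df t y) in hU Nb Nf.
have UM : cnorm U <= M.
  apply: le_trans NMM; have := cnormD (U - N) N; rewrite subrK => h.
  by apply: le_trans h _; rewrite addrC lerD // ltW // (lt_le_trans hU).
have yM : cnorm y <= M.
  apply: le_trans xM; have := cnormD (y - box_ctr m) (box_ctr m); rewrite subrK => h.
  by apply: le_trans h _; rewrite addrC lerD2l.
(* The Lipschitz lemma is used at distance 0, for its bound on the differential at [y]. *)
have [dfL _] := hL t t y y 0 tM tM yM yM (eq_ind_r (fun q => q <= 0) (lexx 0) (etrans (congr1 _ (subrr t)) (normr0 _)))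
  (eq_ind_r (fun q => q <= 0) (lexx 0) (etrans (congr1 _ (subrr y)) (cnorm0 _ _ _))).
have near_id : cnorm (1%:M - U *m df t y) <= K1 * e.
  rewrite -(mulVmx du) -/N -mulmxBl; apply: le_trans (cnorm_mulmx _ _) _.
  have hU' : cnorm (N - U) <= e by rewrite cnormB; apply: ltW.
  apply: le_trans (ler_wpM2l k00 (ler_pM (cnorm_ge0 _) (cnorm_ge0 _) hU' dfL)) _.
  by rewrite /K1 mulrA mulrAC.
(* [f t y] is written as the differential applied to the exact Newton step, on which [U *m df t y]
   acts almost as the identity. *)
have Uf : cnorm (U *m f t y) <= cnorm (N *m f t y) + k0 * K1 * e * cnorm (N *m f t y).
  have -> : U *m f t y = N *m f t y - (1%:M - U *m df t y) *m (N *m f t y).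
    by rewrite mulmxBl mul1mx opprB addrC subrK mulmxA -(mulmxA U) mulmxV // mulmx1.
  apply: le_trans (cnormD _ _) _; rewrite cnormN lerD2l; apply: le_trans (cnorm_mulmx _ _) _.
  by apply: le_trans (ler_wpM2l k00 (ler_wpM2r (cnorm_ge0 _) near_id)) _; rewrite !mulrA.
have Af : cnorm (box_mat m *m f t y) <= 1 / 64 * (1 / 8) * (2 * s).
  rewrite -sE; apply: le_trans hdelta; apply: box_norm_ge.
  by have [] := encl_valid (encl_newton_delta cF_ok cFE (Yu k) trep Arep yr).
have C1u : C1 * u <= 1 / 64 * s.
  have [s2' _] := le_one128 s2.
  by apply: le_trans (ler_wpM2l C10 tune) _; rewrite mulrA; apply: ler_wpM2r s2'; apply: ltW.
have [_ ne1] := le_one128 s1.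
have Db := residual_bound ne1 (cnorm_ge0 _) Nf Af C1u Uf.
have cb i l : cbounded (5 / 64 * s) (delta u t U y i l).
  exact: cnear_point_cbounded (hC1 u t U y u01 trep Ur yr tM UM yM i l) (cabs_cnorm _ i l) Db.
have c01 := five_bounds R.
have s01 : 0 < s <= 1 by rewrite s0.
have e01 : 0 <= K1 * e <= 1.
  by rewrite mulr_ge0 ?(ltW e0) //=; case: (le_one128 s5).
have C2s : C2 * s <= 1 / 128.
  by apply: le_trans s4; rewrite ler_wpM2l // ltW // (lt_le_trans sd).
have C2u : C2 * u <= 1 / 128 by apply: le_trans C2s; rewrite ler_wpM2l.
have total : 5 / 64 + C2 * (K1 * e + s + u) <= 1 / 8.
  by apply: five_le s3 C2s C2u; rewrite !mulrDr mulrA.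
have [/negP nt _] := step_from_refine (Ystep k.+3) E3 (@Ysome k.+4).
apply: nt; rewrite uE Ytime.
exact: (hC2 u t y s U (5 / 64) (K1 * e) u01 trep yr sr' Ur s01 tM UM yM cb c01 near_id e01 _ total).
Qed.

End RefinePhase.

(** * Bounds for certified boxes, uniform in time *)

Section UniformBounds.
Variables (R : realType) (n : nat) (Ar : interval_arith R) (F : polymx R n.+1 n 1).
Variables (cF : circuit R n.+1 n 1) (cdF : circuit R n.+1 n n) (cFdot : circuit R n.+1 n 1).
Hypotheses (cF_ok : circuit_ok Ar cF) (cdF_ok : circuit_ok Ar cdF).
Hypothesis (cFdot_ok : circuit_ok Ar cFdot).
Hypotheses (cFE : represents cF F) (cdFE : represents cdF (jacobian_x F)).
Hypothesis (cFdotE : represents cFdot (derivative_t F)).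
Variables (zeta : 'cV[R[i]]_n) (I : set R) (Z : R -> 'cV[R[i]]_n).
Hypothesis IZ : continuation F zeta I Z.
Variables (R0 : R) (cap : bool).
Hypothesis R01 : 1 <= R0.
Notation f t := (at_point F t).
Notation df t := (at_point (jacobian_x F) t).
Notation mtest := (moore_test Ar cF cdF).
Notation certified := (certified Ar cF cdF I Z R0).
Notation delta := (newton_delta Ar cF).

Lemma cbounded_corners (c : R) (X : cbox R) :
  (forall z, in_cbox X z -> cabs z <= c) -> cvalid Ar X -> cbounded c X.
Proof.
move=> h [[_ _ a] [_ _ b]].
have /h /cabs_le[] : in_cbox X (lo (bRe X) +i* lo (bIm X)).
  by split; rewrite /in_ival /= lexx.
have /h /cabs_le[] : in_cbox X (hi (bRe X) +i* hi (bIm X)).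
  by split; rewrite /in_ival /= lexx andbT.
rewrite /= !ler_norml => /andP[? ?] /andP[? ?] /andP[? ?] /andP[? ?].
by split; split.
Qed.

(* The second summand of the Krawczyk box contains 0, because the ball does. *)
Lemma moore_test_delta u t y s U rho : 0 < u < 1 -> t \in rep Ar -> 0 <= rho ->
  mbox_rep Ar (MBox y s U) -> 0 < s -> mtest u t (MBox y s U) rho ->
  forall i j, cbounded (rho * s) (delta u t U y i j).
Proof.
move=> u01 tr rho0 mr s0 test i j; have [yr sr Ur] := mr.
have tv := test_box_valid cF_ok cdF_ok cFE cdFE u01 tr mr s0.
have Kb := iffLR (box_norm_bounded tv rho0) test i j.
have [Dv _] := encl_newton_delta cF_ok cFE u01 tr Ur yr i j.
apply: (cbounded_corners _ Dv) => z zD.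
suff zK : in_cbox (krawczyk (box_arith Ar u) s U (box_at Ar u t cF (a_mx (box_arith Ar u) y))
    (box_at Ar u t cdF (a_addmx (box_arith Ar u) (a_mx (box_arith Ar u) y)
       (a_ball (box_arith Ar u) n s))) i j) (- ((s^-1)%:C * z)).
  have := in_cbox_bounded Kb zK; rewrite cabsN cabsZ gtr0_norm ?invr_gt0 //.
  by rewrite [s^-1 * _]mulrC ler_pdivrMr.
rewrite /krawczyk {1}/a_addmx mxE {1}/a_oppmx mxE mxE /=.
rewrite -[- _]addr0.
have Bv : forall i j, encloses Ar 1 (a_ball (box_arith Ar u) n s i j) ((0 : 'cV[R[i]]_n) i j).
  by apply: encl_ball => //; rewrite cnorm0 ltW.
have B1 : forall i j, encloses Ar 1 (a_ball (box_arith Ar u) n 1 i j) ((0 : 'cV[R[i]]_n) i j).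
  by apply: encl_ball; [apply: rep1 | rewrite cnorm0].
have yB := encl_addmx u01 (encl_mx u yr) Bv.
have dB := encl_circuit u01 tr cdF_ok cdFE yB.
have V := encl_addmx u01 (encl_mx u (@mxrep1 R Ar n)) (encl_oppmx u01 (encl_mulmx u01 (encl_mx u Ur) dB)).
have [Wv W0] := encl_mulmx u01 V B1 i j; have E0 : (0 : 'cV[R[i]]_n) i j = 0 by rewrite mxE.
rewrite mulmx0 E0 in W0.
apply: (cb_add_incl u01 _ Wv _ W0); first by apply: cb_neg_valid; apply: cb_div_valid.
by apply: cb_neg_incl; apply: cb_div_incl.
Qed.

Lemma certified_moore u t m : 0 < u < 1 -> t \in rep Ar -> certified u t m ->
  moore_box_at F t (1 / 8) m.
Proof. by move=> u01 tr [mr r0 test _ _ _]; apply: (moore_test_sound cF_ok cdF_ok cFE cdFE u01 tr mr r0 test). Qed.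

Lemma nine_eighths (x a b : R) : x <= a + 1 / 8 * a -> a <= b -> x <= 9 / 8 * b.
Proof. by lra. Qed.

(** With [N] the inverse of the differential at the zero, [A = N - (1%:M - A *m df) *m N], and the
    Moore condition with 1/8 bounds the second term. Certified matrices are thus bounded wherever
    [N] is. *)
Lemma certified_mat_bound u t m (M : R) : 0 < u < 1 -> t \in rep Ar -> certified u t m ->
  df t (Z t) \in unitmx -> cnorm (invmx (df t (Z t))) <= M ->
  cnorm (box_mat m) <= 9 / 8 * (2 * n%:R * M).
Proof.
move=> u01 tr ct dZ NM; have mm := certified_moore u01 tr ct.
set N := invmx _ in NM; have M0 : 0 <= M := le_trans (cnorm_ge0 _) NM.
have k0 : 0 <= 2 * n%:R * M by rewrite !mulr_ge0.
have n98 : 0 <= 9 / 8 * (2 * n%:R * M) by rewrite mulr_ge0 // divr_ge0.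
apply: cnorm_mulmx_le => // w.
have h1 := moore_deriv mm (N *m w) (ct_zero ct).
have h2 : cnorm (N *m w) <= 2 * n%:R * M * cnorm w.
  apply: le_trans (cnorm_mulmx _ _) _; rewrite -[X in _ <= X]mulrA.
  by apply: ler_wpM2l; [rewrite mulr_ge0 | apply: ler_wpM2r NM; apply: cnorm_ge0].
have E : box_mat m *m w = N *m w - (1%:M - box_mat m *m df t (Z t)) *m (N *m w).
  by rewrite mulmxBl mul1mx opprB addrC subrK mulmxA -(mulmxA (box_mat m)) mulmxV // mulmx1.
have h3 : cnorm (box_mat m *m w) <= cnorm (N *m w) + 1 / 8 * cnorm (N *m w).
  by rewrite [X in cnorm X]E; apply: le_trans (cnormD _ _) _; rewrite cnormN lerD2l.
by rewrite -(mulrA (9 / 8)); apply: nine_eighths h3 h2.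
Qed.

Lemma enlarge_sum (a x y z : R) : a = x + y + z -> x <= 1 / 64 -> y <= 1 / 64 -> z <= 1 / 64 ->
  1 / 16 + a <= 1 / 8.
Proof. by lra. Qed.

Lemma enlarge_cst : 0 <= (1 / 16 : R) <= 1 /\ 0 < (1 / 64 : R) /\ 1 / 8 < 1 :> R /\ 0 <= 1 / 8 :> R.
Proof. by split; [apply/andP; split; lra | split; [lra | split; lra]]. Qed.

(* A recomputed matrix U makes the test succeed on every small enough box, so
   the second loop of refine only stops at a radius bounded from below. *)
Lemma enlarging_passes (M : R) : 1 <= M -> exists e, exists2 sigma,
    0 < e /\ 0 < sigma <= 1 / 2 &
  forall u t m, 0 < u < 1 -> t \in rep Ar -> certified u t m ->
    `|t| <= M -> cnorm (Z t) <= M -> df t (Z t) \in unitmx -> cnorm (invmx (df t (Z t))) <= M ->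
    cnorm (box_mat m - invmx (df t (box_ctr m))) < e -> box_rad m < sigma -> u <= sigma ->
    mtest u t (MBox (box_ctr m) (2 * box_rad m) (box_mat m)) (1 / 8).
Proof.
move=> M1; pose k0 : R := 2 * n%:R; have k00 : 0 <= k0 by rewrite mulr_ge0.
have M0 : 0 <= M by lra.
pose kM := k0 * M; have kM0 : 0 <= kM by rewrite mulr_ge0.
pose M' := M + R0 + 9 / 8 * kM.
have R1 := R01.
have M'1 : 1 <= M' by rewrite /M'; lra.
have MM' : M <= M' by rewrite /M'; lra.
have MRM' : M + R0 <= M' by rewrite /M'; lra.
have kM' : 9 / 8 * kM <= M' by rewrite /M'; lra.
have [L L1 hL] := at_point_lipschitz cdF_ok cdFE M'1.
have [C C0 hC] := moore_test_passes cF_ok cdF_ok cFE cdFE M'1.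
pose K1 := k0 * L; have K10 : 0 <= K1 by rewrite mulr_ge0 //; lra.
have CK0 : 0 <= C * K1 by rewrite mulr_ge0.
have [c16 [c64 [c18 c8]]] := enlarge_cst.
pose Q := C * K1 + K1 + 2 * C; have Q0 : 0 <= Q by rewrite /Q; lra.
have [e /andP[e0 e1] Qe] := exists_small Q0 c64.
have small a : a <= Q -> a * e <= 1 / 64 by move=> aQ; apply: le_trans Qe; rewrite ler_wpM2r // ltW.
have s1 : C * K1 * e <= 1 / 64 by apply: small; rewrite /Q; lra.
have s2 : K1 * e <= 1 by apply: (@le_trans _ _ (1 / 64)); [apply: small; rewrite /Q|]; lra.
have s3 : 2 * C * e <= 1 / 64 by apply: small; rewrite /Q; lra.
exists e, (Num.min e (1 / 2)); first by rewrite e0 lt_min e0 ge_min lexx orbT; split => //; rewrite divr_gt0.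
move=> u t m u01 tr ct tM ZM dZ NM hU; rewrite lt_min => /andP[se sh]; rewrite le_min => /andP[ue _].
have [mr s0 test It Zm sR] := ct; have mm := certified_moore u01 tr ct.
have AM := le_trans (certified_mat_bound u01 tr ct dZ NM) kM'.
case: m mr s0 test Zm sR hU se sh ct mm AM => y s U mr /= s0 test Zm sR hU se sh ct mm AM.
have [yr sr Ur] := mr; rewrite /= in yr sr Ur.
have yM : cnorm y <= M'.
  apply: le_trans MRM'; have := cnormD (Z t) (y - Z t); rewrite addrC subrK => h.
  apply: le_trans h _; apply: lerD => //; rewrite cnormB; exact: le_trans Zm sR.
have ym : in_mbox (MBox y s U) y by rewrite /in_mbox /= subrr cnorm0 ltW.
have du := moore_df_unit mm c18 ym.
have tM' := le_trans tM MM'.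
have [dfL _] := hL t t y y 0 tM' tM' yM yM (eq_ind_r (fun q => q <= 0) (lexx 0) (etrans (congr1 _ (subrr t)) (normr0 _)))
  (eq_ind_r (fun q => q <= 0) (lexx 0) (etrans (congr1 _ (subrr y)) (cnorm0 _ _ _))).
have near_id : cnorm (1%:M - U *m df t y) <= K1 * e.
  rewrite -(mulVmx du) -mulmxBl; apply: le_trans (cnorm_mulmx _ _) _.
  have hU' : cnorm (invmx (df t y) - U) <= e by rewrite cnormB; apply: ltW.
  apply: le_trans (ler_wpM2l k00 (ler_pM (cnorm_ge0 _) (cnorm_ge0 _) hU' dfL)) _.
  by rewrite /K1 mulrA mulrAC.
have s20 : 0 < 2 * s <= 1.
  by rewrite mulr_gt0 //=; move: sh; rewrite ltr_pdivlMr // mulrC => /ltW.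
have sr2 : 2 * s \in rep Ar by rewrite repM // rep_nat.
have Db := moore_test_delta u01 tr c8 mr s0 test.
(* The test at radius [s] bounds the residual by [1 / 8 * s], only 1/16 of the doubled radius; the
   other 1/16 is left for the remaining terms. *)
have cb i j : cbounded (1 / 16 * (2 * s)) (delta u t U y i j).
  by rewrite (_ : 1 / 16 * (2 * s) = 1 / 8 * s) //; field.
have e01 : 0 <= K1 * e <= 1 by rewrite s2 andbT mulr_ge0 // ltW.
have Cs : C * (2 * s) <= 1 / 64.
  apply: le_trans s3; rewrite mulrA [C * 2]mulrC; apply: ler_wpM2l; [by rewrite mulr_ge0 | exact: ltW].
have Cu : C * u <= 1 / 64.
  apply: le_trans s3; apply: ler_pM => //; [by case/andP: u01 => /ltW | by rewrite ler_peMl // ler1n].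
have total : 1 / 16 + C * (K1 * e + 2 * s + u) <= 1 / 8.
  by apply: enlarge_sum s1 Cs Cu; rewrite !mulrDr mulrA.
exact: (hC u t y (2 * s) U (1 / 16) (K1 * e) u01 tr yr sr2 Ur s20 tM' AM yM cb c16 near_id e01 _ total).
Qed.

End UniformBounds.

(** * Progress of the main loop *)

Section InfiniteRun.
Variables (R : realType) (n : nat) (Ar : interval_arith R) (F : polymx R n.+1 n 1).
Variables (cF : circuit R n.+1 n 1) (cdF : circuit R n.+1 n n) (cFdot : circuit R n.+1 n 1).
Hypotheses (cF_ok : circuit_ok Ar cF) (cdF_ok : circuit_ok Ar cdF).
Hypothesis (cFdot_ok : circuit_ok Ar cFdot).
Hypotheses (cFE : represents cF F) (cdFE : represents cdF (jacobian_x F)).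
Hypothesis (cFdotE : represents cFdot (derivative_t F)).
Variables (zeta : 'cV[R[i]]_n) (I : set R) (Z : R -> 'cV[R[i]]_n).
Hypothesis IZ : continuation F zeta I Z.
Variables (R0 : R) (cap : bool).
Hypothesis R01 : 1 <= R0.
Variable run : nat -> state R n.
Notation f t := (at_point F t).
Notation df t := (at_point (jacobian_x F) t).
Notation mtest := (moore_test Ar cF cdF).
Notation step := (step Ar cF cdF cFdot cap).
Notation certified := (certified Ar cF cdF I Z R0).
Hypothesis run_step : forall k, step (run k) (run k.+1).
Hypothesis run_inv : forall k, state_invariant Ar F cF cdF I Z R0 cap (run k).
Hypothesis run_prec : precision_conventions F run.
Hypothesis not_halted : forall k, ~ halted (run k).

Let u k := uprec (run k).
Let t k := time (run k).
Let h k := stepsize (run k).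

Let u01 k : 0 < u k < 1. Proof. by case: (run_inv k). Qed.
Let trep k : t k \in rep Ar. Proof. by case: (run_inv k). Qed.
Let h0 k : 0 < h k. Proof. by case: (run_inv k) => _ _ []. Qed.
Let hrep k : h k \in rep Ar. Proof. by case: (run_inv k) => _ _ []. Qed.
Let t0 k : 0 <= t k. Proof. by case: (run_inv k) => _ _ _ []. Qed.

Lemma step_refine_pair st st' m m1 : step st st' -> refine_pair (ctl st) = Some (m, m1) ->
  (exists m', ctl st' = Enlarge m') \/
  (exists m1', refine_pair (ctl st') = Some (m, m1')) /\ time st' = time st.
Proof.
case=> {st st'}; try discriminate.
- by move=> t' h' u' m' m1' test _; left; exists m1'.
- by move=> t' h' u' m' y s U _ _ _ [-> _]; right; split => //; eexists.
- by move=> t' h' u' m' y s U _ _ _ [-> _]; right; split => //; eexists.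
- by move=> t' h' u' m' y s U _ _ _ [-> _]; right; split => //; eexists.
- by move=> t' h' u' m' y s U y' _ _ _ _ [-> _]; right; split => //; eexists.
- by move=> t' h' u' u'' m' m1' _ [-> _]; right; split => //; eexists.
- by move=> t' h' u' u'' m' m1' _ [-> _]; right; split => //; eexists.
- by move=> t' h' u' m' y s U U' _ [-> _]; right; split => //; eexists.
Qed.

(** Otherwise the tail of the run from [k] on would be an infinite refine phase; the three
    conventions pass to tails. *)
Lemma refine_reaches_enlarge k m : ctl (run k) = Refine m m ->
  exists2 k', (k <= k')%N & exists m', ctl (run k') = Enlarge m'.
Proof.
move=> E; apply: contrapT => hn.
have no k' m' : (k <= k')%N -> ctl (run k') <> Enlarge m'.
  by move=> kk E'; apply: hn; exists k' => //; exists m'.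
have all j : (exists m1, refine_pair (ctl (run (k + j))) = Some (m, m1)) /\ t (k + j) = t k.
  elim: j => [|j [[m1 IH] IHt]]; first by rewrite addn0 E; split => //; exists m.
  have [[m' E']|[e et]] := step_refine_pair (run_step (k + j)) IH.
    by case: (no (k + j).+1 m') => //; rewrite leqW // leq_addr.
  by rewrite addnS; split => //; rewrite /t et.
pose b j := odflt m (omap snd (refine_pair (ctl (run (k + j))))).
have prec := run_prec.
apply: (@refine_phase_ends R n Ar F cF cdF cFdot cF_ok cdF_ok cFE cdFE zeta I Z IZ R0 cap
  (fun j => run (k + j)) (t k) m _ _ _ b).
- by move=> j; rewrite addnS; apply: run_step.
- by move=> j; apply: run_inv.
- by move=> j; case: (all j).
- by move=> j; rewrite /b; case: (all j) => -[m1 ->].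
- by rewrite /b addn0 E.
- move=> hr e e0.
  have : uprec (run k) @[k --> \oo] --> (0 : R).
    apply: (raise_convention prec) => N; have [j Nj [m' [m1 E']]] := hr N.
    by exists (k + j)%N; [apply: leq_trans Nj (leq_addl _ _) | exists m', m1].
  move/cvgr0Pnorm_le => /(_ e e0)[N _ hN]; exists N => j Nj.
  have := hN (k + j)%N (leq_trans Nj (leq_addl _ _)).
  by rewrite /= ger0_norm //; case/andP: (u01 (k + j)) => /ltW.
- move=> e e0; have [d d0 hd] := tune_convention prec e0; exists d => // j m' m1.
  by rewrite addnS; apply: hd.
- move=> e e0; have [d d0 hd] := invert_convention prec e0; exists d => // j m' m1 m2.
  by rewrite addnS; apply: hd.
Qed.

Lemma step_from_enlarge st st' m : step st st' -> ctl st = Enlarge m ->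
  let m2 := MBox (box_ctr m) (2 * box_rad m) (box_mat m) in
  ctl st' = Enlarge m2 /\ time st' = time st \/
  ctl st' = Predict m /\ ~ (2 * box_rad m <= 1 /\ mtest (uprec st) (time st) m2 (1 / 8)).
Proof.
case=> {st st'}; try discriminate.
- by move=> t' h' u' y s U _ _ [<-] m2; left.
- by move=> t' h' u' y s U hn [<-] m2; right.
Qed.

(** Each round doubles the radius, which therefore exceeds every multiple of its first value,
    against the bound [R0]. *)
Lemma enlarge_reaches_predict k m : ctl (run k) = Enlarge m ->
  exists2 k', (k <= k')%N & exists m', ctl (run k') = Predict m'.
Proof.
move=> E; apply: contrapT => hn.
have no k' m' : (k <= k')%N -> ctl (run k') <> Predict m'.
  by move=> kk E'; apply: hn; exists k' => //; exists m'.
have r0 : 0 < box_rad m.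
  by have [_ _ _ _] := run_inv k; rewrite E => -[_ []].
have all j : exists2 m', ctl (run (k + j)) = Enlarge m' & box_rad m *+ j.+1 <= box_rad m'.
  elim: j => [|j [m' E' IH]]; first by rewrite addn0; exists m.
  have [[E2 _]|[E2 _]] := step_from_enlarge (run_step (k + j)) E'.
    rewrite addnS; eexists; first exact: E2.
    rewrite /= mulrS mulr_natl mulr2n; apply: lerD => //; apply: le_trans IH.
    by rewrite mulrS lerDl mulrn_wge0 // ltW.
  by case: (no (k + j).+1 m') => //; rewrite leqW // leq_addr.
pose j := Num.bound (R0 / box_rad m).
have [m' E' hm] := all j.
have [_ _ _ _] := run_inv (k + j); rewrite E' => -[_ [_ _ _ _ _ mR]].
have := archi_boundP (_ : 0 <= R0 / box_rad m); rewrite -/j => hj.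
have : R0 < box_rad m *+ j.+1.
  have h1 : R0 < j%:R * box_rad m.
    rewrite -ltr_pdivrMr //; apply: hj; apply: divr_ge0; [exact: le_trans ler01 R01 | exact: ltW].
  apply: lt_le_trans h1 _; rewrite -[box_rad m *+ _]mulr_natl ler_pM2r // ler_nat; exact: leqnSn.
by rewrite ltNge (le_trans hm mR).
Qed.

Lemma step_from_track st st' m : step st st' -> ctl st = Track m ->
  halted st' \/ [/\ time st < 1, time st' = time st & ctl st' = Refine m m].
Proof.
case=> {st st'}; try discriminate.
- by move=> t' h' u' m' _ [->]; left; exists m.
- by move=> t' h' u' m' t1 [->]; right.
Qed.

Lemma step_from_predict st st' m : step st st' -> ctl st = Predict m ->
  let h1 := next_stepsize cap (time st) (stepsize st) in
  [\/ [/\ stepsize st' = h1, time st' = time st + h1, uprec st' = uprec st &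
        exists2 v, ctl st' = Track (advance m v h1) & True],
      [/\ stepsize st' = h1 / 2, uprec st' <= h1 / 2, time st' = time st + h1 / 2,
          exists2 v, ctl st' = Track (advance m v (h1 / 2)) & True &
          exists2 v, is_mid Ar (tangent_box Ar cFdot (uprec st) (time st) m) v &
            ~~ model_test Ar (uprec st) (predictor_model Ar cF cdF (uprec st) (time st) h1 m v) h1] |
      [/\ stepsize st' = h1 / 2, uprec st' <= h1 / 2, time st' = time st, ctl st' = Track m &
          exists2 v, is_mid Ar (tangent_box Ar cFdot (uprec st) (time st) m) v &
            ~~ model_test Ar (uprec st) (predictor_model Ar cF cdF (uprec st) (time st) h1 m v) h1]].
Proof.
case=> {st st'}; try discriminate.
- by move=> t' h' u' m' v h1' mid test [<-] h1; constructor 1; split => //; exists v.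
- move=> t' h' u' m' v h1' h2 u2 mid test test2 [<-] h1; constructor 2; split => //.
  + by rewrite /u2 ge_min lexx orbT.
  + by exists v.
  + by exists v.
- move=> t' h' u' m' v h1' h2 u2 mid test test2 [<-] h1; constructor 3; split => //.
  + by rewrite /u2 ge_min lexx orbT.
  + by exists v.
Qed.

Lemma step_not_predict st st' : step st st' -> (forall m, ctl st <> Predict m) ->
  stepsize st' = stepsize st /\ time st' = time st.
Proof.
case=> {st st'} //.
- by move=> t' h' u' m' v h1 _ _ /(_ m').
- by move=> t' h' u' m' v h1 h2 u2 _ _ _ /(_ m').
- by move=> t' h' u' m' v h1 h2 u2 _ _ _ /(_ m').
Qed.

Lemma predict_dec (c : control R n) : (exists m, c = Predict m) \/ (forall m, c <> Predict m).
Proof. by case: c; [right|right|right|right|right|right|left; exists m|right]. Qed.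

Let t1 k : t k < 1.
Proof.
have [_ _ _ _] := run_inv k; rewrite -/(t k).
case E: (ctl (run k)) => [m|m m1|m m1|m m1|m m1|m|m|m]; try by case.
  by have [/not_halted|[]] := step_from_track (run_step k) E.
by case: (@not_halted k); exists m.
Qed.

Let track_predict k m : ctl (run k) = Track m -> exists2 k', (k <= k')%N & exists m', ctl (run k') = Predict m'.
Proof.
move=> E; have [/not_halted //|[_ _ E1]] := step_from_track (run_step k) E.
have [k1 kk1 [m1 E2]] := refine_reaches_enlarge E1.
have [k2 kk2 [m2 E3]] := enlarge_reaches_predict E2.
by exists k2; [apply: leq_trans kk2; apply: leq_trans kk1; apply: leqnSn | exists m2].
Qed.

Let predict_track k m : ctl (run k) = Predict m -> exists m', ctl (run k.+1) = Track m'.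
Proof.
by move=> /(step_from_predict (run_step k))[[_ _ _ [v -> _]]|[_ _ _ [v -> _] _]|[_ _ _ -> _]];
  eexists.
Qed.

Hypothesis started : exists m, ctl (run 0) = Track m.

Let tracks N : exists2 k, (N <= k)%N & exists m, ctl (run k) = Track m.
Proof.
elim: N => [|N [k Nk [m E]]]; first by exists 0%N.
have [k' kk' [m' E']] := track_predict E.
by exists k'.+1; [rewrite ltnS (leq_trans Nk) | apply: predict_track E'].
Qed.

Let predicts N : exists2 k, (N <= k)%N & exists m, ctl (run k) = Predict m.
Proof.
have [k Nk [m E]] := tracks N; have [k' kk' e] := track_predict E.
by exists k' => //; apply: leq_trans kk'.
Qed.

Let h1 k := next_stepsize cap (t k) (h k).

Let h1_props k : [/\ 0 < h1 k, h1 k \in rep Ar & h1 k <= 5 / 4 * h k].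
Proof. by have [] := next_stepsize_props cap (trep k) (hrep k) (h0 k) (t1 k). Qed.

(** Covers both outcomes of a failed test on the full step, acceptance of the half step and
    rejection: either way the precision drops to [h1 k / 2] or less. *)
Definition failing k (m : mbox R n) (v : 'cV[R[i]]_n) : Prop :=
  [/\ ctl (run k) = Predict m, is_mid Ar (tangent_box Ar cFdot (u k) (t k) m) v,
      u k.+1 <= h1 k / 2 &
      ~~ model_test Ar (u k) (predictor_model Ar cF cdF (u k) (t k) (h1 k) m v) (h1 k)].

Let t_mono k : t k <= t k.+1.
Proof.
have [h10 _ _] := h1_props k.
have [[m E]|nE] := predict_dec (ctl (run k)); last first.
  by have [_] := step_not_predict (run_step k) nE; rewrite /t => ->.
have := step_from_predict (run_step k) E; rewrite /= -/(h k) -/(t k) -/(h1 k).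
case=> [[_ + _ _]|[_ _ + _ _]|[_ _ + _ _]]; rewrite -/(t k.+1) => -> //.
  by rewrite lerDl ltW.
by rewrite lerDl divr_ge0 // ltW.
Qed.

Let t_le j k : (j <= k)%N -> t j <= t k.
Proof. by move=> /subnKC <-; elim: (k - j)%N => [|i IH]; rewrite ?addn0 // addnS (le_trans IH). Qed.

Let u_le j k : (j <= k)%N -> u k <= u j.
Proof.
move=> /subnKC <-; elim: (k - j)%N => [|i IH]; first by rewrite addn0.
by rewrite addnS; apply: le_trans IH; apply: step_uprec (run_step _).
Qed.

Let tsup := sup [set t k | k in [set: nat]].

Let tsup_has : has_sup [set t k | k in [set: nat]].
Proof. by split; [exists (t 0), 0%N | exists 1 => _ [k _ <-]; apply: ltW]. Qed.

Let t_tsup k : t k <= tsup.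
Proof. by apply: sup_upper_bound => //; exists k. Qed.

Let t_near (e : R) : 0 < e -> exists N, forall k, (N <= k)%N -> tsup - e < t k.
Proof.
move=> e0; have [_ [N _ <-] hN] := sup_adherent e0 tsup_has.
by exists N => k Nk; apply: lt_le_trans hN (t_le Nk).
Qed.

(** If late failing steps all had length at least [e], the step size would stay above some [c]. As
    the times converge, only rejections could occur in the end, and each shrinks the step size by a
    factor of at most [5 / 8]. *)
Lemma small_failing_step (e : R) N : 0 < e ->
  exists k, (N <= k)%N /\ exists m v, failing k m v /\ h1 k < e.
Proof.
move=> e0; apply: contrapT => hn.
have big k m v : (N <= k)%N -> failing k m v -> e <= h1 k.
  by move=> Nk fk; rewrite leNgt; apply/negP => he; apply: hn; exists k; split => //; exists m, v.
pose c := Num.min (e / 2) (h N).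
have c0 : 0 < c by rewrite lt_min divr_gt0 ?h0.
have ce : c <= e / 2 by rewrite ge_min lexx.
(* A step shortened by [cap] ends at time 1, which [t1] excludes, so an accepted full step is never
   a shortened one. *)
have full k : t k.+1 = t k + h1 k -> h1 k = 5 / 4 * h k.
  move=> tE; have := t1 k.+1; rewrite tE /h1 /next_stepsize; case: (cap) => //.
  by case: (leP (5 / 4 * h k) (1 - t k)) => // _; rewrite addrC subrK ltxx.
have hc k : (N <= k)%N -> c <= h k.
  move=> /subnKC <-; elim: (k - N)%N => [|i]; first by rewrite addn0 ge_min lexx orbT.
  rewrite addnS; move: (N + i)%N (leq_addr i N) => {k i} k Nk IH.
  have [[m E]|nE] := predict_dec (ctl (run k)); last first.
    by have [+ _] := step_not_predict (run_step k) nE; rewrite /h => ->.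
  have := step_from_predict (run_step k) E; rewrite /= -/(h k) -/(t k) -/(h1 k) -/(u k).
  case=> [[hE tE _ _]|[hE uE _ _ [v mid test]]|[hE uE _ _ [v mid test]]]; rewrite -/(h k.+1) in hE; rewrite hE.
  - by rewrite (full k tE); move: (h0 k) IH; lra.
  - have fk : failing k m v by split.
    by move: (big k m v Nk fk) ce; lra.
  - have fk : failing k m v by split.
    by move: (big k m v Nk fk) ce; lra.
have [N' hN'] := t_near c0.
pose N2 := maxn N N'.
(* Beyond [N2] less than [c] of time is left, while any acceptance advances the time by at least
   [c]. *)
have reject k m : (N2 <= k)%N -> ctl (run k) = Predict m -> h k.+1 <= 5 / 8 * h k.
  rewrite geq_max => /andP[Nk Nk'] E.
  have tk := hN' k Nk'; have tk1 := t_tsup k.+1; have [_ _ h54] := h1_props k.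
  have := step_from_predict (run_step k) E; rewrite /= -/(h k) -/(t k) -/(h1 k) -/(u k).
  case=> [[hE tE _ _]|[hE uE tE _ [v mid test]]|[hE _ _ _ [v mid test]]].
  - have fE := full k tE; have hck := hc k Nk; have h0k := h0 k; rewrite -/(t k.+1) in tE.
    by lra.
  - have fk : failing k m v by split.
    by move: (big k m v Nk fk) tE tk tk1 ce; rewrite -/(t k.+1); lra.
  - by rewrite /h hE -/(h k); move: h54; lra.
have hdec j : h (N2 + j).+1 <= h (N2 + j).
  have [[m E]|nE] := predict_dec (ctl (run (N2 + j))).
    by have := reject _ m (leq_addr _ _) E; move: (h0 (N2 + j)); lra.
  by have [+ _] := step_not_predict (run_step (N2 + j)) nE; rewrite /h => ->.
have th : 5 / 8 < 1 :> R by lra.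
have [N3 hN3] := decay_finite (a := fun j => h (N2 + j)) (fun j => ltW (h0 _))
  (fun j => eq_ind _ (fun q => h q <= h (N2 + j)) (hdec j) _ (esym (addnS N2 j))) th c0.
have [k Nk [m E]] := predicts (N2 + N3).
have N2k : (N2 <= k)%N by apply: leq_trans (leq_addr _ _) Nk.
have := hN3 (k - N2)%N; rewrite addnS subnKC // leq_subRL // Nk => /(_ isT).
have Nk' : (N <= k)%N by apply: leq_trans (leq_maxl _ _) N2k.
by move=> /(_ (hc k Nk')); rewrite ltNge (reject k m).
Qed.

(** One short failing step suffices, because [u] never increases. *)
Lemma precision_vanishes (e : R) : 0 < e -> exists N, forall k, (N <= k)%N -> u k <= e.
Proof.
move=> e0; have [k [_ [m [v [[E mid uE test] he]]]]] := small_failing_step 0 e0.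
exists k.+1 => j kj; apply: le_trans (u_le kj) _; have [h10 _ _] := h1_props k.
by lra.
Qed.

Definition recomputed e t' (m : mbox R n) :=
  cnorm (box_mat m - invmx (df t' (box_ctr m))) < e.

(** A box reaches [Enlarge] either untouched by refine, with its former radius, or with a matrix
    recomputed at its centre. In the second case the radius may be small for a while, but
    [enlarging_passes] makes it grow. *)
Definition radius_bound e rho (st : state R n) : Prop :=
  match ctl st with
  | Track m | Predict m | Raise m _ | Tune m _ | Invert m _ => rho <= box_rad m
  | Refine m m1 => rho <= box_rad m /\ (m1 = m \/ recomputed e (time st) m1)
  | Enlarge m => rho <= box_rad m \/ recomputed e (time st) m
  | Return _ => True
  end.

Lemma radius_bound_step e rho k : 
  (forall m m1 m2, ctl (run k) = Invert m m1 -> ctl (run k.+1) = Refine m m2 ->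
     recomputed e (t k) m2) ->
  (forall m, ctl (run k) = Enlarge m -> recomputed e (t k) m -> box_rad m < rho ->
     2 * box_rad m <= 1 /\ mtest (u k) (t k) (MBox (box_ctr m) (2 * box_rad m) (box_mat m)) (1 / 8)) ->
  radius_bound e rho (run k) -> radius_bound e rho (run k.+1).
Proof.
have [_ _ _ _] := run_inv k; rewrite /u /t.
move: (run k) (run k.+1) (run_step k) => st st'; case=> {st st'}.
- by [].
- by move=> t' h' u' m t1' _ _ _ ?; split; [|left].
- by move=> t' h' u' m m1 test _ _ _ [hr [->|hc]]; [left|right].
- by move=> t' h' u' m y s U _ _ _ _ _ _ [hr _].
- by move=> t' h' u' m y s U _ _ _ _ _ _ [hr _].
- by move=> t' h' u' m y s U _ _ _ _ _ _ [hr _].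
- by move=> t' h' u' m y s U y' _ _ _ _ _ _ _ [hr _].
- by [].
- by [].
- by move=> t' h' u' m y s U U' _ _ hc _ hr; split; [|right; apply: (hc m (MBox y s U))].
- move=> t' h' u' y s U s1 test [_ [_ s0 _ _ _ _]] _ _ [hr|hc]; [left|right; exact: hc].
  by apply: le_trans hr _; rewrite /= ler_peMl ?ler1n // ltW.
- move=> t' h' u' y s U hn _ _ hE; rewrite /radius_bound /= => -[//|hc].
  (* A recomputed box below [rho] would pass the test at twice its radius, so the enlarging loop
     would not have stopped. *)
  by rewrite leNgt; apply/negP => sr; apply: hn; apply: (hE (MBox y s U)).
- by [].
- by [].
- by [].
Qed.

Lemma no_infinite_run : I 1 -> False.
Proof.
move=> I1.
have T1 : tsup <= 1 by apply: ge_sup; [exact: tsup_has.1 | move=> _ [k _ <-]; apply: ltW].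
have T0 : 0 <= tsup by apply: le_trans (t_tsup 0).
(* The limit time lies between 0 and 1, hence in the interval [I]; all bounds on the path are taken
   near it. *)
have IT : I tsup.
  by apply: (cont_interval IZ (cont_mem0 IZ) I1); rewrite T0 T1.
have [d [M [d0 M1 hM]]] := continuation_bounds IZ cdF_ok cdFE IT.
have [N1 hN1] := t_near d0.
have bounds k : (N1 <= k)%N -> [/\ I (t k), `|t k| <= M, cnorm (Z (t k)) <= M,
    df (t k) (Z (t k)) \in unitmx & cnorm (invmx (df (t k) (Z (t k)))) <= M].
  move=> Nk; apply: hM; have a := hN1 k Nk; have b := t_tsup k.
  by rewrite ltr_norml; apply/andP; split; lra.
have [e [sigma [e0 /andP[sg0 sg1]] hsg]] :=
  enlarging_passes cF_ok cdF_ok cFE cdFE I Z R01 M1.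
have [di di0 hdi] := invert_convention run_prec e0.
have [N2 hN2] := precision_vanishes sg0.
have di20 : 0 < di / 2 by rewrite divr_gt0.
have [N3 hN3] := precision_vanishes di20.
(* From [K] on, the bounds near [tsup] hold and the precision suffices for [enlarging_passes] and
   for the convention on [Invert]. *)
have [K NK [mK EK]] := tracks (maxn N1 (maxn N2 N3)).
have after k : (K <= k)%N -> [/\ (N1 <= k)%N, u k <= sigma & u k < di].
  move=> Kk; have := leq_trans NK Kk; rewrite !geq_max => /and3P[a b c].
  by split => //; [exact: hN2 | have := hN3 k c; move: di0; lra].
have rK0 : 0 < box_rad mK.
  by have [_ _ _ _] := run_inv K; rewrite EK => /tracked_pos.
(* The radius at index [K] is positive but otherwise unknown; including it in the minimum starts the
   invariant. *)
pose rho := Num.min sigma (box_rad mK).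
have rho0 : 0 < rho by rewrite lt_min sg0.
have rb k : (K <= k)%N -> radius_bound e rho (run k).
  move=> /subnKC <-; elim: (k - K)%N => [|i IH].
    by rewrite addn0 /radius_bound EK ge_min lexx orbT.
  rewrite addnS; move: (K + i)%N (leq_addr i K) IH => {k i} k Kk IH.
  have [Nk us ud] := after k Kk.
  apply: radius_bound_step IH => [m m1 m2 E1 E2|m E hc hr].
    exact: hdi _ _ _ _ E1 E2 ud.
  have [_ tM ZM dZ NM] := bounds k Nk.
  have [_ _ _ _] := run_inv k; rewrite E => -[_ ct].
  have rs : box_rad m < sigma by apply: lt_le_trans hr _; rewrite ge_min lexx.
  split; last exact: (hsg (u k) (t k) m (u01 k) (trep k) ct tM ZM dZ NM hc rs us).
  by move: rs sg1; lra.
have k0 : 0 <= 9 / 8 * (2 * n%:R * M).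
  by apply: mulr_ge0; [exact: divr_ge0 | apply: mulr_ge0; [exact: mulr_ge0 | exact: le_trans ler01 M1]].
pose M2 := M + R0 + 9 / 8 * (2 * n%:R * M).
have R1 := R01.
have [a1 a2 a3] : [/\ M <= M2, M + R0 <= M2 & 9 / 8 * (2 * n%:R * M) <= M2].
  by rewrite /M2; move: (9 / 8 * _) k0 => q k0; split; lra.
have M21 : 1 <= M2 by apply: le_trans a1.
have [M3 M23 hM3] := tangent_box_bounded cFdot_ok cFdotE M21.
have M31 : 1 <= M3 by apply: le_trans M23.
have [C C0 hC] := predictor_passes cF_ok cdF_ok M31 rho0.
have i68 : 0 < 6 / 8 :> R by lra.
have C20 : 0 <= 2 * C by rewrite mulr_ge0.
have [e' /andP[e'0 e'1] Ce'] := exists_small C20 i68.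
have [N4 hN4] := precision_vanishes e'0.
(* A late failing step shorter than [e'] contradicts [predictor_passes]: the radius is at least
   [rho], and [C] times the sum of step and precision is at most [2 * C * e']. *)
have [k [Nk [m [v [[E mid _ /negP test] hk]]]]] := small_failing_step (maxn K N4) e'0.
move: Nk; rewrite geq_max => /andP[Kk Nk4].
have [Nk _ _] := after k Kk; have [_ tM ZM dZ NM] := bounds k Nk.
have := rb k Kk; rewrite /radius_bound E => rm.
have [_ _ _ _] := run_inv k; rewrite E -/(t k) -/(u k) => -[_ ct].
have [mr s0 tst It Zm mR] := ct.
have AM := le_trans (certified_mat_bound cF_ok cdF_ok cFE cdFE (u01 k) (trep k) ct dZ NM) a3.
have xM : cnorm (box_ctr m) <= M2.
  apply: le_trans a2; have := cnormD (Z (t k)) (box_ctr m - Z (t k)); rewrite addrC subrK => hx.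
  by apply: le_trans hx _; apply: lerD => //; rewrite cnormB; exact: le_trans Zm mR.
have tM2 := le_trans tM a1.
have vM := hM3 (u k) (t k) m (u01 k) (trep k) mr tM2 AM xM v mid.2.
have [h10 h1r _] := h1_props k.
apply: test; apply: (hC (u k) (t k) (h1 k) m v (u01 k) (trep k) h1r mr mid.1).
- rewrite rm /=; apply: le_trans mR _; apply: le_trans M23; apply: le_trans a2.
  by rewrite lerDr (le_trans ler01).
- exact: le_trans tM2 M23.
- exact: le_trans xM M23.
- exact: le_trans AM M23.
- exact: vM.
- by rewrite (ltW h10) (le_trans (ltW hk)).
- exact: tst.
- apply: le_trans Ce'; rewrite [2 * C]mulrC -mulrA.
  apply: ler_wpM2l => //; have := hN4 k Nk4; move: hk; rewrite -/(u k); lra.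
Qed.

End InfiniteRun.

(** * Equivalence of termination with [I 1], and correctness of the output *)

Unset Implicit Arguments.

Theorem theorem6p1 (R : realType) (n : nat) (Ar : interval_arith R)
    (F : polymx R n.+1 n 1)
    (cF : circuit R n.+1 n 1) (cdF : circuit R n.+1 n n)
    (cFdot : circuit R n.+1 n 1)
    (cF_ok : circuit_ok Ar cF) (cdF_ok : circuit_ok Ar cdF)
    (cFdot_ok : circuit_ok Ar cFdot)
    (cFE : represents cF F) (cdFE : represents cdF (jacobian_x F))
    (cFdotE : represents cFdot (derivative_t F))
    (m0 : mbox R n) (m0_rep : mbox_rep Ar m0)
    (m0_moore : moore_box_at F 0 (7 / 8) m0)
    (zeta : 'cV[R[i]]_n) (zetaE : associated_zero (at_point F 0) m0 zeta)
    (I : set R) (Z : R -> 'cV[R[i]]_n) (IZ : continuation F zeta I Z)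
    (u0 : R) (u0_unit : 0 < u0 < 1)
    (cap : bool) (run : nat -> state R n)
    (run_exec : execution Ar cF cdF cFdot cap m0 u0 run)
    (run_prec : precision_conventions F run) :
  (terminates run <-> I 1) /\
  (I 1 -> forall k m, ctl (run k) = Return m ->
    let t := time (run k) in
    [/\ 1 <= t, I t, moore_box_at F t (7 / 8) m &
        associated_zero (at_point F t) m (Z t)] /\
    (cap ->
      moore_box_at F 1 (7 / 8) m /\ associated_zero (at_point F 1) m (Z 1))).
Proof.
pose R0 := Num.max 1 (box_rad m0).
have R01 : 1 <= R0 by rewrite le_max lexx.
have [run0 run_next] := run_exec.
have start : state_invariant Ar F cF cdF I Z R0 cap (run 0%N).
  rewrite run0; split => //=.
  - exact: rep0.
  - by split; rewrite ?divr_gt0 // rep_div2 // rep1.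
  - have [r0 _] := m0_moore; have [[fz zm] _] := zetaE.
    split => //; first exact: cont_mem0 IZ.
      by rewrite (cont_init IZ); apply/in_mboxP.
    by rewrite le_max lexx orbT.
have inv k : state_invariant Ar F cF cdF I Z R0 cap (run k).
  elim: k => // k IH; have [st|[_ ->] //] := run_next k.
  exact: (step_invariant cF_ok cdF_ok cFE cdFE IZ R01 st IH).
have returned k m : ctl (run k) = Return m -> [/\ 1 <= time (run k),
    tracked Ar F I Z R0 (time (run k)) m & cap -> time (run k) <= 1].
  by move=> E; have [_ _ _ [_ tc]] := inv k; rewrite E => -[].
split.
- split=> [[k [m /returned[t1 [_ _ It _ _] _]]]|I1].
    (* The final time is in [I] and at least 1, so 1 lies between two points of an interval. *)
    by apply: (cont_interval IZ (cont_mem0 IZ) It); rewrite ler01.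
  apply: contrapT => nt.
  have nh k : ~ halted (run k) by move=> hk; apply: nt; exists k.
  have st k : step Ar cF cdF cFdot cap (run k) (run k.+1).
    by have [//|[/nh]] := run_next k.
  apply: (no_infinite_run cF_ok cdF_ok cFdot_ok cFE cdFE cFdotE IZ R01 st inv run_prec nh _ I1).
  by exists m0; rewrite run0.
move=> _ k m /returned[t1 [mr mm It Zm _] tc] t.
have s1 : 7 / 8 < 1 :> R := seven_eighths R.
have az : associated_zero (at_point F t) m (Z t).
  exact: (moore_associated mm s1 Zm (cont_zero IZ It)).
split; first by split; [exact: t1 | exact: It | exact: mm | exact: az].
(* With [cap] the invariant keeps the time at most 1, so the final time is exactly 1. *)
move=> /tc t1'; have tE : t = 1 by apply/eqP; rewrite eq_le t1' t1.
exact: (eq_ind t (fun s => moore_box_at F s (7 / 8) m /\ associated_zero (at_point F s) m (Z s))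
  (conj mm az) 1 tE).
Qed.
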